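(* Let $F:\mathcal H\to\mathcal K$ be a frame operator and let $\{H_r\}$ be a path of self-adjoint operators, $H_r=H_0+V_r$, $V_r=F^*J_rF$, where each $J_r$ is a bounded self-adjoint operator on $\mathcal K$, $J_0=0$, and $r\mapsto J_r\in\mathcal B(\mathcal K)$ is continuous and piecewise real-analytic. For any $\lambda\in\Lambda(H_r;F)\cap\Lambda(H_0;F)$ the stationary formula for the scattering matrix holds: $$S(\lambda;H_r,H_0)=1_\lambda-2\pi i\,\mathcal E_\lambda(H_0)V_r\big(1+R_{\lambda+i0}(H_0)V_r\big)^{-1}\mathcal E^\diamondsuit_\lambda(H_0),$$ where $1_\lambda$ is the identity operator on $\mathfrak h_\lambda(H_0)$.
   Context: Inner products are linear in the second variable; $R_z(H)=(H-z)^{-1}$; $\operatorname{Im}T=(T-T^* )/2i$. $\mathcal H,\mathcal K$ are complex separable Hilbert spaces. Piecewise real-analytic: there is an increasing sequence $(r_j)$ without finite accumulation points such that $J$ restricted to each $[r_{j-1},r_j]$ extends analytically in norm to a neighbourhood of it. Frame: $F=\sum_j\kappa_j\langle\varphi_j,\cdot\rangle\psi_j$, with $(\kappa_j)\in\ell_2$ a decreasing sequence of positive numbers, $(\varphi_j)$, $(\psi_j)$ orthonormal bases of $\mathcal H$, $\mathcal K$. $|F|=\sqrt{F^*F}$. For $\alpha=\pm1$, $\mathcal H_\alpha$ is the completion of $\operatorname{span}\{\varphi_j\}$ in the norm $\||F|^{-\alpha}f\|$; $\mathcal H_1\subset\mathcal H\subset\mathcal H_{-1}$, and $\langle\cdot,\cdot\rangle_{\pm1,\mp1}$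 is the pairing extending $\langle\cdot,\cdot\rangle$. $V_r$ is regarded as a bounded operator $\mathcal H_{-1}\to\mathcal H_1$. $\Lambda(H;F)$ is the set of $\lambda\in\mathbb R$ such that, as $y\to0^+$, $FR_{\lambda+iy}(H)F^*$ converges in operator norm and $F\operatorname{Im}R_{\lambda+iy}(H)F^*$ converges in trace-class norm. For such $\lambda$ the limits $R_{\lambda\pm i0}(H):\mathcal H_1\to\mathcal H_{-1}$ of $R_{\lambda\pm iy}(H)$ exist. The operator $1+R_{\lambda+i0}(H_0)V_r$ acts on $\mathcal H_{-1}$. Evaluation operator: for $\lambda\in\Lambda(H;F)$ let $\phi(\lambda)=\frac1\pi\big(\kappa_i\kappa_j\langle\varphi_i,\operatorname{Im}R_{\lambda+i0}(H)\varphi_j\rangle\big)_{i,j}$, a non-negative trace-class operator on $\ell_2$, $\eta(\lambda)=\sqrt{\phi(\lambda)}$, and $\eta_j(\lambda)\in\ell_2$ the $j$-th column of $\eta(\lambda)$. Then $\mathcal E_\lambda(H):\mathcal H_1\to\ell_2$ is the Hilbert–Schmidt operator $\sum_j\beta_j\kappa_j\varphi_j\mapsto\sum_j\beta_j\eta_j(\lambda)$, $(\beta_j)\in\ell_2$; $\mathfrak h_\lambda(H)\subset\ell_2$ is the closure of its range; $\mathcal E^\diamondsuit_\lambda(H):\mathfrak h_\lambda(H)\to\mathcal H_{-1}$ is defined by $\langle\mathcal E_\lambda^\diamondsuit u,g\rangle_{-1,1}=\langle u,\mathcal E_\lambda g\rangle$. Wave and scattering matrices: $\mathfrak a_\pm(\lambda;H_r,H_0):\mathcal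 H_1\to\mathcal H_{-1}$ is the trace-class limit, as $y\to0^+$, of $\frac y\pi R_{\lambda\mp iy}(H_r)R_{\lambda\pm iy}(H_0)$; $w_\pm(\lambda;H_r,H_0):\mathfrak h_\lambda(H_0)\to\mathfrak h_\lambda(H_r)$ is the bounded operator with $\langle\mathcal E_\lambda(H_r)f,w_\pm\mathcal E_\lambda(H_0)g\rangle=\langle f,\mathfrak a_\pm(\lambda;H_r,H_0)g\rangle_{1,-1}$ for all $f,g\in\mathcal H_1$; and $S(\lambda;H_r,H_0)=w_+^*(\lambda;H_r,H_0)w_-(\lambda;H_r,H_0)$. *)

(* Defs.v *)
From HB Require Import structures.
From mathcomp Require Import all_boot all_order all_algebra.
From mathcomp Require Import all_classical all_reals.
From mathcomp Require Import ereal topology tvs normedtype sequences trigo.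
From mathcomp Require Import complex.
From mathcomp Require Import ring lra.
Set Implicit Arguments.
Unset Strict Implicit.
Unset Printing Implicit Defensive.
Import Order.TTheory GRing.Theory Num.Theory numFieldNormedType.Exports.
Local Open Scope classical_set_scope.
Local Open Scope ring_scope.
Local Open Scope complex_scope.

(* Norms over R[i] take values in R[i]; [nrm] reads them in R. *)
Definition nrm (R : realType) (V : normedZmodType R[i]) (x : V) : R :=
  complex.Re `|x|.

HB.mixin Record isInnerProduct (R : realType) H & NormedModule R[i] H := {
  ip : H -> H -> R[i];
  ip_linear : forall x (a : R[i]) (y z : H),
    ip x (a *: y + z) = a * ip x y + ip x z;
  ip_conj : forall x y, ip y x = (ip x y)^*;
  ip_norm : forall x, `|x| ^+ 2 = ip x x
}.

#[short(type="preHilbertType")]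
HB.structure Definition PreHilbert (R : realType) :=
  {H of NormedModule R[i] H & isInnerProduct R H}.

#[short(type="hilbertType")]
HB.structure Definition Hilbert (R : realType) :=
  {H of CompleteNormedModule R[i] H & PreHilbert R H}.

HB.factory Record Lmodule_isPreHilbert (R : realType) H & GRing.Lmodule R[i] H := {
  form : H -> H -> R[i];
  form_linear : forall x (a : R[i]) (y z : H),
    form x (a *: y + z) = a * form x y + form x z;
  form_conj : forall x y, form y x = (form x y)^*;
  form_ge0 : forall x, 0 <= form x x;
  form_eq0 : forall x, form x x = 0 -> x = 0
}.

HB.builders Context R H & Lmodule_isPreHilbert R H.

Let q x : R := complex.Re (form x x).

Let qE x : form x x = (q x)%:C.
Proof.
by rewrite /q; move: (form_ge0 x); rewrite lecE => /andP[/eqP]; case: (form x x) => a b /= ->.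
Qed.

Let q_ge0 x : 0 <= q x.
Proof. by rewrite -ler0c -qE form_ge0. Qed.

Let formD x y z : form x (y + z) = form x y + form x z.
Proof. by have := form_linear x 1 y z; rewrite scale1r mul1r. Qed.

Let form0 x : form x 0 = 0.
Proof. by apply: (addrI (form x 0)); rewrite -formD !addr0. Qed.

Let formZ x a y : form x (a *: y) = a * form x y.
Proof. by have := form_linear x a y 0; rewrite form0 !addr0. Qed.

Let formDl x y z : form (x + y) z = form x z + form y z.
Proof. by rewrite form_conj formD rmorphD/= -!form_conj. Qed.

Let formZl a x y : form (a *: x) y = a^* * form x y.
Proof. by rewrite form_conj formZ rmorphM/= -form_conj. Qed.

Let qD x y : q (x + y) = q x + q y + 2 * complex.Re (form x y).
Proof.
rewrite /q formD !formDl (form_conj x y).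
case: (form x x) (form x y) (form y y) => [a b] [c d] [e f] /=; lra.
Qed.

Let qZ a x : q (a *: x) = nrm a ^+ 2 * q x.
Proof.
rewrite /q formZ formZl qE mulrA /nrm normc_def /=.
rewrite sqr_sqrtr ?addr_ge0 ?sqr_ge0//.
by case: a => a b /=; rewrite /q; move: (complex.Re _) => t; ring.
Qed.

Let CS x y : complex.Re (form x y) <= Num.sqrt (q x) * Num.sqrt (q y).
Proof.
have [/eqP qx0|qx0] := boolP (q x == 0).
  have -> : x = 0 by apply: form_eq0; rewrite qE qx0.
  by rewrite form_conj form0 /= mulr_ge0 ?sqrtr_ge0.
have qx : 0 < q x by rewrite lt0r qx0 q_ge0.
pose c := complex.Re (form x y).
have [c0|c0] := leP c 0.
  by rewrite -/c (le_trans c0)// mulr_ge0 ?sqrtr_ge0.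
rewrite -/c -sqrtrM// -[c]gtr0_norm// -sqrtr_sqr ler_sqrt ?mulr_ge0//.
have := q_ge0 ((- (c / q x))%:C *: x + y).
rewrite qD qZ formZl /nrm normc_def/= expr0n/= addr0 sqr_sqrtr ?sqr_ge0//.
have -> : complex.Re ((- (c / q x) -i* 0) * form x y) = - (c / q x) * c.
  by rewrite /c; case: (form x y) => a b /=; ring.
have -> : (- (c / q x)) ^+ 2 * q x + q y + 2 * (- (c / q x) * c) =
   (q x * q y - c ^+ 2) / q x by field.
by rewrite pmulr_lge0 ?invr_gt0// subr_ge0.
Qed.

Let norm x : R[i] := (Num.sqrt (q x))%:C.

Let normD x y : norm (x + y) <= norm x + norm y.
Proof.
rewrite -rmorphD lecR -[leRHS]ger0_norm ?addr_ge0 ?sqrtr_ge0//.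
rewrite -sqrtr_sqr ler_sqrt ?sqr_ge0// qD sqrrD !sqr_sqrtr//.
by have := CS x y; rewrite -mulr_natl; lra.
Qed.

Let normZ (l : R[i]) (x : H) : norm (l *: x) = `|l| * norm x.
Proof.
rewrite /norm qZ sqrtrM ?sqr_ge0// sqrtr_sqr ger0_norm ?rmorphM/=; last first.
  by rewrite /nrm normc_def/= sqrtr_ge0.
by rewrite /nrm normc_def.
Qed.

Let norm0_eq0 x : norm x = 0 -> x = 0.
Proof.
move=> /complexI /eqP; rewrite sqrtr_eq0 => qx; apply: form_eq0; rewrite qE.
by congr _%:C; apply/eqP; rewrite eq_le qx q_ge0.
Qed.

HB.instance Definition _ := Lmodule_isNormed.Build R[i] H normD normZ norm0_eq0.

Let norm_form (x : H) : `|x| ^+ 2 = form x x.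
Proof. rewrite -[`|x|]/(norm x) /norm qE -rmorphXn; congr _%:C; exact: sqr_sqrtr. Qed.

HB.instance Definition _ :=
  isInnerProduct.Build R H form_linear form_conj norm_form.

HB.end.

Section BoundedOperators.
Variables (R : realType) (U V : normedModType R[i]).

Definition bounded_op : {pred U -> V} :=
  fun f => `[< linear f /\ continuous f >].

Fact bounded_op_submod_closed : submod_closed bounded_op.
Proof.
split; first by apply/asboolP; split=> [a x y|x]; [rewrite scaler0 addr0|exact: cvg_cst].
move=> a f g /asboolP[flin fcont] /asboolP[glin gcont]; apply/asboolP; split.
  move=> b x y; rewrite !fctE flin glin !scalerDr !scalerA (mulrC a b).
  by rewrite addrACA.
by move=> x; apply: cvgD; [apply: cvgZr; exact: fcont|exact: gcont].
Qed.

HB.instance Definition _ := GRing.isSubmodClosed.Build _ _ bounded_op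
  bounded_op_submod_closed.

Record bop := Bop { bop_fun :> U -> V; _ : bop_fun \in bounded_op }.

HB.instance Definition _ := [isSub for bop_fun].
HB.instance Definition _ := [Choice of bop by <:].
HB.instance Definition _ := [SubChoice_isSubLmodule of bop by <:].

Definition mkbop (f : U -> V) (flin : linear f) (fcont : continuous f) : bop :=
  Bop (asboolT (conj flin fcont)).

Lemma bop_linear (f : bop) : linear f.
Proof. by case: f => f /= /asboolP[]. Qed.

Lemma bop_continuous (f : bop) : continuous f.
Proof. by case: f => f /= /asboolP[]. Qed.

End BoundedOperators.
Arguments bop {R} U V.
Notation "''B' ( U , V )" := (bop U V)
  (at level 8, format "''B' ( U ,  V )") : type_scope.

Definition bid (R : realType) (U : normedModType R[i]) : 'B(U, U) :=
  mkbop (f := @idfun U) (fun _ _ _ => erefl) (fun x => @cvg_id _ (nbhs x)).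

Section Composition.
Variables (R : realType) (U V W : normedModType R[i]).
Variables (g : 'B(V, W)) (f : 'B(U, V)).

Fact bcomp_linear : linear (g \o f).
Proof. by move=> a x y; rewrite /= !bop_linear. Qed.

Fact bcomp_continuous : continuous (g \o f).
Proof. by move=> x; apply: continuous_comp; exact: bop_continuous. Qed.

Definition bcomp : 'B(U, W) := mkbop bcomp_linear bcomp_continuous.

End Composition.
Infix "\ob" := bcomp (at level 40, left associativity) : ring_scope.

Section ComplexSeries.
Variable R : realType.
Implicit Types u v : nat -> R[i].

Definition csum u : R[i] :=
  limn (series (fun j => complex.Re (u j)))
    +i* limn (series (fun j => complex.Im (u j))).

Definition csummable u :=
  cvgn (series (fun j => complex.Re (u j))) /\
  cvgn (series (fun j => complex.Im (u j))).

Lemma csumMD (a : R[i]) u v : csummable u -> csummable v ->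
  csum (fun j => a * u j + v j) = a * csum u + csum v.
Proof.
case: a => x y [ru iu] [rv iv].
have lin (f g h : nat -> R) (c d : R) :
    cvgn (series f) -> cvgn (series g) -> cvgn (series h) ->
  limn (series (fun j => c * f j + d * g j + h j)) =
  c * limn (series f) + d * limn (series g) + limn (series h).
  move=> cf cg ch; apply/cvg_lim => //.
  have -> : series (fun j => c * f j + d * g j + h j) =
    (fun n => c * series f n + d * series g n + series h n).
    by apply/funext => n; rewrite /series/= !mulr_sumr -!big_split.
  by apply: cvgD => //; apply: cvgD; apply: cvgMr.
rewrite /csum; have [-> ->] :
    limn (series (fun j => complex.Re ((x +i* y) * u j + v j))) =
      x * limn (series (fun j => complex.Re (u j)))
        + (- y) * limn (series (fun j => complex.Im (u j)))
        + limn (series (fun j => complex.Re (v j))) /\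
    limn (series (fun j => complex.Im ((x +i* y) * u j + v j))) =
      x * limn (series (fun j => complex.Im (u j)))
        + y * limn (series (fun j => complex.Re (u j)))
        + limn (series (fun j => complex.Im (v j))).
  rewrite -!lin//; split; congr (limn (series _)); apply/funext => j;
    by case: (u j) (v j) => [a b] [c d] /=; ring.
by simpc; congr (_ +i* _); ring.
Qed.

Lemma csum_conj u : csummable u -> csum (fun j => (u j)^*) = (csum u)^*.
Proof.
move=> [_ iu]; rewrite /csum /=; congr (_ +i* _).
  by congr (limn (series _)); apply/funext => j; case: (u j).
rewrite -limN//; congr (limn _); apply/funext => n.
rewrite -[RHS]/(- (\sum_(0 <= k < n) complex.Im (u k))) -sumrN.
by apply: eq_bigr => j _; case: (u j).
Qed.

End ComplexSeries.

Section WeightedSequences.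
Variable R : realType.
Implicit Types w : nat -> {posnum R}.

Definition l2_summable w : {pred nat -> R[i]} :=
  fun c => `[< cvgn (series (fun j => ((w j)%:num * nrm (c j)) ^+ 2)) >].

Let nrmE (z : R[i]) : nrm z ^+ 2 = complex.Re z ^+ 2 + complex.Im z ^+ 2.
Proof. by rewrite /nrm normc_def /= sqr_sqrtr ?addr_ge0 ?sqr_ge0. Qed.

Fact l2_submod_closed w : submod_closed (l2_summable w).
Proof.
split.
  apply/asboolP; rewrite (_ : series _ = cst 0); first exact: is_cvg_cst.
  apply/funext => n; rewrite /series/= big1// => j _.
  by rewrite /nrm normr0 /= mulr0 expr0n.
move=> a c d /asboolP cc /asboolP cd; apply/asboolP.
pose v := (fun j => 2 * nrm a ^+ 2 * ((w j)%:num * nrm (c j)) ^+ 2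
              + 2 * ((w j)%:num * nrm (d j)) ^+ 2).
apply: (@series_le_cvg _ _ v) => [j|j|j|].
- by apply: sqr_ge0.
- by apply: addr_ge0; rewrite mulr_ge0 ?sqr_ge0// mulr_ge0 ?sqr_ge0.
- rewrite /v -[(a *: c + d) j]/(a * c j + d j) !exprMn !nrmE.
  have := sqr_ge0 (complex.Re (a * c j) - complex.Re (d j)).
  have := sqr_ge0 (complex.Im (a * c j) - complex.Im (d j)).
  have w2 : 0 <= ((w j)%:num : R) ^+ 2 by rewrite sqr_ge0.
  move: ((w j)%:num ^+ 2) w2 => W W0.
  move: (a) (c j) (d j) => [a1 a2] [c1 c2] [d1 d2] /= h1 h2.
  rewrite mulrCA [2 * (W * _)]mulrCA -mulrDr ler_wpM2l//.
  lra.
rewrite (_ : series v = (fun n => 2 * nrm a ^+ 2 *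
  series (fun j => ((w j)%:num * nrm (c j)) ^+ 2) n +
  2 * series (fun j => ((w j)%:num * nrm (d j)) ^+ 2) n)).
  by apply: is_cvgD; apply: is_cvgMr; [exact: cc|exact: cd].
by apply/funext => n; rewrite /series /= !mulr_sumr -big_split.
Qed.

HB.instance Definition _ w := GRing.isSubmodClosed.Build _ _ (l2_summable w)
  (l2_submod_closed w).

Record wl2 w := WL2 { wl2_val :> nat -> R[i]; _ : wl2_val \in l2_summable w }.

HB.instance Definition _ w := [isSub for @wl2_val w].
HB.instance Definition _ w := [Choice of wl2 w by <:].
HB.instance Definition _ w := [SubChoice_isSubLmodule of wl2 w by <:].

End WeightedSequences.

Section WeightedSequencesHilbert.
Variables (R : realType) (w : nat -> {posnum R}).
Implicit Types c d e : wl2 w.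

Let W j : R := (w j)%:num ^+ 2.
Let sq (z : R[i]) : R := complex.Re z ^+ 2 + complex.Im z ^+ 2.

Let W_gt0 j : 0 < W j. Proof. exact: exprn_gt0. Qed.
Let W_ge0 j : 0 <= W j. Proof. exact/ltW/W_gt0. Qed.
Let sq_ge0 z : 0 <= sq z. Proof. by rewrite addr_ge0 ?sqr_ge0. Qed.

Let nrmE (z : R[i]) j : ((w j)%:num * nrm z) ^+ 2 = W j * sq z.
Proof.
by rewrite exprMn /nrm normc_def /= sqr_sqrtr ?addr_ge0 ?sqr_ge0.
Qed.

Let wsq (c : nat -> R[i]) j : R := W j * sq (c j).

Let wsq_ge0 (c : nat -> R[i]) j : 0 <= wsq c j. Proof. by rewrite mulr_ge0. Qed.

Let summableP (c : nat -> R[i]) : c \in l2_summable w <-> cvgn (series (wsq c)).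
Proof.
have E : series (wsq c) = series (fun j => ((w j)%:num * nrm (c j)) ^+ 2).
  by congr series; apply/funext => j; rewrite nrmE.
by rewrite E; split => [/asboolP|?]; [|apply/asboolP].
Qed.

Let wl2P c : cvgn (series (wsq c)).
Proof. by apply/summableP; case: c. Qed.

Definition wl2_form c d : R[i] :=
  csum (fun j => ((w j)%:num ^+ 2)%:C * ((c j)^* * d j)).

Let form_summable c d :
  csummable (fun j => ((w j)%:num ^+ 2)%:C * ((c j)^* * d j)).
Proof.
have S : cvgn (series (fun j => wsq c j + wsq d j)).
  rewrite (_ : series _ = series (wsq c) + series (wsq d)).
    by apply: is_cvgD; exact: wl2P.
  by apply/funext => n; rewrite /series /= big_split.
split; apply: normed_cvg; apply: series_le_cvg S => j.
- exact: normr_ge0.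
- by rewrite addr_ge0.
- rewrite /wsq -mulrDr /= /sq; case: (c j) (d j) => [a b] [x y] /=.
  rewrite mul0r subr0 normrM (ger0_norm (W_ge0 j)) ler_wpM2l//.
  rewrite ler_norml; apply/andP; split.
    have := sqr_ge0 (a + x); have := sqr_ge0 (b + y).
    have := sqr_ge0 (a - x); have := sqr_ge0 (b - y); lra.
  have := sqr_ge0 (a + x); have := sqr_ge0 (b + y).
  have := sqr_ge0 (a - x); have := sqr_ge0 (b - y); lra.
- exact: normr_ge0.
- by rewrite addr_ge0.
- rewrite /wsq -mulrDr /= /sq; case: (c j) (d j) => [a b] [x y] /=.
  rewrite mul0r addr0 normrM (ger0_norm (W_ge0 j)) ler_wpM2l//.
  rewrite ler_norml; apply/andP; split.
    have := sqr_ge0 (a + y); have := sqr_ge0 (b + x).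
    have := sqr_ge0 (a - y); have := sqr_ge0 (b - x); lra.
  have := sqr_ge0 (a + y); have := sqr_ge0 (b + x).
  have := sqr_ge0 (a - y); have := sqr_ge0 (b - x); lra.
Qed.

Fact wl2_form_linear c (a : R[i]) d e :
  wl2_form c (a *: d + e) = a * wl2_form c d + wl2_form c e.
Proof.
rewrite /wl2_form -csumMD; [|exact: form_summable..].
congr csum; apply/funext => j.
rewrite -[(a *: d + e) j]/(a * d j + e j); ring.
Qed.

Fact wl2_form_conj c d : wl2_form d c = (wl2_form c d)^*.
Proof.
rewrite /wl2_form -csum_conj; last exact: form_summable.
congr csum; apply/funext => j.
by rewrite !rmorphM/= conjcK oppr0 [_^* * _]mulrC.
Qed.

Fact wl2_formE c : wl2_form c c = (limn (series (wsq c)))%:C.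
Proof.
rewrite /wl2_form /csum; congr (_ +i* _).
  congr (limn (series _)); apply/funext => j.
  by rewrite /wsq /sq; case: (c j) => a b /=; rewrite mul0r subr0 mulNr opprK -!expr2.
rewrite (_ : series _ = cst 0) ?lim_cst//; apply/funext => n.
rewrite /series/= big1// => j _; case: (c j) => a b /=; ring.
Qed.

Let wl2_form_ge c n : series (wsq c) n <= limn (series (wsq c)).
Proof.
apply: nondecreasing_cvgn_le; last exact: wl2P.
exact: nondecreasing_series.
Qed.

Fact wl2_form_ge0 c : 0 <= wl2_form c c.
Proof.
rewrite wl2_formE ler0c (le_trans _ (wl2_form_ge c 0))//.
by rewrite /series/= big_geq.
Qed.

Fact wl2_form_eq0 c : wl2_form c c = 0 -> c = 0.
Proof.
rewrite wl2_formE => -[lim0]; apply/val_inj/funext => j /=.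
suff : c j = 0 by [].
have : wsq c j <= 0.
  rewrite -lim0 (le_trans _ (wl2_form_ge c j.+1))//.
  by rewrite seriesSr/= lerDr sumr_ge0.
rewrite pmulr_rle0 // /sq.
case: (c j) => a b /=; have := sqr_ge0 a; have := sqr_ge0 b => b0 a0 ab.
have /eqP : a ^+ 2 = 0 by lra.
have /eqP : b ^+ 2 = 0 by lra.
by rewrite !sqrf_eq0 => /eqP-> /eqP->.
Qed.

HB.instance Definition _ := @Lmodule_isPreHilbert.Build R (wl2 w)
  wl2_form wl2_form_linear wl2_form_conj wl2_form_ge0 wl2_form_eq0.

Let norm2 c : `|c| ^+ 2 = (limn (series (wsq c)))%:C.
Proof. by rewrite ip_norm -wl2_formE. Qed.

Let norm_le c (x : R) : 0 <= x ->
  (forall n, series (wsq c) n <= x ^+ 2) <-> `|c| <= x%:C.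
Proof.
move=> x0; rewrite -[`|c| <= _](@ler_pXn2r _ 2)// ?nnegrE ?ler0c//.
rewrite norm2 -rmorphXn lecR; split=> [cx|cx n].
  by apply: limr_le; [exact: wl2P|exact: nearW].
exact: le_trans (wl2_form_ge c n) cx.
Qed.

Fact wl2_complete (F : set_system (wl2 w)) :
  ProperFilter F -> cauchy F -> cvg F.
Proof.
move=> FF /cauchy_ballP Fc.
have Fcauchy (e : R) : 0 < e -> \forall x & y \near F, `|x - y| <= e%:C.
  move=> e0; have e0C : 0 < e%:C :> R[i] by rewrite ltcR.
  by near do apply: ltW; have := Fc _ e0C; rewrite -ball_normE.
have coord j (x : wl2 w) (e : R) : 0 < e -> `|x| <= (e * (w j)%:num)%:C ->
    `|complex.Re (x j)| <= e /\ `|complex.Im (x j)| <= e.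
  move=> e0 /norm_le => /(_ (mulr_ge0 (ltW e0) (ge0 _)))/(_ j.+1).
  rewrite seriesSr/= => xe.
  have : wsq x j <= (e * (w j)%:num) ^+ 2.
    by apply: le_trans xe; rewrite lerDr sumr_ge0.
  rewrite /wsq exprMn mulrC ler_pM2r// /sq => {}xe.
  split; rewrite -(@ler_pXn2r _ 2) ?nnegrE ?(ltW e0)// real_normK ?num_real//.
    by apply: le_trans xe; rewrite lerDl sqr_ge0.
  by apply: le_trans xe; rewrite lerDr sqr_ge0.
have Rc j : cvg ((fun x : wl2 w => complex.Re (x j)) @ F).
  apply: cauchy_cvg; apply/cauchy_ballP => e e0; near_simpl.
  have e2 : 0 < e / 2 by rewrite divr_gt0.
  have ew : 0 < e / 2 * (w j)%:num by rewrite mulr_gt0.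
  apply: filterS (Fcauchy _ ew) => -[x y] /=; rewrite -ball_normE /=.
  move/coord => /(_ e2)[+ _]; rewrite -[(x - y) j]/(x j - y j) raddfB/=.
  by move=> h; rewrite (le_lt_trans h)// ltr_pdivrMr// ltr_pMr// ltr1n.
have Ic j : cvg ((fun x : wl2 w => complex.Im (x j)) @ F).
  apply: cauchy_cvg; apply/cauchy_ballP => e e0; near_simpl.
  have e2 : 0 < e / 2 by rewrite divr_gt0.
  have ew : 0 < e / 2 * (w j)%:num by rewrite mulr_gt0.
  apply: filterS (Fcauchy _ ew) => -[x y] /=; rewrite -ball_normE /=.
  move/coord => /(_ e2)[_ +]; rewrite -[(x - y) j]/(x j - y j) raddfB/=.
  by move=> h; rewrite (le_lt_trans h)// ltr_pdivrMr// ltr_pMr// ltr1n.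
pose a j : R[i] := lim ((fun x : wl2 w => complex.Re (x j)) @ F) +i*
                   lim ((fun x : wl2 w => complex.Im (x j)) @ F).
have sqc (x : nat -> R[i]) j :
    (fun y : wl2 w => sq (x j - y j)) y @[y --> F] --> sq (x j - a j).
  have re : complex.Re (x j - y j) @[y --> F] --> complex.Re (x j - a j).
    rewrite !raddfB/=.
    under eq_fun do rewrite raddfB/=.
    by apply: cvgB; [exact: cvg_cst|exact: Rc].
  have im : complex.Im (x j - y j) @[y --> F] --> complex.Im (x j - a j).
    rewrite !raddfB/=.
    under eq_fun do rewrite raddfB/=.
    by apply: cvgB; [exact: cvg_cst|exact: Ic].
  by rewrite /sq !expr2; under eq_fun do rewrite !expr2; apply: cvgD; apply: cvgM.
have bnd (x : wl2 w) (e : R) : 0 < e ->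
    (\forall y \near F, `|x - y| <= e%:C) ->
    forall n, series (wsq (fun j => x j - a j)) n <= e ^+ 2.
  move=> e0 xy n.
  have sc : series (wsq (fun j => x j - y j)) n @[y --> F] -->
      series (wsq (fun j => x j - a j)) n.
    elim: n => [|n IHn].
      rewrite /series/= big_geq//; under eq_fun do rewrite big_geq//.
      exact: cvg_cst.
    rewrite seriesSr; under eq_fun do rewrite seriesSr.
    by apply: cvgD => //; apply: cvgMr; exact: sqc.
  rewrite -(cvg_lim _ sc)//; apply: limr_le; first by apply/cvg_ex; eexists; exact: sc.
  by apply: filterS xy => y; move/norm_le; apply; exact: ltW.
have {Fcauchy} Fx (e : R) : 0 < e ->
    \forall x \near F, \forall y \near F, `|x - y| <= e%:C.
  by move=> e0; apply: nearP_dep; exact: Fcauchy.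
near F => x0.
have x0P : forall n, series (wsq (fun j => x0 j - a j)) n <= 1 ^+ 2.
  by apply: bnd => //; near: x0; apply: Fx.
have da : (fun j => x0 j - a j) \in l2_summable w.
  apply/summableP; apply: nondecreasing_is_cvgn.
    by apply: nondecreasing_series => j _ _; exact: wsq_ge0.
  by exists (1 ^+ 2) => _ [n _ <-].
have al2 : a \in l2_summable w.
  have -> : a = (x0 : nat -> R[i]) - (fun j => x0 j - a j).
    by apply/funext => j; rewrite !fctE opprB addrC subrK.
  by rewrite rpredB//; case: (x0).
apply/cvg_ex; exists (WL2 al2); apply/cvgrPdist_le => e e0.
have eR : e = (complex.Re e)%:C.
  by apply/esym/RRe_real; exact: gtr0_real.
have e0R : 0 < complex.Re e by rewrite -ltcR -eR.
rewrite eR; near=> x; rewrite distrC; apply/norm_le; first exact: ltW.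
by apply: bnd => //; near: x; exact: (Fx _ e0R).
Unshelve. all: by end_near. Qed.

HB.instance Definition _ := Uniform_isComplete.Build (wl2 w) wl2_complete.

Fact wl2_delta_subproof j : (fun i => (i == j)%:R) \in l2_summable w.
Proof.
apply/summableP; apply/cvg_ex; exists (W j).
apply: cvg_near_cst; exists j.+1 => // n /= jn.
rewrite /series/= (bigD1_seq j) ?mem_index_iota ?iota_uniq//= big1; last first.
  by move=> i ij; rewrite /wsq (negbTE ij) /sq /= expr0n addr0 mulr0.
by rewrite /wsq eqxx /sq /= expr1n expr0n !addr0 mulr1.
Qed.

Definition wl2_delta j : wl2 w := WL2 (wl2_delta_subproof j).

End WeightedSequencesHilbert.

Section ClosedRange.
Variables (R : realType) (U V : hilbertType R).
Implicit Type T : 'B(U, V).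

Definition closed_range T : {pred V} := fun v => `[< closure (range T) v >].

Fact closed_range_submod_closed T : submod_closed (closed_range T).
Proof.
split.
  apply/asboolP/subset_closure; exists 0 => //.
  by have := bop_linear T (-1) 0 0; rewrite scaler0 addr0 scaleN1r addNr.
move=> a u v /asboolP uT /asboolP vT; apply/asboolP => B Buv.
have /(_ _ Buv)[[P Q] /= [Pu Qv] PQ] :
    (fun z : V * V => a *: z.1 + z.2) z @[z --> (u, v)] --> a *: u + v.
  by apply: cvgD; [apply: cvgZr; exact: cvg_fst|exact: cvg_snd].
have [_ [[x _ <-] Px]] := uT _ Pu; have [_ [[y _ <-] Qy]] := vT _ Qv.
exists (a *: T x + T y); split; last exact: (PQ (T x, T y)).
by exists (a *: x + y) => //; rewrite bop_linear.
Qed.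

HB.instance Definition _ T := GRing.isSubmodClosed.Build _ _ (closed_range T)
  (closed_range_submod_closed T).

Record crange T := CRange { crange_val :> V; _ : crange_val \in closed_range T }.

HB.instance Definition _ T := [isSub for @crange_val T].
HB.instance Definition _ T := [Choice of crange T by <:].
HB.instance Definition _ T := [SubChoice_isSubLmodule of crange T by <:].

Section Instances.
Variable T : 'B(U, V).
Implicit Types u v : crange T.

Definition crange_form u v : R[i] := ip (u : V) (v : V).

Fact crange_form_linear u (a : R[i]) v1 v2 :
  crange_form u (a *: v1 + v2) = a * crange_form u v1 + crange_form u v2.
Proof. exact: ip_linear. Qed.

Fact crange_form_conj u v : crange_form v u = (crange_form u v)^*.
Proof. exact: ip_conj. Qed.

Fact crange_form_ge0 u : 0 <= crange_form u u.
Proof. by rewrite /crange_form -ip_norm exprn_ge0. Qed.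

Fact crange_form_eq0 u : crange_form u u = 0 -> u = 0.
Proof.
rewrite /crange_form -ip_norm => /eqP; rewrite expf_eq0/= normr_eq0 => /eqP u0.
exact: val_inj.
Qed.

HB.instance Definition _ := @Lmodule_isPreHilbert.Build R (crange T)
  crange_form crange_form_linear crange_form_conj crange_form_ge0 crange_form_eq0.

Lemma crange_norm u : `|u| = `|u : V|.
Proof.
by apply/eqP; rewrite -(@eqrXn2 _ 2)// !ip_norm.
Qed.

Fact crange_complete (F : set_system (crange T)) :
  ProperFilter F -> cauchy F -> cvg F.
Proof.
move=> FF Fc; have : cvg (@crange_val T @ F).
  apply: cauchy_cvg; apply/cauchy_ballP => e e0; near_simpl.
  move/cauchy_ballP : Fc => /(_ _ e0).
  by apply: filterS => -[x y]; rewrite -!ball_normE /= crange_norm.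
move=> /cvg_ex[v Fv].
have vT : v \in closed_range T.
  apply/asboolP => B Bv.
  have /nbhs_interior Bv' := Bv.
  have [u Bu] := @filter_ex _ F _ _ (Fv _ Bv').
  by have /asboolP/(_ _ Bu) := valP u.
apply/cvg_ex; exists (CRange vT); apply/cvgrPdist_le => e e0.
have /cvgrPdist_le/(_ _ e0) := Fv.
by apply: filterS => x /=; rewrite crange_norm.
Qed.

HB.instance Definition _ := Uniform_isComplete.Build (crange T) crange_complete.

Fact to_crange_subproof f : T f \in closed_range T.
Proof. by apply/asboolP/subset_closure; exists f. Qed.

Let to_crange_fun f : crange T := CRange (to_crange_subproof f).

Fact to_crange_linear : linear to_crange_fun.
Proof. by move=> a f g; apply: val_inj; exact: bop_linear. Qed.

Fact to_crange_continuous : continuous to_crange_fun.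
Proof.
move=> f; apply/cvgrPdist_le => e e0.
have /cvgrPdist_le/(_ _ e0) := @bop_continuous _ _ _ T f.
by apply: filterS => x /=; rewrite crange_norm.
Qed.

Definition to_crange : 'B(U, crange T) :=
  mkbop to_crange_linear to_crange_continuous.

End Instances.
End ClosedRange.

Section WeightedBasis.
Variables (R : realType) (w : nat -> {posnum R}).

(* The next two lemmas say that [wl2 w] is the completion of the finitely
   supported sequences in the norm (\sum_j (w j)^2 |c j|^2)^(1/2). *)
Lemma wl2_normE (c : wl2 w) :
  nrm c ^+ 2 = limn (series (fun j => ((w j)%:num * nrm (c j)) ^+ 2)).
Proof.
have sqE x : ((w x)%:num * nrm (c x)) ^+ 2 =
    (w x)%:num ^+ 2 * (complex.Re (c x) ^+ 2 + complex.Im (c x) ^+ 2).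
  by rewrite exprMn [nrm (c x)]/nrm normc_def /= sqr_sqrtr ?addr_ge0 ?sqr_ge0.
under eq_fun do rewrite sqE; apply: complexI; rewrite -wl2_formE.
by rewrite rmorphXn /= -[wl2_form c c]/(ip c c) -ip_norm /nrm RRe_real ?normr_real.
Qed.

Lemma wl2_expansion (c : wl2 w) :
  series (fun j => c j *: wl2_delta w j) @ \oo --> c.
Proof.
have subE (x y : wl2 w) j : (x - y) j = x j - y j by [].
pose s n := series (fun j => ((w j)%:num * nrm (c j)) ^+ 2) n.
have sc : cvgn s by apply/asboolP; case: c @s.
have partialE n j : series (fun j => c j *: wl2_delta w j) n j =
    if (j < n)%N then c j else 0.
  rewrite /series /=; elim: n => [|n IHn]; first by rewrite big_geq.
  rewrite big_nat_recr //= -[LHS]/(wl2_val _ j + c n * (j == n)%:R) IHn.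
  rewrite ltnS [in RHS]leq_eqVlt; have [->|_] := eqVneq j n.
    by rewrite ltnn add0r mulr1.
  by rewrite mulr0n mulr0 addr0.
have tailE n : nrm (c - series (fun j => c j *: wl2_delta w j) n) ^+ 2 =
    limn s - s n.
  move: (series _ n) (partialE n) => S SE.
  rewrite wl2_normE; apply/cvg_lim => //.
  have : (s m - s n) @[m --> \oo] --> limn s - s n.
    by apply: cvgB => //; exact: cvg_cst.
  apply: cvg_trans; apply: near_eq_cvg; near=> m.
  have nm : (n <= m)%N by near: m; exact: nbhs_infty_ge.
  rewrite /s sub_series_geq// [in RHS]/series /= (@big_cat_nat _ _ _ n 0 m)//=.
  have -> : \sum_(0 <= k < n) ((w k)%:num * nrm ((c - S) k)) ^+ 2 = 0.
    rewrite big_nat_cond big1// => k /andP[/andP[_ kn] _].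
    by rewrite subE SE kn subrr /nrm normr0 mulr0 expr0n.
  rewrite add0r; apply: eq_big_nat => j /andP[nj _].
  congr ((_ * nrm _) ^+ 2).
  by rewrite -[RHS]/(c j - S j) SE ltnNge nj subr0.
apply/cvgrPdist_le => e e0.
have eR : e = (complex.Re e)%:C by apply/esym/RRe_real; exact: gtr0_real.
have e0R : 0 < complex.Re e by rewrite -ltcR -eR.
near=> n; rewrite eR -[leLHS]RRe_real ?normr_real// lecR.
rewrite -(@ler_pXn2r _ 2) ?nnegrE ?(ltW e0R)//; last first.
  by rewrite -ler0c RRe_real ?normr_real.
rewrite -[_ ^+ 2 <= _]/(nrm _ ^+ 2 <= _) tailE (le_trans (ler_norm _))//; near: n.
by apply: cvgr_dist_le => //; rewrite exprn_gt0.
Unshelve. all: by end_near. Qed.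

End WeightedBasis.

(* In the definitions below [xget 0 [set T : 'B(U, V) | P T]] reads "the
   bounded operator T such that P T"; 0 is only the value it would take if
   there were none. *)

Section BoundedTheory.
Variable R : realType.

Definition separable_space (H : hilbertType R) : Prop :=
  exists D : set H, countable D /\ dense D.

Definition orthonormal_basis (H : hilbertType R) (e : nat -> H) : Prop :=
  (forall i j, ip (e i) (e j) = (i == j)%:R) /\
  (forall x, series (fun j => ip (e j) x *: e j) @ \oo --> x).

Definition opnorm (U V : hilbertType R) (T : 'B(U, V)) : \bar R :=
  ereal_sup [set (nrm (T x))%:E | x in [set x : U | nrm x <= 1]].

Definition adj (U V : hilbertType R) (T : 'B(U, V)) : 'B(V, U) :=
  xget 0 [set S : 'B(V, U) | forall x y, ip (S y) x = ip y (T x)].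

Definition nonneg_op (U : hilbertType R) (T : 'B(U, U)) : Prop :=
  forall x, 0 <= ip x (T x).

Definition sqrt_op (U : hilbertType R) (T : 'B(U, U)) : 'B(U, U) :=
  xget 0 [set S : 'B(U, U) | nonneg_op S /\ S \ob S = T].

Definition abs_op (U V : hilbertType R) (T : 'B(U, V)) : 'B(U, U) :=
  sqrt_op (adj T \ob T).

(* The trace norm Tr |T|, with the trace computed in the orthonormal basis e of
   U, on which it does not depend. *)
Definition trnorm (U V : hilbertType R) (e : nat -> U) (T : 'B(U, V)) : \bar R :=
  (\sum_(0 <= j <oo) (complex.Re (ip (e j) (abs_op T (e j))))%:E)%E.

Definition im_op (U : hilbertType R) (T : 'B(U, U)) : 'B(U, U) :=
  (2 * 'i)^-1 *: (T - adj T).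

Definition self_adjoint_bop (U : hilbertType R) (T : 'B(U, U)) : Prop :=
  forall x y, ip (T x) y = ip x (T y).

Definition opnorm_continuous (U : hilbertType R) (J : R -> 'B(U, U)) : Prop :=
  forall s, opnorm (J t - J s) @[t --> s] --> 0%E.

Definition opnorm_analytic_on (U : hilbertType R) (D : set R)
    (J : R -> 'B(U, U)) : Prop :=
  forall s, D s -> exists (rho : R) (A : nat -> 'B(U, U)), 0 < rho /\
    forall t, `|t - s| < rho ->
      opnorm (J t - \sum_(0 <= k < n) ((t - s) ^+ k)%:C *: A k) @[n --> \oo]
        --> 0%E.

(* The break points are indexed by int, so that the intervals cover R. *)
Definition piecewise_analytic (U : hilbertType R) (J : R -> 'B(U, U)) : Prop :=
  exists t : int -> R,
    [/\ {homo t : i j / i < j}, limit_point (range t) = set0 &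
     forall j : int, exists (D : set R) (G : R -> 'B(U, U)),
       [/\ open D, `[t (j - 1), t j]%classic `<=` D, opnorm_analytic_on D G &
        forall s, s \in `[t (j - 1), t j] -> J s = G s]].

End BoundedTheory.

Section UnboundedOperators.
Variables (R : realType) (H : hilbertType R).

(* An operator on the subspace [dom]; its values off [dom] are irrelevant. *)
Record linop := Linop {
  dom : set H;
  linop_fun :> H -> H;
  dom0 : dom 0;
  dom_linear : forall (a : R[i]) x y, dom x -> dom y -> dom (a *: x + y);
  linop_linear : forall (a : R[i]) x y, dom x -> dom y ->
    linop_fun (a *: x + y) = a *: linop_fun x + linop_fun y
}.

(* A is densely defined and has the same graph as its adjoint. *)
Definition self_adjoint (A : linop) : Prop :=
  dense (dom A) /\
  forall x y, (dom A x /\ A x = y) <->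
              (forall z, dom A z -> ip x (A z) = ip y z).

Definition resolvent (A : linop) (z : R[i]) : 'B(H, H) :=
  xget 0 [set T : 'B(H, H) |
    (forall f, dom A (T f) /\ A (T f) - z *: T f = f) /\
    (forall f, dom A f -> T (A f - z *: f) = f)].

Fact perturb_linear (A : linop) (V : 'B(H, H)) (a : R[i]) x y :
  dom A x -> dom A y ->
  A (a *: x + y) + V (a *: x + y) = a *: (A x + V x) + (A y + V y).
Proof.
by move=> Ax Ay; rewrite linop_linear// bop_linear scalerDr addrACA.
Qed.

Definition perturb (A : linop) (V : 'B(H, H)) : linop :=
  Linop (dom0 A) (@dom_linear A) (@perturb_linear A V).

End UnboundedOperators.

Section Frames.
Variables (R : realType) (H K : hilbertType R).

Record frame := Frame {
  kappa : nat -> {posnum R};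
  phi : nat -> H;
  psi : nat -> K;
  frame_op :> 'B(H, K);
  kappa_decr : forall i j, (i <= j)%N -> (kappa j)%:num <= (kappa i)%:num;
  kappa_l2 : cvgn (series (fun j => (kappa j)%:num ^+ 2));
  phi_basis : orthonormal_basis phi;
  psi_basis : orthonormal_basis psi;
  frame_opE : forall f,
    series (fun j => ((kappa j)%:num%:C * ip (phi j) f) *: psi j) @ \oo
      --> frame_op f
}.

Variable F : frame.

Definition kappaV j : {posnum R} := ((kappa F j)%:num^-1)%:pos.

End Frames.

Definition unit_weight (R : realType) (j : nat) : {posnum R} := 1%:pos.
Notation l2 R := (wl2 (unit_weight R)).
(* H_1 and H_{-1}: the finite sum \sum_j c_j phi_j corresponds to the sequence c.
   Since |F| phi_j = kappa_j phi_j, its norm in H_alpha is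
   (\sum_j kappa_j^(-2 alpha) |c_j|^2)^(1/2). *)
Notation Hplus F := (wl2 (kappaV F)).
Notation Hminus F := (wl2 (kappa F)).

(* <c, d> = \sum_j (c_j)^* d_j: the pairings of H_1 and H_{-1}. *)
Definition pairing (R : realType) (w w' : nat -> {posnum R})
    (c : wl2 w) (d : wl2 w') : R[i] :=
  csum (fun j => (c j)^* * d j).

Section Rigging.
Variables (R : realType) (H K : hilbertType R) (F : frame H K).

Definition incl : 'B(Hplus F, H) :=
  xget 0 [set T : 'B(Hplus F, H) |
    forall c : Hplus F, series (fun j => c j *: phi F j) @ \oo --> T c].

Definition emb : 'B(H, Hminus F) :=
  xget 0 [set T : 'B(H, Hminus F) | forall f j, T f j = ip (phi F j) f].

Definition rig (T : 'B(H, H)) : 'B(Hplus F, Hminus F) := emb \ob T \ob incl.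

(* V seen as an operator from H_{-1} to H_1 *)
Definition rig_perturb (V : 'B(H, H)) : 'B(Hminus F, Hplus F) :=
  xget 0 [set T : 'B(Hminus F, Hplus F) | forall f, incl (T (emb f)) = V f].

Definition rig_adj (T : 'B(Hplus F, Hminus F)) : 'B(Hplus F, Hminus F) :=
  xget 0 [set S : 'B(Hplus F, Hminus F) |
    forall f g, pairing (S f) g = pairing f (T g)].

Definition rig_im (T : 'B(Hplus F, Hminus F)) : 'B(Hplus F, Hminus F) :=
  (2 * 'i)^-1 *: (T - rig_adj T).

Definition Hplus_basis (j : nat) : Hplus F :=
  (kappa F j)%:num%:C *: wl2_delta (kappaV F) j.

Definition frame_perturbation (J : 'B(K, K)) : 'B(H, H) := adj F \ob J \ob F.

Definition Lambda (A : linop H) : set R :=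
  [set lam |
    (exists T : 'B(K, K),
       opnorm (F \ob resolvent A (lam +i* y) \ob adj F - T) @[y --> 0^'+]
         --> 0%E) /\
    (exists T : 'B(K, K),
       trnorm (psi F)
         (F \ob im_op (resolvent A (lam +i* y)) \ob adj F - T) @[y --> 0^'+]
         --> 0%E)].

Section Evaluation.
Variables (A : linop H) (lam : R).

(* R_{lam + i0}(A) *)
Definition resolvent_bd : 'B(Hplus F, Hminus F) :=
  xget 0 [set T : 'B(Hplus F, Hminus F) |
    opnorm (rig (resolvent A (lam +i* y)) - T) @[y --> 0^'+] --> 0%E].

Definition phi_mx (i j : nat) : R[i] :=
  (pi^-1 * (kappa F i)%:num * (kappa F j)%:num)%:C *
  pairing (wl2_delta (kappaV F) i) (rig_im resolvent_bd (wl2_delta (kappaV F) j)).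

Definition phi_op : 'B(l2 R, l2 R) :=
  xget 0 [set T : 'B(l2 R, l2 R) |
    forall i j, T (wl2_delta _ j) i = phi_mx i j].

Definition eta (j : nat) : l2 R := sqrt_op phi_op (wl2_delta _ j).

Definition eval_op : 'B(Hplus F, l2 R) :=
  xget 0 [set E : 'B(Hplus F, l2 R) |
    forall (b : l2 R) (f : Hplus F), (forall j, f j = (kappa F j)%:num%:C * b j) ->
      series (fun j => b j *: eta j) @ \oo --> E f].

(* E_lam(A) with codomain the fibre h_lam(A) *)
Definition eval_fiber : 'B(Hplus F, crange eval_op) := to_crange eval_op.

Definition eval_diamond : 'B(crange eval_op, Hminus F) :=
  xget 0 [set D : 'B(crange eval_op, Hminus F) |
    forall u g, pairing (D u) g = ip (crange_val u) (eval_op g)].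

End Evaluation.

Local Notation fiber A lam := (crange (eval_op A lam)).

Section Waves.
Variables (A1 A0 : linop H) (lam : R).

(* s is 1 or -1: the sign in the index of a_+, a_-, w_+, w_- *)
Definition wave_form (s : R) : 'B(Hplus F, Hminus F) :=
  xget 0 [set a : 'B(Hplus F, Hminus F) |
    trnorm Hplus_basis
      ((y / pi)%:C *:
         rig (resolvent A1 (lam -i* (s * y)) \ob resolvent A0 (lam +i* (s * y)))
       - a) @[y --> 0^'+] --> 0%E].

Definition wave_mx (s : R) : 'B(fiber A0 lam, fiber A1 lam) :=
  xget 0 [set W : 'B(fiber A0 lam, fiber A1 lam) |
    forall f g, ip (eval_fiber A1 lam f) (W (eval_fiber A0 lam g)) =
                pairing f (wave_form s g)].

Definition scattering_mx : 'B(fiber A0 lam, fiber A0 lam) :=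
  adj (wave_mx 1) \ob wave_mx (- 1).

End Waves.
End Rigging.

(* Main.v *)
(* Write s and r for the boundary values R_{lam + i0}(H_0) and R_{lam + i0}(H_r),
   and s', r' for their adjoints R_{lam - i0}. Passing to the limit in the second
   resolvent identity gives s = r + r V s = r + s V r, so 1 - r V is the inverse of
   1 + s V: no compactness or analyticity is needed. The same identities give
     a_+ = (1 - r' V) Im s / pi = Im r (1 + V s) / pi,
     a_- = (1 - r V) Im s / pi = Im r (1 + V s') / pi,
   where the first form shows convergence in trace norm, being a product of a norm
   convergent and a trace norm convergent factor. Since Im r / pi = E(H_r)^* E(H_r),
   the second form reads w_+ E(H_0) g = E(H_r) (1 + V s) g, and likewise for w_-
   with s'. Hence
     <E(H_0) f, w_+^* w_- E(H_0) g> = <f, (1 + s' V)(1 - r V) (Im s / pi) g>,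
   and s' = s - 2i Im s turns (1 + s' V)(1 - r V) into 1 - 2i Im s V (1 - r V). *)
Require Import Defs.
From HB Require Import structures.
From mathcomp Require Import all_boot all_order all_algebra.
From mathcomp Require Import all_classical all_reals.
From mathcomp Require Import ereal topology tvs normedtype sequences trigo.
From mathcomp Require Import complex.
From mathcomp Require Import ring lra.
Set Implicit Arguments.
Unset Strict Implicit.
Unset Printing Implicit Defensive.
Import Order.TTheory GRing.Theory Num.Theory numFieldNormedType.Exports.
Local Open Scope classical_set_scope.
Local Open Scope ring_scope.
Local Open Scope complex_scope.

(** * Inner products and bounded operators *)

(** Adjoints, resolvents, square roots, boundary values and wave matrices are each chosen by a
    characteristic property, so an identity about one of them can be used only after such an
    operator has been exhibited. A single variational Riesz lemma serves three constructions. It is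
    stated for a functional dominated by |E x| with E linear on a mere subspace: E = id gives
    adjoints, E = A - conj z on the domain gives resolvents, and E = the map into the closed range
    gives the wave matrices.

    The trace norm is the sum of <e_j, |T| e_j>, a form that hides the triangle inequality and the
    ideal property. It is traded for bounds against all test contractions, where both are immediate.
    The equivalence regularises the polar decomposition as T (|T| + e)^-1, so that no partial
    isometry has to be built.

    The formula for w_+ E(H_0) g prescribes w_+ only on the range of E(H_0). It extends to the fibre
    because (1 + s' V)(1 - r' V) = 1 yields <(1 + V s) f, Im r (1 + V s) g> = <f, Im s g>, which
    makes the prescription isometric; likewise for w_-. *)

Section InnerProduct.
Variable R : realType.

Lemma nrmE (V : normedZmodType R[i]) (x : V) : `|x| = (nrm x)%:C.
Proof. by rewrite /nrm RRe_real ?normr_real. Qed.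

Lemma nrm_ge0 (V : normedZmodType R[i]) (x : V) : 0 <= nrm x.
Proof. by rewrite -ler0c -nrmE. Qed.
Hint Resolve nrm_ge0 : core.

Lemma nrm0 (V : normedZmodType R[i]) : nrm (0 : V) = 0.
Proof. by rewrite /nrm normr0. Qed.

Lemma nrm_eq0 (V : normedZmodType R[i]) (x : V) : nrm x = 0 -> x = 0.
Proof. by move=> x0; apply/normr0_eq0; rewrite nrmE x0. Qed.

Lemma nrmN (V : normedZmodType R[i]) (x : V) : nrm (- x) = nrm x.
Proof. by rewrite /nrm normrN. Qed.

Lemma nrmB (V : normedZmodType R[i]) (x y : V) : nrm (x - y) = nrm (y - x).
Proof. by rewrite -nrmN opprB. Qed.

Lemma ler_nrmD (V : normedZmodType R[i]) (x y : V) :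
  nrm (x + y) <= nrm x + nrm y.
Proof. by rewrite -lecR rmorphD/= -!nrmE ler_normD. Qed.

Lemma nrmZ (V : normedModType R[i]) (a : R[i]) (x : V) :
  nrm (a *: x) = nrm a * nrm x.
Proof. by apply: complexI; rewrite rmorphM/= -!nrmE normrZ. Qed.

Lemma nrmM (a b : R[i]) : nrm (a * b) = nrm a * nrm b.
Proof. by apply: complexI; rewrite rmorphM/= -!nrmE normrM. Qed.

Lemma nrm_real (a : R) : nrm (a%:C : R[i]) = `|a|.
Proof. by rewrite /nrm normc_def/= expr0n/= addr0 sqrtr_sqr. Qed.

Lemma nrm_sqr (a : R[i]) : nrm a ^+ 2 = complex.Re a ^+ 2 + complex.Im a ^+ 2.
Proof. by rewrite /nrm normc_def /= sqr_sqrtr ?addr_ge0 ?sqr_ge0. Qed.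

Lemma nrm_conj (a : R[i]) : nrm (a^*%R) = nrm a.
Proof.
by apply/eqP; rewrite -(@eqrXn2 _ 2)// !nrm_sqr; case: a => a b/=; rewrite sqrrN.
Qed.

Lemma conjCR (a : R) : (a%:C : R[i])^*%R = a%:C.
Proof. by apply/eqP; rewrite eq_complex /= oppr0 !eqxx. Qed.

Lemma ler_Re_nrm (a : R[i]) : complex.Re a <= nrm a.
Proof.
rewrite (le_trans (ler_norm _))// -(@ler_pXn2r _ 2)// ?nnegrE//.
by rewrite real_normK ?num_real// nrm_sqr lerDl sqr_ge0.
Qed.

Lemma ler_norm_Re (a : R[i]) : `|complex.Re a| <= nrm a.
Proof.
rewrite -(@ler_pXn2r _ 2)// ?nnegrE//.
by rewrite real_normK ?num_real// nrm_sqr lerDl sqr_ge0.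
Qed.

Lemma ler_norm_Im (a : R[i]) : `|complex.Im a| <= nrm a.
Proof.
rewrite -(@ler_pXn2r _ 2)// ?nnegrE//.
by rewrite real_normK ?num_real// nrm_sqr lerDr sqr_ge0.
Qed.

Variable H : preHilbertType R.
Implicit Types x y z : H.

Lemma ipDr x y z : ip x (y + z) = ip x y + ip x z.
Proof. by have := ip_linear x 1 y z; rewrite scale1r mul1r. Qed.

Lemma ipr0 x : ip x 0 = 0.
Proof. by apply: (addrI (ip x 0)); rewrite -ipDr !addr0. Qed.

Lemma ipZr x a y : ip x (a *: y) = a * ip x y.
Proof. by have := ip_linear x a y 0; rewrite ipr0 !addr0. Qed.

Lemma ipNr x y : ip x (- y) = - ip x y.
Proof. by rewrite -scaleN1r ipZr mulN1r. Qed.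

Lemma ipBr x y z : ip x (y - z) = ip x y - ip x z.
Proof. by rewrite ipDr ipNr. Qed.

Lemma ipDl x y z : ip (x + y) z = ip x z + ip y z.
Proof. by rewrite ip_conj ipDr rmorphD/= -!ip_conj. Qed.

Lemma ipZl a x y : ip (a *: x) y = a^* * ip x y.
Proof. by rewrite ip_conj ipZr rmorphM/= -ip_conj. Qed.

Lemma ip0l x : ip 0 x = 0.
Proof. by rewrite ip_conj ipr0 conjc0. Qed.

Lemma ipNl x y : ip (- x) y = - ip x y.
Proof. by rewrite ip_conj ipNr rmorphN/= -ip_conj. Qed.

Lemma ipBl x y z : ip (x - y) z = ip x z - ip y z.
Proof. by rewrite ipDl ipNl. Qed.

Lemma ip_sumr x (I : Type) (s : seq I) (P : pred I) (f : I -> H) :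
  ip x (\sum_(i <- s | P i) f i) = \sum_(i <- s | P i) ip x (f i).
Proof. by apply: (big_morph (ip x)) => [y z|]; rewrite ?ipDr ?ipr0. Qed.

Lemma ip_suml x (I : Type) (s : seq I) (P : pred I) (f : I -> H) :
  ip (\sum_(i <- s | P i) f i) x = \sum_(i <- s | P i) ip (f i) x.
Proof.
by apply: (big_morph (fun y => ip y x)) => [y z|]; rewrite ?ipDl ?ip0l.
Qed.

Lemma ip_self x : ip x x = (nrm x ^+ 2)%:C.
Proof. by rewrite -ip_norm nrmE rmorphXn. Qed.

Lemma Re_ip_self x : complex.Re (ip x x) = nrm x ^+ 2.
Proof. by rewrite ip_self. Qed.

Lemma ip_ext x y : (forall z, ip z x = ip z y) -> x = y.
Proof.
move=> xy; apply/eqP; rewrite -subr_eq0; apply/eqP/nrm_eq0/eqP.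
rewrite -(@eqrXn2 _ 2)// expr0n/= -Re_ip_self ipBr xy subrr//.
Qed.

Lemma Re_ipC x y : complex.Re (ip y x) = complex.Re (ip x y).
Proof. by rewrite ip_conj; case: (ip x y). Qed.

Lemma nrm_sqrD x y :
  nrm (x + y) ^+ 2 = nrm x ^+ 2 + nrm y ^+ 2 + 2 * complex.Re (ip x y).
Proof.
by rewrite -!Re_ip_self ipDr !ipDl !raddfD/= (Re_ipC x y); ring.
Qed.

Lemma nrm_sqrB x y :
  nrm (x - y) ^+ 2 = nrm x ^+ 2 + nrm y ^+ 2 - 2 * complex.Re (ip x y).
Proof. by rewrite nrm_sqrD nrmN ipNr raddfN/= mulrN. Qed.

Lemma Cauchy_Schwarz x y : nrm (ip x y) <= nrm x * nrm y.
Proof.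
have [x0|x0] := eqVneq (nrm x) 0.
  by rewrite (nrm_eq0 x0) ip0l !nrm0 mul0r.
have xp : 0 < nrm x by rewrite lt0r x0/=.
rewrite -(@ler_pXn2r _ 2)// ?nnegrE ?mulr_ge0//.
(* [c *: x] is the orthogonal projection of y onto the line of x. *)
pose c : R[i] := ((nrm x ^+ 2)^-1)%:C * ip x y.
have := sqr_ge0 (nrm (y - c *: x)); rewrite nrm_sqrB nrmZ /c nrmM ipZr.
rewrite nrm_real (ip_conj x y) ger0_norm ?invr_ge0 ?sqr_ge0//.
have -> : complex.Re (((nrm x ^+ 2)^-1)%:C * ip x y * (ip x y)^*) =
    (nrm x ^+ 2)^-1 * nrm (ip x y) ^+ 2.
  by rewrite nrm_sqr; case: (ip x y) => a b/=; ring.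
move: (nrm (ip x y)) => n.
rewrite [X in 0 <= X](_ : _ = (nrm x ^+ 2 * nrm y ^+ 2 - n ^+ 2) / nrm x ^+ 2).
  by rewrite pmulr_lge0 ?invr_gt0 ?exprn_gt0// subr_ge0 exprMn.
by field.
Qed.

End InnerProduct.
#[local] Hint Extern 0 (is_true (0 <= nrm _)) => exact: nrm_ge0 : core.

(** * Convergence expressed through real-valued norms *)

Section Convergence.
Variable R : realType.

Lemma cvg_nrmP (V : normedModType R[i]) (T : Type) (G : set_system T)
    {FG : Filter G} (u : T -> V) (l : V) :
  u @ G --> l <-> forall e : R, 0 < e -> \forall t \near G, nrm (u t - l) <= e.
Proof.
split=> [/cvgrPdist_le ul e e0|ul].
  have e0C : 0 < e%:C :> R[i] by rewrite ltcR.
  by apply: filterS (ul _ e0C) => t; rewrite distrC nrmE lecR.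
apply/cvgrPdist_le => e e0.
have eR : e = (complex.Re e)%:C by apply/esym/RRe_real; exact: gtr0_real.
have e0R : 0 < complex.Re e by rewrite -ltcR -eR.
by apply: filterS (ul _ e0R) => t; rewrite distrC nrmE eR lecR.
Qed.

Lemma nrm_cvg0 (V : normedModType R[i]) (T : Type) (G : set_system T)
    {FG : Filter G} (u : T -> V) (l : V) (v : T -> R) :
  v @ G --> 0 -> (\forall t \near G, nrm (u t - l) <= v t) -> u @ G --> l.
Proof.
move=> /cvgrPdist_le v0 uv; apply/cvg_nrmP => e /v0.
apply: filterS2 uv => t uv; rewrite sub0r normrN => ve.
exact: le_trans uv (le_trans (ler_norm _) ve).
Qed.

Lemma cvg_ip (H : preHilbertType R) (T : Type) (G : set_system T)
    {FG : Filter G} (u : T -> H) (l : H) x :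
  u @ G --> l -> complex.Re (ip x (u t)) @[t --> G] --> complex.Re (ip x l).
Proof.
move=> /cvg_nrmP ul; apply/cvgrPdist_le => e e0.
have d0 : 0 < e / (nrm x + 1) by rewrite divr_gt0// ltr_wpDl.
apply: filterS (ul _ d0) => t ut.
rewrite distrC -raddfB -ipBr.
apply: le_trans (ler_norm_Re _) _; apply: le_trans (Cauchy_Schwarz _ _) _.
apply: (@le_trans _ _ (nrm x * (e / (nrm x + 1)))).
  by rewrite ler_wpM2l.
by rewrite mulrCA ger_pMr// ler_pdivrMr ?mul1r ?lerDl ?ltr_wpDl//.
Qed.

Lemma cvg_nrm (H : normedModType R[i]) (T : Type) (G : set_system T)
    {FG : Filter G} (u : T -> H) (l : H) :
  u @ G --> l -> nrm (u t) @[t --> G] --> nrm l.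
Proof.
move=> /cvg_nrmP ul; apply/cvgrPdist_le => e e0.
apply: filterS (ul _ e0) => t ut; rewrite (le_trans _ ut)//.
have := ler_nrmD (u t - l) l; have := ler_nrmD (l - u t) (u t).
by rewrite !subrK (nrmB l) ler_norml => ? ?; apply/andP; split; lra.
Qed.

Lemma cauchy_nrm (V : completeNormedModType R[i]) (u : nat -> V) :
  (forall e : R, 0 < e -> exists N, forall m n, (N <= m)%N -> (N <= n)%N ->
     nrm (u m - u n) <= e) -> cvgn u.
Proof.
move=> uc; apply: cauchy_cvg; apply/cauchy_ballP => e e0.
have eR : e = (complex.Re e)%:C by apply/esym/RRe_real; exact: gtr0_real.
have e0R : 0 < complex.Re e / 2 by rewrite divr_gt0// -ltcR -eR.
have [N uN] := uc _ e0R; exists ([set u n | n in [set n | (N <= n)%N]],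
  [set u n | n in [set n | (N <= n)%N]]) => /=.
  by split; exists N => // n /= Nn; exists n.
move=> [_ _] /= [[m Nm <-] [n Nn <-]].
rewrite -ball_normE /= eR nrmE ltcR; apply: (@le_lt_trans _ _ (complex.Re e / 2)).
  exact: uN.
by rewrite ltr_pdivrMr// ltr_pMr ?ltr1n// -ltcR -eR.
Qed.

Lemma cvg_nrm_unique (V : normedModType R[i]) (T : Type) (G : set_system T)
    {FG : ProperFilter G} (u : T -> V) (l l' : V) :
  u @ G --> l -> u @ G --> l' -> l = l'.
Proof. by move=> ul ul'; apply: (cvg_unique _ ul ul'). Qed.

Lemma near_at_right0 (P : R -> Prop) : (forall y, 0 < y -> P y) ->
  \forall y \near (0 : R)^'+, P y.
Proof.
move=> h; near=> y; apply: h; near: y; exact: nbhs_right_gt.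
Unshelve. all: by end_near. Qed.

End Convergence.

(** * Bounded operators *)

Section Bounded.
Variable R : realType.
Implicit Types U V W : normedModType R[i].

Lemma bopD U V (T : 'B(U, V)) x y : T (x + y) = T x + T y.
Proof. by have := bop_linear T 1 x y; rewrite !scale1r. Qed.

Lemma bop0 U V (T : 'B(U, V)) : T 0 = 0.
Proof. by apply: (addrI (T 0)); rewrite -bopD !addr0. Qed.

Lemma bopZ U V (T : 'B(U, V)) a x : T (a *: x) = a *: T x.
Proof. by have := bop_linear T a x 0; rewrite bop0 !addr0. Qed.

Lemma bopN U V (T : 'B(U, V)) x : T (- x) = - T x.
Proof. by rewrite -scaleN1r bopZ scaleN1r. Qed.

Lemma bopB U V (T : 'B(U, V)) x y : T (x - y) = T x - T y.
Proof. by rewrite bopD bopN. Qed.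

Lemma bop_sum U V (T : 'B(U, V)) (I : Type) (s : seq I) (P : pred I)
    (f : I -> U) :
  T (\sum_(i <- s | P i) f i) = \sum_(i <- s | P i) T (f i).
Proof. by apply: (big_morph T) => [y z|]; rewrite ?bopD ?bop0. Qed.

Lemma bop_ext U V (S T : 'B(U, V)) : (forall x, S x = T x) -> S = T.
Proof. by move=> ST; apply: val_inj; apply/funext. Qed.

Lemma bop_bound U V (T : 'B(U, V)) :
  exists2 C : R, 0 < C & forall x, nrm (T x) <= C * nrm x.
Proof.
have /cvg_nrmP/(_ 1 ltr01) : T x @[x --> (0 : U)] --> T 0 by exact: bop_continuous.
rewrite bop0 => /nbhs_ballP[e /= e0 eT].
have eR : e = (complex.Re e)%:C by apply/esym/RRe_real; exact: gtr0_real.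
have e0R : 0 < complex.Re e by rewrite -ltcR -eR.
move: (complex.Re e) eR e0R => d -> d0 in eT *.
(* On the ball of radius d the values have norm at most 1; rescaling x to length d / 2 produces the
   factor 2 / d. *)
exists (2 / d); first by rewrite divr_gt0.
move=> x; have [x0|x0] := eqVneq (nrm x) 0.
  by rewrite (nrm_eq0 x0) bop0 !nrm0 mulr0.
have xp : 0 < nrm x by rewrite lt0r x0/=.
pose t := d / 2 / nrm x.
have t0 : 0 < t by rewrite !divr_gt0.
have /eT : ball (0 : U) d%:C (t%:C *: x).
  rewrite -ball_normE /= sub0r normrN nrmE ltcR nrmZ nrm_real gtr0_norm//.
  by rewrite divfK ?gt_eqF// ltr_pdivrMr// ltr_pMr ?ltr1n.
rewrite /= subr0 bopZ nrmZ nrm_real gtr0_norm// -ler_pdivlMl// mulr1.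
move/le_trans; apply; rewrite le_eqVlt; apply/orP; left; apply/eqP.
by rewrite /t; field; rewrite x0 gt_eqF.
Qed.

Lemma mkbop_bound U V (f : U -> V) (C : R) : linear f ->
  (forall x, nrm (f x) <= C * nrm x) -> exists T : 'B(U, V), forall x, T x = f x.
Proof.
move=> flin fC.
have fB x y : f (y - x) = f y - f x.
  by rewrite addrC -scaleN1r flin scaleN1r addrC.
suff fcont : continuous f by exists (mkbop flin fcont).
move=> x; apply/cvg_nrmP => e e0.
(* C carries no sign, so a positive substitute is taken as divisor. *)
have C0 : 0 < `|C| + 1 by rewrite ltr_wpDl.
have /cvg_nrmP/(_ (e / (`|C| + 1))) : y @[y --> x] --> x by exact: cvg_id.
rewrite divr_gt0// => /(_ isT); apply: filterS => y xy.
rewrite -fB (le_trans (fC _))//.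
apply: (@le_trans _ _ ((`|C| + 1) * nrm (y - x))).
  by rewrite ler_wpM2r// (le_trans (ler_norm _))// lerDl.
by rewrite -ler_pdivlMl// mulrC.
Qed.

Lemma bopDE U V (S T : 'B(U, V)) x : (S + T) x = S x + T x. Proof. by []. Qed.
Lemma bopBE U V (S T : 'B(U, V)) x : (S - T) x = S x - T x. Proof. by []. Qed.
Lemma bopZE U V a (T : 'B(U, V)) x : (a *: T) x = a *: T x. Proof. by []. Qed.
Lemma bop0E U V x : (0 : 'B(U, V)) x = 0. Proof. by []. Qed.
Lemma bcompE U V W (S : 'B(V, W)) (T : 'B(U, V)) x : (S \ob T) x = S (T x).
Proof. by []. Qed.
Lemma bidE U (x : U) : bid U x = x. Proof. by []. Qed.

Lemma bcomp_sandwichB U V W X (C : 'B(V, W)) (S T : 'B(U, V)) (D : 'B(X, U)) :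
  C \ob (S - T) \ob D = C \ob S \ob D - C \ob T \ob D.
Proof. by apply: bop_ext => x; exact: bopB. Qed.

End Bounded.

(** * Riesz representation and adjoints *)

Section Riesz.
Variable R : realType.

(* Minimise |E x|^2 - 2 Re (l x) over D: by the parallelogram law, the images
   under E of a minimising sequence form a Cauchy sequence. *)
Lemma riesz_rep (G : lmodType R[i]) (M : hilbertType R) (D : set G)
    (E : G -> M) (l : G -> R[i]) (c : R) :
  D 0 -> (forall a x y, D x -> D y -> D (a *: x + y)) ->
  (forall a x y, D x -> D y -> E (a *: x + y) = a *: E x + E y) ->
  (forall a x y, D x -> D y -> l (a *: x + y) = a * l x + l y) ->
  (forall x, D x -> nrm (l x) <= c * nrm (E x)) ->
  exists w, (forall x, D x -> l x = ip w (E x)) /\ nrm w ^+ 2 <= c * nrm w.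
Proof.
move=> D0 Dlin Elin llin lE.
have DZ a x : D x -> D (a *: x) by move=> Dx; rewrite -[_ *: _]addr0; exact: Dlin.
have DD x y : D x -> D y -> D (x + y).
  by move=> Dx Dy; rewrite -[x]scale1r; exact: Dlin.
have E0 : E 0 = 0.
  by have := Elin (-1) 0 0 D0 D0; rewrite scaler0 addr0 scaleN1r addNr.
have l0 : l 0 = 0.
  by have := llin (-1) 0 0 D0 D0; rewrite scaler0 addr0 mulN1r addNr.
have EZ a x : D x -> E (a *: x) = a *: E x.
  by move=> Dx; rewrite -[a *: x]addr0 Elin// E0 addr0.
have lZ a x : D x -> l (a *: x) = a * l x.
  by move=> Dx; rewrite -[a *: x]addr0 llin// l0 addr0.
have ED x y : D x -> D y -> E (x + y) = E x + E y.
  by move=> Dx Dy; rewrite -{1}[x]scale1r Elin// scale1r.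
have lD x y : D x -> D y -> l (x + y) = l x + l y.
  by move=> Dx Dy; rewrite -{1}[x]scale1r llin// mul1r.
pose q x := nrm (E x) ^+ 2 - 2 * complex.Re (l x).
(* Completing the square in |E x|^2 - 2 c |E x|. *)
have qlb x : D x -> - c ^+ 2 <= q x.
  move=> Dx; have := ler_Re_nrm (l x); have := lE _ Dx; rewrite /q.
  by have := sqr_ge0 (nrm (E x) - c); lra.
have qinf : has_inf (q @` D).
  split; first by exists (q 0), 0.
  by exists (- c ^+ 2) => _ [x Dx <-]; exact: qlb.
pose m := inf (q @` D).
have qm x : D x -> m <= q x.
  by move=> Dx; apply: ge_inf; [case: qinf|exists x].
have /choice[f fP] : forall n, exists x, D x /\ q x <= m + n.+1%:R^-1.
  move=> n; have n0 : 0 < n.+1%:R^-1 :> R by rewrite invr_gt0.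
  by have [_ [x Dx <-] /ltW] := inf_adherent n0 qinf; exists x.
have par x y : D x -> D y ->
    nrm (E x - E y) ^+ 2 <= 2 * (q x - m) + 2 * (q y - m).
  move=> Dx Dy; have Dxy : D ((2^-1)%:C *: (x + y)) by exact/DZ/DD.
  have := qm _ Dxy; rewrite /q EZ ?lZ; [|exact: DD..].
  rewrite nrmZ nrm_real ger0_norm ?invr_ge0// exprMn ED// lD//.
  rewrite nrm_sqrD nrm_sqrB.
  rewrite (_ : complex.Re (_ * _) =
      2^-1 * (complex.Re (l x) + complex.Re (l y))).
    by move: (complex.Re (ip _ _)) => p; lra.
  by case: (l x) (l y) => [a b] [a' b']/=; ring.
have /cvg_ex[w fw] : cvgn (E \o f : nat -> M).
  apply: cauchy_nrm => e e0.
  have e2 : 0 < e ^+ 2 / 4 by rewrite divr_gt0 ?exprn_gt0.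
  have [N _ NP] := near_infty_natSinv_lt (PosNum e2).
  exists N => i j /NP/= iN /NP/= jN; rewrite -(@ler_pXn2r _ 2) ?nnegrE ?(ltW e0)//.
  have [Di qi] := fP i; have [Dj qj] := fP j.
  apply: le_trans (par _ _ Di Dj) _; move: iN jN qi qj => /=.
  by move: (q _) (q _) (i.+1%:R^-1) (j.+1%:R^-1) => a b a' b'; lra.
exists w.
have Rel x : D x -> complex.Re (l x) = complex.Re (ip w (E x)).
  (* First variation: compare q at f_n + t x with its infimum m. As q (f_n) is within 1 / (n + 1) of
     m, the limit in n leaves a quadratic polynomial in t that is non-negative for every real t,
     which kills its linear coefficient. *)
  move=> Dx; pose d t := t ^+ 2 * nrm (E x) ^+ 2 +
    2 * t * (complex.Re (ip (E x) w) - complex.Re (l x)).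
  have dge t : 0 <= d t.
    have : t ^+ 2 * nrm (E x) ^+ 2 + 2 * t *
        (complex.Re (ip (E x) (E (f n))) - complex.Re (l x)) + n.+1%:R^-1
        @[n --> \oo] --> d t + 0.
      apply: cvgD; last exact: cvg_harmonic.
      apply: cvgD; first exact: cvg_cst.
      by apply: cvgMr; apply: cvgB; [exact: cvg_ip|exact: cvg_cst].
    rewrite addr0 => dlim; rewrite -(cvg_lim _ dlim)//.
    apply: limr_ge; first by apply/cvg_ex; exists (d t).
    near=> n; have [Dn qn] := fP n.
    have := qm _ (DD _ _ Dn (DZ t%:C _ Dx)); rewrite /q in qn *.
    rewrite ED ?EZ ?lD ?lZ//; [|exact: DZ..].
    rewrite nrm_sqrD nrmZ nrm_real exprMn real_normK ?num_real// ipZr.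
    rewrite (Re_ipC (E (f n)) (E x)) raddfD/=.
    case: (l x) (l (f n)) (ip (E (f n)) (E x)) qn => [a b] [a' b'] [a'' b'']/=.
    by move: (n.+1%:R^-1) => k h1 h2; lra.
  have a0 : 0 < nrm (E x) ^+ 2 + 1 by rewrite ltr_wpDl ?sqr_ge0.
  (* With a = |E x|^2 and 2 b the coefficient of t, the choice t = - b / (a + 1) gives the value -
     b^2 (a + 2) / (a + 1)^2. The summand 1 also covers E x = 0. *)
  have := dge (- (complex.Re (ip (E x) w) - complex.Re (l x))
                 / (nrm (E x) ^+ 2 + 1)).
  rewrite /d (Re_ipC w).
  move: (complex.Re (ip w (E x))) (complex.Re (l x)) => u v.
  have [->//|uv] := eqVneq u v.
  have uv2 : 0 < (u - v) ^+ 2 by rewrite exprn_even_gt0/= ?subr_eq0.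
  rewrite [X in 0 <= X](_ : _ =
    - ((u - v) ^+ 2 * (nrm (E x) ^+ 2 + 2) / (nrm (E x) ^+ 2 + 1) ^+ 2)).
    have a2 : 0 < nrm (E x) ^+ 2 + 2 by rewrite ltr_wpDl ?sqr_ge0.
    rewrite oppr_ge0 => /(lt_le_trans _)-/(_ 0); rewrite ltxx.
    by move=> /(_ (divr_gt0 (mulr_gt0 uv2 a2) (exprn_gt0 _ a0))).
  by field; rewrite gt_eqF.
(* The bound has the form |w|^2 <= c |w| because c may be negative; E then vanishes on D and w =
   0. *)
split; last first.
  have h : complex.Re (ip w (E (f n))) @[n --> \oo] --> nrm w ^+ 2.
    by rewrite -Re_ip_self; exact: cvg_ip.
  have h' : c * nrm (E (f n)) @[n --> \oo] --> c * nrm w.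
    by apply: cvgMr; exact: cvg_nrm fw.
  rewrite -(cvg_lim _ h)// -(cvg_lim _ h')//; apply: ler_lim.
  - by apply/cvg_ex; exists (nrm w ^+ 2).
  - by apply/cvg_ex; exists (c * nrm w).
  - apply: nearW => n; have [Dn _] := fP n; rewrite -Rel//.
    exact: le_trans (ler_Re_nrm _) (lE _ Dn).
move=> x Dx; have := Rel _ Dx; have := Rel _ (DZ 'i _ Dx).
rewrite EZ// lZ// ipZr; case: (l x) (ip _ _) => [a b] [a' b']/= h1 h2.
by congr (_ +i* _); lra.
Unshelve. all: by end_near. Qed.

End Riesz.

Section Adjoint.
Variables (R : realType) (U V : hilbertType R).

Lemma adjP (T : 'B(U, V)) x y : ip (adj T y) x = ip y (T x).
Proof.
have [C C0 TC] := bop_bound T.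
have /choice[S SP] : forall y, exists w, forall x, ip y (T x) = ip w x.
  move=> {}y; have [] := @riesz_rep _ U U setT id (fun x => ip y (T x)) (nrm y * C).
  - by [].
  - by [].
  - by [].
  - by move=> a u v _ _; rewrite bop_linear ipDr ipZr.
  - move=> u _; apply: le_trans (Cauchy_Schwarz _ _) _.
    by rewrite -mulrA ler_wpM2l.
  by move=> w [wP _]; exists w => u; exact: wP.
have Slin : linear S.
  move=> a u v; apply: ip_ext => z.
  by rewrite ip_conj -SP ipDl ipZl !SP ipDr ipZr rmorphD rmorphM/= conjcK -!ip_conj.
have SC u : nrm (S u) <= C * nrm u.
  have [->|Su0] := eqVneq (nrm (S u)) 0; first by rewrite mulr_ge0// ltW.
  have Sup : 0 < nrm (S u) by rewrite lt0r Su0/=.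
  rewrite -(ler_pM2l Sup) -expr2 -Re_ip_self -SP.
  apply: le_trans (ler_Re_nrm _) _; apply: le_trans (Cauchy_Schwarz _ _) _.
  by rewrite mulrC [leRHS]mulrA [_ * C]mulrC ler_wpM2r.
have [B BE] := mkbop_bound Slin SC.
have Badj : [set S : 'B(V, U) | forall x y, ip (S y) x = ip y (T x)] B.
  by move=> /= u v; rewrite BE.
by have := @xgetPex _ 0 _ (ex_intro _ _ Badj); apply.
Qed.

Lemma adjP' (T : 'B(U, V)) x y : ip x (adj T y) = ip (T x) y.
Proof. by rewrite ip_conj adjP -ip_conj. Qed.

Lemma adj_unique (T : 'B(U, V)) (S : 'B(V, U)) :
  (forall x y, ip (S y) x = ip y (T x)) -> adj T = S.
Proof.
move=> ST; apply: bop_ext => y; apply: ip_ext => z.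
by rewrite ip_conj adjP -ST -ip_conj.
Qed.

Lemma contraction_adj (T : 'B(U, V)) :
  (forall x, nrm (T x) <= nrm x) -> forall y, nrm (adj T y) <= nrm y.
Proof.
move=> TC y; have [->|Sy0] := eqVneq (nrm (adj T y)) 0; first by [].
have Syp : 0 < nrm (adj T y) by rewrite lt0r Sy0/=.
rewrite -(ler_pM2l Syp) -expr2 -Re_ip_self adjP.
apply: le_trans (ler_Re_nrm _) _; apply: le_trans (Cauchy_Schwarz _ _) _.
by rewrite mulrC ler_wpM2r.
Qed.

End Adjoint.

(** * Resolvents of self-adjoint operators *)

Section Resolvent.
Variables (R : realType) (H : hilbertType R).

(** The Riesz lemma with E x = A x - conj z x represents <f, x> as <w, A x - conj z x>. This says
    that w lies in the domain of the adjoint, which is that of A, and that (A - z) w = f. The lower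
    bound at z gives injectivity and the norm bound 1 / c. Leaving c free allows real z outside the
    numerical range as well as non-real z. *)
Lemma resolvent_ex (A : linop H) (z : R[i]) (c : R) : self_adjoint A -> 0 < c ->
  (forall x, dom A x -> c * nrm x <= nrm (A x - z *: x)) ->
  (forall x, dom A x -> c * nrm x <= nrm (A x - z^* *: x)) ->
  (forall f, dom A (resolvent A z f) /\
     A (resolvent A z f) - z *: resolvent A z f = f) /\
  (forall f, dom A f -> resolvent A z (A f - z *: f) = f).
Proof.
move=> [_ Asa] c0 Az Azc.
have Alin a x y : dom A x -> dom A y ->
    A (a *: x + y) - z^* *: (a *: x + y) =
    a *: (A x - z^* *: x) + (A y - z^* *: y).
  move=> Ax Ay; rewrite linop_linear// scalerBr scalerDr !scalerA (mulrC a).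
  by rewrite opprD addrACA.
have /choice[S SP] : forall f, exists w, dom A w /\ A w - z *: w = f.
  move=> f; have [] := @riesz_rep _ H H (dom A) (fun x => A x - z^* *: x)
     (fun x => ip f x) (nrm f / c).
  - exact: dom0.
  - exact: dom_linear.
  - exact: Alin.
  - by move=> a x y _ _; rewrite ip_linear.
  - move=> x Ax; apply: le_trans (Cauchy_Schwarz _ _) _.
    by rewrite -mulrA ler_wpM2l// ler_pdivlMl// Azc.
  move=> w [wP _]; exists w; have [Aw E] : dom A w /\ A w = f + z *: w.
    apply/Asa => x Ax; rewrite ipDl wP// ipBr ipZl ipZr subrK//.
  by rewrite E addrK.
have inj x y : dom A x -> dom A y -> A x - z *: x = A y - z *: y -> x = y.
  move=> Ax Ay xy; have Axy : dom A (x - y).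
    by rewrite addrC -scaleN1r; exact: dom_linear.
  have := Az _ Axy; rewrite (_ : A (x - y) - z *: (x - y) = 0); last first.
    have -> : A (x - y) = A x - A y.
      by rewrite addrC -scaleN1r linop_linear// scaleN1r addrC.
    by rewrite scalerBr opprD addrACA -opprD xy subrr.
  rewrite nrm0 -ler_pdivlMl// mulr0 => xy0; apply/eqP; rewrite -subr_eq0.
  by apply/eqP/nrm_eq0/eqP; rewrite eq_le xy0/=.
have Slin : linear S.
  move=> a x y; have [Ax xE] := SP x; have [Ay yE] := SP y.
  have [Axy xyE] := SP (a *: x + y); apply: inj => //; first exact: dom_linear.
  rewrite xyE linop_linear// -{1}xE -{1}yE !scalerBr scalerDr !scalerA (mulrC a).
  by rewrite opprD addrACA.
have SC x : nrm (S x) <= c^-1 * nrm x.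
  by rewrite ler_pdivlMl//; have [Sx E] := SP x; rewrite -[X in _ <= nrm X]E Az.
have [B BE] := mkbop_bound Slin SC.
have BP : [set T : 'B(H, H) |
    (forall f, dom A (T f) /\ A (T f) - z *: T f = f) /\
    (forall f, dom A f -> T (A f - z *: f) = f)] B.
  split=> f; rewrite BE//.
  by move=> Af; have [Sf Ef] := SP (A f - z *: f); exact: inj.
by have := @xgetPex _ 0 _ (ex_intro _ _ BP); apply.
Qed.

Section SelfAdjoint.
Variable A : linop H.
Hypothesis Asa : self_adjoint A.

Lemma self_adjoint_sym x y : dom A x -> dom A y -> ip (A x) y = ip x (A y).
Proof. by case: Asa => _ AP Ax Ay; have [/(_ (conj Ax erefl))->] := AP x (A x). Qed.

(** Since <x, A x> is real, the imaginary part of <x, (A - z) x> is - Im z |x|^2. *)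
Lemma self_adjoint_coercive (z : R[i]) x : dom A x ->
  `|complex.Im z| * nrm x <= nrm (A x - z *: x).
Proof.
move=> Ax; have [->|x0] := eqVneq (nrm x) 0; first by rewrite mulr0.
have xp : 0 < nrm x by rewrite lt0r x0/=.
rewrite -(ler_pM2l xp); apply: le_trans (Cauchy_Schwarz _ _).
apply: le_trans (ler_norm_Im _).
have : complex.Im (ip x (A x)) = 0.
  have := self_adjoint_sym Ax Ax; rewrite ip_conj.
  by case: (ip x (A x)) => a b [] /= ?; lra.
rewrite ipBr ipZr ip_self raddfB/=; case: z (ip x (A x)) => a b [a' b']/= ->.
rewrite sub0r normrN mulr0 add0r normrM [`|_ ^+ 2|]ger0_norm ?sqr_ge0//.
by rewrite mulrCA expr2.
Qed.

Variable z : R[i].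
Hypothesis z0 : complex.Im z != 0.

Let Rz : (forall f, dom A (resolvent A z f) /\
     A (resolvent A z f) - z *: resolvent A z f = f) /\
  (forall f, dom A f -> resolvent A z (A f - z *: f) = f).
Proof.
apply: (@resolvent_ex _ _ `|complex.Im z|) => //; first by rewrite normr_gt0.
  by move=> x; exact: self_adjoint_coercive.
move=> x Ax; apply: le_trans (self_adjoint_coercive z^* Ax).
by case: (z) => a b /=; rewrite normrN.
Qed.

Lemma resolvent_dom f : dom A (resolvent A z f).
Proof. by have [/(_ f)[]] := Rz. Qed.

Lemma resolventK f : A (resolvent A z f) - z *: resolvent A z f = f.
Proof. by have [/(_ f)[]] := Rz. Qed.

Lemma resolventE f : A (resolvent A z f) = f + z *: resolvent A z f.
Proof. by rewrite -[LHS](subrK (z *: resolvent A z f)) resolventK. Qed.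

Lemma resolvent_eq f x : dom A x -> A x = f + z *: x -> x = resolvent A z f.
Proof. by move=> Ax xE; have [_ /(_ _ Ax)] := Rz; rewrite xE addrK => ->. Qed.

End SelfAdjoint.

Lemma resolvent_conj (A : linop H) (z : R[i]) : self_adjoint A ->
  complex.Im z != 0 -> adj (resolvent A z) = resolvent A z^*.
Proof.
move=> Asa z0; have zc0 : complex.Im z^* != 0.
  by case: z z0 => a b /=; rewrite oppr_eq0.
apply: adj_unique => x y.
move: (resolvent A z x) (resolvent_dom Asa z0 x) (resolventK Asa z0 x) => v Av <-.
move: (resolvent A _ y) (resolvent_dom Asa zc0 y) (resolventK Asa zc0 y) => u Au <-.
rewrite ipBr ipZr ipBl ipZl -[conjc z]/(Num.conj z) conjCK.
by rewrite (self_adjoint_sym Asa Au Av).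
Qed.

Lemma resolvent_first (A : linop H) (z w : R[i]) f : self_adjoint A ->
  complex.Im z != 0 -> complex.Im w != 0 ->
  resolvent A z f - resolvent A w f =
    (z - w) *: resolvent A w (resolvent A z f).
Proof.
move=> Asa z0 w0.
apply/eqP; rewrite subr_eq addrC -bopZ -bopD; apply/eqP.
apply: resolvent_eq => //; first exact: resolvent_dom.
by rewrite resolventE// scalerBl -addrA subrK.
Qed.

(** The first resolvent identity between a point and its conjugate, whose difference is 2 i y. *)
Lemma im_op_resolvent (A : linop H) (x y : R) f : self_adjoint A -> y != 0 ->
  im_op (resolvent A (x +i* y)) f =
    y%:C *: resolvent A (x -i* y) (resolvent A (x +i* y) f).
Proof.
move=> Asa y0; rewrite /im_op bopZE bopBE resolvent_conj//=.
rewrite resolvent_first//= ?oppr_eq0// scalerA; congr (_ *: _).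
rewrite (_ : _ - _ = (2 * 'i) * y%:C); last by simpc; congr (_ +i* _); ring.
by rewrite mulKf// mulf_neq0 ?pnatr_eq0// neq0Ci.
Qed.

End Resolvent.

(** * Square roots and the trace norm *)

Section SquareRoot.
Variables (R : realType) (U : hilbertType R).
Implicit Types (S T P : 'B(U, U)).

Lemma nonneg_ReE T x : nonneg_op T -> ip x (T x) = (complex.Re (ip x (T x)))%:C.
Proof.
move=> /(_ x); rewrite lecE => /andP[/eqP + _].
by case: (ip x (T x)) => a b /= ->.
Qed.

Lemma nonneg_Re T x : nonneg_op T -> 0 <= complex.Re (ip x (T x)).
Proof. by move=> /(_ x); rewrite lecE => /andP[_]. Qed.

(** Polarization: the quadratic form is real at x + y and at x + i y. *)
Lemma nonneg_sym T x y : nonneg_op T -> ip (T x) y = ip x (T y).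
Proof.
move=> T0; rewrite ip_conj.
have Im0 z : complex.Im (ip z (T z)) = 0 by rewrite nonneg_ReE.
have := Im0 (x + y); have := Im0 (x + 'i *: y); have := Im0 x; have := Im0 y.
rewrite !bopD !bopZ !ipDr !ipDl !ipZr !ipZl !raddfD/=.
case: (ip x (T x)) (ip x (T y)) (ip y (T x)) (ip y (T y)).
move=> a a' [b b'] [c c'] [d d'] /= h1 h2 h3 h4.
by congr (_ +i* _); lra.
Qed.

(** Positivity of T at x - T x reads <x, T x> - 2 |T x|^2 + <T x, T T x> >= 0. The last term is at
    most |T x|^2, so |T x|^2 <= <x, T x>, and the expansion of |x - T x|^2 concludes. *)
Lemma nonneg_contraction_compl T : nonneg_op T ->
  (forall x, nrm (T x) <= nrm x) -> forall x, nrm (x - T x) <= nrm x.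
Proof.
move=> T0 TC x; rewrite -(@ler_pXn2r _ 2) ?nnegrE// nrm_sqrB.
have := nonneg_Re (x - T x) T0; rewrite bopB ipBr !ipBl.
rewrite -[ip x (T (T x))](nonneg_sym x (T x) T0) ip_self !raddfB/=.
have : complex.Re (ip (T x) (T (T x))) <= nrm (T x) ^+ 2.
  apply: le_trans (ler_Re_nrm _) _; apply: le_trans (Cauchy_Schwarz _ _) _.
  by rewrite expr2 ler_wpM2l.
by have := sqr_ge0 (nrm (T x)); lra.
Qed.

(** P is viewed as a self-adjoint operator with full domain and G is its resolvent at - e, where <x,
    (P + e) x> >= e |x|^2 gives coercivity. *)
Lemma nonneg_op_shift_inverse P (e : R) : nonneg_op P -> 0 < e ->
  exists G : 'B(U, U), (forall x, P (G x) + e%:C *: G x = x) /\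
    (forall x, G (P x + e%:C *: x) = x).
Proof.
move=> P0 e0.
pose A := @Linop R U setT P I (fun _ _ _ _ _ => I)
  (fun a x y _ _ => bop_linear P a x y).
have Asa : self_adjoint A.
  split=> [B [x Bx] _|x y]; first by exists x.
  split=> [[_ <-] z _|xy]; first by rewrite /= nonneg_sym.
  split=> //; apply: ip_ext => z; rewrite ip_conj [RHS]ip_conj -xy//.
  by rewrite /= nonneg_sym.
have coer x : dom A x -> e * nrm x <= nrm (A x - (- e%:C) *: x).
  move=> _; rewrite scaleNr opprK /=.
  have [->|x0] := eqVneq (nrm x) 0; first by rewrite mulr0.
  have xp : 0 < nrm x by rewrite lt0r x0/=.
  rewrite -(ler_pM2l xp); apply: le_trans (Cauchy_Schwarz _ _).
  apply: le_trans (ler_Re_nrm _); rewrite ipDr ipZr ip_self raddfD/=.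
  have := nonneg_Re x P0; lra.
have [] := @resolvent_ex _ _ A (- e%:C) e Asa e0 coer.
  have -> : Num.conj (- e%:C : R[i]) = - e%:C; last exact: coer.
  by apply/eqP; rewrite eq_complex /= !oppr0 !eqxx.
move=> h1 h2; exists (resolvent A (- e%:C)); split=> x.
  by have [_] := h1 x; rewrite scaleNr opprK.
by have := h2 x I; rewrite scaleNr opprK.
Qed.

(* For a non-negative contraction T put A = 1 - T and S_0 = 0,
   S_(n+1) = (A + S_n^2) / 2. The scalar recursion s_(n+1) = (1 + s_n^2) / 2
   dominates it, so S_n converges to a contraction B with B = (A + B^2) / 2, that
   is (1 - B)^2 = T. *)
Lemma nonneg_contraction_sqrt T : nonneg_op T ->
  (forall x, nrm (T x) <= nrm x) -> exists S, nonneg_op S /\ S \ob S = T.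
Proof.
move=> T0 TC; pose A := bid U - T.
have AE x : A x = x - T x by [].
have AC x : nrm (A x) <= nrm x by exact: nonneg_contraction_compl.
have Asym x y : ip (A x) y = ip x (A y).
  by rewrite !AE ipBl ipBr nonneg_sym.
pose S := fix S n : 'B(U, U) :=
  if n is n'.+1 then (2^-1)%:C *: (A + S n' \ob S n') else 0.
pose s := fix s n : R := if n is n'.+1 then 2^-1 * (1 + s n' ^+ 2) else 0.
have SE n x : S n.+1 x = (2^-1)%:C *: (A x + S n (S n x)) by [].
have S0 x : S 0 x = 0 by [].
have sE n : s n.+1 = 2^-1 * (1 + s n ^+ 2) by [].
have s01 n : 0 <= s n <= 1.
  elim: n => [|n /andP[n0 n1]]; first by rewrite /= lexx ler01.
  rewrite /= mulr_ge0 ?addr_ge0 ?sqr_ge0//=.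
  have : s n ^+ 2 <= 1 by rewrite exprn_ile1.
  lra.
(* The increment is (s_n - 1)^2 / 2. *)
have sincr n : s n <= s n.+1.
  by rewrite /=; have := sqr_ge0 (s n - 1); lra.
have Sbound n x : nrm (S n x) <= s n * nrm x.
  elim: n x => [|n IHn] x; first by rewrite nrm0 mul0r.
  rewrite SE nrmZ nrm_real ger0_norm ?invr_ge0//= -mulrA ler_wpM2l ?invr_ge0//.
  apply: le_trans (ler_nrmD _ _) _; rewrite mulrDl mul1r; apply: lerD; first exact: AC.
  apply: le_trans (IHn _) _; rewrite expr2 -mulrA ler_wpM2l//.
  by have /andP[] := s01 n.
have Sstep n x : nrm (S n.+1 x - S n x) <= (s n.+1 - s n) * nrm x.
  elim: n x => [|n IHn] x.
    rewrite SE !S0 addr0 subr0 nrmZ nrm_real ger0_norm ?invr_ge0//=.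
    by rewrite expr0n/= addr0 subr0 mulr1 ler_wpM2l ?invr_ge0//; exact: AC.
  rewrite (SE n.+1) [X in _ - X]SE -scalerBr opprD addrACA subrr add0r.
  rewrite nrmZ nrm_real ger0_norm ?invr_ge0//.
  (* The splitting a^2 - b^2 = a (a - b) + (a - b) b holds without commutation, and the scalar
     recursion admits the same one. *)
  have -> : S n.+1 (S n.+1 x) - S n (S n x) =
      S n.+1 (S n.+1 x - S n x) + (S n.+1 (S n x) - S n (S n x)).
    by rewrite bopB addrA subrK.
  have -> : (s n.+2 - s n.+1) * nrm x = 2^-1 *
      (s n.+1 * ((s n.+1 - s n) * nrm x) + (s n.+1 - s n) * (s n * nrm x)).
    by rewrite (sE n.+1) [X in (_ - X) * _ = _]sE; move: (s _) (s _) => t u; ring.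
  rewrite ler_wpM2l ?invr_ge0//; apply: le_trans (ler_nrmD _ _) _.
  have /andP[sn0 _] := s01 n.+1; rewrite lerD//.
    by apply: le_trans (Sbound _ _) _; rewrite ler_wpM2l.
  by apply: le_trans (IHn _) _; rewrite ler_wpM2l// subr_ge0.
have Sdiff m n x : (n <= m)%N -> nrm (S m x - S n x) <= (s m - s n) * nrm x.
  move=> /subnK <-; elim: (m - n)%N => [|k IHk].
    by rewrite add0n !subrr nrm0 mul0r.
  rewrite addSn -(subrK (S (k + n)%N x) (S _ x)) -addrA.
  apply: le_trans (ler_nrmD _ _) _.
  rewrite -(subrK (s (k + n)%N) (s (k + n).+1)) -addrA mulrDl.
  by rewrite lerD// Sstep.
have scvg : cvgn s.
  apply: nondecreasing_is_cvgn; first exact/nondecreasing_seqP.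
  by exists 1 => _ [n _ <-]; have /andP[] := s01 n.
have sl n : s n <= limn s.
  by apply: nondecreasing_cvgn_le => //; exact/nondecreasing_seqP.
have scvg0 (x : U) : (limn s - s n) * nrm x @[n --> \oo] --> 0.
  rewrite -[X in _ --> X](mul0r (nrm x)) -[in X in _ --> X](subrr (limn s)).
  by apply: cvgMl; apply: cvgB => //; exact: cvg_cst.
have /(@choice U U)[B BP] : forall x : U, exists w : U, S n x @[n --> \oo] --> w.
  move=> x; apply/cvg_ex; apply: cauchy_nrm => e e0.
  have /cvgrPdist_le/(_ _ e0)[N _ NP] := scvg0 x.
  have key m n : (N <= n)%N -> (n <= m)%N -> nrm (S m x - S n x) <= e.
    move=> Nn nm; apply: le_trans (Sdiff _ _ _ nm) _.
    apply: le_trans (NP n Nn); rewrite sub0r normrN.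
    by apply: le_trans (ler_norm _); rewrite ler_wpM2r// lerB.
  exists N => m n Nm Nn; have [nm|/ltnW mn] := leqP n m; first exact: key.
  by rewrite nrmB; exact: key.
have Blin : linear B.
  move=> a x y; apply: (cvg_unique _ (BP (a *: x + y))) => //.
  rewrite (_ : (fun n => S n (a *: x + y)) = fun n => a *: S n x + S n y).
    by apply: cvgD => //; apply: cvgZr.
  by apply/funext => n; exact: bop_linear.
have BC x : nrm (B x) <= 1 * nrm x.
  rewrite -(cvg_lim _ (cvg_nrm (BP x)))//.
  apply: limr_le; first by apply/cvg_ex; eexists; exact: cvg_nrm (BP x).
  apply: nearW => n; apply: le_trans (Sbound _ _) _.
  by rewrite ler_wpM2r//; have /andP[] := s01 n.
have [C CE] := mkbop_bound Blin BC.
have CP x : S n x @[n --> \oo] --> C x by rewrite CE.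
have CP0 x : nrm (S n x - C x) @[n --> \oo] --> 0.
  rewrite -[X in _ --> X](nrm0 U) -(subrr (C x)).
  by apply: cvg_nrm; apply: cvgB; [exact: CP|exact: cvg_cst].
have CCP x : S n (S n x) @[n --> \oo] --> C (C x).
  apply: (@nrm_cvg0 _ _ _ _ _ _ _
    (fun n => nrm (S n x - C x) + nrm (S n (C x) - C (C x)))).
    by rewrite -[X in _ --> X](addr0 0); apply: cvgD; exact: CP0.
  apply: nearW => n; rewrite -(subrK (S n (C x)) (S n (S n x))) -addrA.
  apply: le_trans (ler_nrmD _ _) _; rewrite lerD2r -bopB.
  apply: le_trans (Sbound _ _) _; rewrite ler_piMl//.
  by have /andP[] := s01 n.
have CAE x : C x = (2^-1)%:C *: (A x + C (C x)).
  have h : S n.+1 x @[n --> \oo] --> C x.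
    by rewrite (cvg_shiftS (fun n => S n x)); exact: CP.
  apply: (cvg_unique _ h) => //; apply: cvgZr; apply: cvgD; last exact: CCP.
  exact: cvg_cst.
have CCE x : C (C x) = C x + C x - A x.
  have /(congr1 (fun y => 2%:C *: y)) := CAE x.
  rewrite scalerA -rmorphM/= mulfV ?pnatr_eq0// scale1r.
  rewrite -[2]/(1 + 1) rmorphD scalerDl scale1r => ->.
  by rewrite addrC addKr.
have Csym x y : ip (C x) y = ip x (C y).
  have Ssym n u v : ip (S n u) v = ip u (S n v).
    elim: n u v => [|n IHn] u v; first by rewrite !S0 ip0l ipr0.
    rewrite !SE ipZr ipZl conjCR ipDl ipDr Asym !IHn//.
  have ReC u v : complex.Re (ip (C u) v) = complex.Re (ip u (C v)).
    have h : complex.Re (ip v (S n u)) @[n --> \oo] --> complex.Re (ip v (C u)).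
      by apply: cvg_ip; exact: CP.
    have h' : complex.Re (ip u (S n v)) @[n --> \oo] --> complex.Re (ip u (C v)).
      by apply: cvg_ip; exact: CP.
    rewrite Re_ipC -(cvg_lim _ h)// -(cvg_lim _ h')//; congr (lim (_ @ \oo)).
    by apply/funext => n; rewrite Re_ipC Ssym.
  have := ReC x y; have := ReC x ('i *: y); rewrite bopZ !ipZr.
  by case: (ip (C x) y) (ip x (C y)) => a b [a' b'] /= h1 h2; congr (_ +i* _); lra.
(* C is a symmetric contraction, so <x, C x> is real and at most |x|^2, which makes 1 - C
   non-negative. From C^2 = 2 C - A one gets (1 - C)^2 = 1 - A = T. *)
exists (bid U - C); split.
  move=> x; have -> : (bid U - C) x = x - C x by [].
  have : complex.Re (ip x (C x)) <= nrm x ^+ 2.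
    apply: le_trans (ler_Re_nrm _) _; apply: le_trans (Cauchy_Schwarz _ _) _.
    by rewrite expr2 ler_wpM2l// CE; have := BC x; rewrite mul1r.
  have : complex.Im (ip x (C x)) = 0.
    have := Csym x x; rewrite ip_conj.
    by case: (ip x (C x)) => a b [] /= ?; lra.
  rewrite ipBr ip_self lecE; case: (ip x (C x)) => a b /= -> h.
  by rewrite subr0 eqxx/= subr_ge0.
apply: bop_ext => x.
have -> : ((bid U - C) \ob (bid U - C)) x = (x - C x) - C (x - C x) by [].
rewrite bopB CCE AE opprB [C x + C x - _ - C x]addrAC addrK.
by rewrite addrA subrK opprB addrC subrK.
Qed.

Lemma sqrt_opP T : nonneg_op T ->
  nonneg_op (sqrt_op T) /\ sqrt_op T \ob sqrt_op T = T.
Proof.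
move=> T0; have [C C0 TC] := bop_bound T.
pose T1 : 'B(U, U) := (C^-1)%:C *: T.
have T1E x : T1 x = (C^-1)%:C *: T x by [].
have [||S [S0 SS]] := @nonneg_contraction_sqrt T1.
- by move=> x; rewrite T1E ipZr mulr_ge0// ler0c invr_ge0 ltW.
- move=> x; rewrite T1E nrmZ nrm_real ger0_norm ?invr_ge0 ?(ltW C0)//.
  by rewrite ler_pdivrMl.
have QP : [set S : 'B(U, U) | nonneg_op S /\ S \ob S = T] ((Num.sqrt C)%:C *: S).
  split=> [x|]; first by rewrite bopZE ipZr mulr_ge0// ler0c sqrtr_ge0.
  apply: bop_ext => x; rewrite bcompE !bopZE bopZ scalerA -rmorphM/=.
  rewrite -expr2 sqr_sqrtr ?ltW// -[S (S x)]/((S \ob S) x) SS T1E scalerA.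
  by rewrite -rmorphM/= mulfV ?scale1r ?gt_eqF.
by have := @xgetPex _ 0 _ (ex_intro _ _ QP); apply.
Qed.

End SquareRoot.

(** * Orthonormal systems and duality for the trace norm *)

Definition orthonormal (R : realType) (U : hilbertType R) (e : nat -> U) : Prop :=
  forall i j, ip (e i) (e j) = (i == j)%:R.

Definition contraction_op (R : realType) (U V : hilbertType R) (T : 'B(U, V)) :
  Prop := forall x, nrm (T x) <= nrm x.

Section Orthonormal.
Variables (R : realType) (U : hilbertType R) (e : nat -> U).
Hypothesis eON : orthonormal e.

Lemma nrm_orthonormal i : nrm (e i) = 1.
Proof. by apply/eqP; rewrite -(@eqrXn2 _ 2)// -Re_ip_self eON eqxx expr1n. Qed.

Lemma ip_orthonormal_sum (c : nat -> R[i]) n k :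
  ip (e k) (\sum_(0 <= j < n) c j *: e j) = if (k < n)%N then c k else 0.
Proof.
rewrite ip_sumr; elim: n => [|n IHn]; first by rewrite big_geq.
rewrite big_nat_recr//= IHn ipZr eON ltnS [in RHS]leq_eqVlt.
by have [->|kn] := eqVneq k n; rewrite ?ltnn ?add0r ?mulr1 ?mulr0 ?addr0.
Qed.

Lemma Re_ip_partial_sum x n :
  complex.Re (ip x (\sum_(0 <= j < n) ip (e j) x *: e j)) =
  \sum_(0 <= j < n) nrm (ip (e j) x) ^+ 2.
Proof.
rewrite ip_sumr raddf_sum/=; apply: eq_bigr => j _.
rewrite ipZr (ip_conj (e j) x) nrm_sqr.
by case: (ip (e j) x) => a b /=; ring.
Qed.

Lemma bessel x n : \sum_(0 <= j < n) nrm (ip (e j) x) ^+ 2 <= nrm x ^+ 2.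
Proof.
pose p := \sum_(0 <= j < n) ip (e j) x *: e j.
have pp : nrm p ^+ 2 = \sum_(0 <= j < n) nrm (ip (e j) x) ^+ 2.
  rewrite -Re_ip_self {1}/p ip_suml raddf_sum/=; rewrite !big_nat.
  apply: eq_bigr => j /andP[_ jn]; rewrite ipZl ip_orthonormal_sum jn nrm_sqr.
  by case: (ip (e j) x) => a b /=; ring.
have := sqr_ge0 (nrm (x - p)); rewrite nrm_sqrB pp Re_ip_partial_sum; lra.
Qed.

End Orthonormal.

Lemma parseval (R : realType) (U : hilbertType R) (e : nat -> U) x :
  orthonormal_basis e ->
  series (fun j => nrm (ip (e j) x) ^+ 2) @ \oo --> nrm x ^+ 2.
Proof.
move=> [_ /(_ x) ex]; rewrite -Re_ip_self.
rewrite (_ : series _ = fun n =>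
    complex.Re (ip x (series (fun j => ip (e j) x *: e j) n))).
  exact: cvg_ip.
by apply/funext => n; rewrite Re_ip_partial_sum.
Qed.

Lemma nrm_ip_conj (R : realType) (U : hilbertType R) (x y : U) :
  nrm (ip x y) = nrm (ip y x).
Proof. by rewrite ip_conj nrm_conj. Qed.

(* Expand |Q Y e_j|^2 in the basis f, exchange the sums, and bound the sum over j
   by Bessel's inequality for Y^* Q^* f_k. *)
Lemma hilbert_schmidt_contraction (R : realType) (U V : hilbertType R)
    (Q : 'B(U, V)) (e : nat -> U) (f : nat -> V) (c : R) (Y : 'B(U, U)) n :
  orthonormal e -> orthonormal_basis f ->
  (forall m, \sum_(0 <= k < m) nrm (adj Q (f k)) ^+ 2 <= c) ->
  contraction_op Y -> \sum_(0 <= j < n) nrm (Q (Y (e j))) ^+ 2 <= c.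
Proof.
move=> eON fB Qc YC.
have h : \sum_(0 <= j < n) series (fun k => nrm (ip (f k) (Q (Y (e j)))) ^+ 2) m
    @[m --> \oo] --> \sum_(0 <= j < n) nrm (Q (Y (e j))) ^+ 2.
  elim: n => [|n IHn].
    by rewrite big_geq//; under eq_fun do rewrite big_geq//; exact: cvg_cst.
  rewrite big_nat_recr//=; under eq_fun do rewrite big_nat_recr//=.
  by apply: cvgD => //; exact: parseval.
rewrite -(cvg_lim _ h)//; apply: limr_le; first by apply/cvg_ex; eexists; exact: h.
apply: nearW => m; apply: le_trans (Qc m); rewrite /series/= exchange_big/=.
apply: ler_sum => k _; apply: (@le_trans _ _ (nrm (adj Y (adj Q (f k))) ^+ 2)).
  apply: le_trans (bessel eON _ n); apply: ler_sum => j _.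
  by rewrite nrm_ip_conj -!adjP' nrm_ip_conj.
by rewrite ler_pXn2r ?nnegrE//; exact: contraction_adj.
Qed.

(* By duality, this says that the trace norm of T is at most c. *)
Definition tr_le (R : realType) (U V : hilbertType R) (e : nat -> U)
    (T : 'B(U, V)) (c : R) : Prop :=
  forall W : 'B(V, U), contraction_op W -> forall n,
    \sum_(0 <= j < n) complex.Re (ip (e j) (W (T (e j)))) <= c.

Section TraceNorm.
Variables (R : realType) (U V : hilbertType R) (e : nat -> U).
Implicit Types (T S : 'B(U, V)).

Lemma tr_leD S T c d : tr_le e S c -> tr_le e T d -> tr_le e (S + T) (c + d).
Proof.
move=> Sc Td W WC n; under eq_bigr do rewrite bopDE bopD ipDr raddfD/=.
by rewrite big_split/= lerD// ?Sc ?Td.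
Qed.

Lemma tr_leN T c : tr_le e T c -> tr_le e (- T) c.
Proof.
move=> Tc W WC n; have NWC : contraction_op (- W).
  by move=> x; rewrite -[(- W) x]/(- W x) nrmN.
apply: le_trans (Tc _ NWC n); apply: ler_sum => j _.
by rewrite -[(- T) _]/(- T (e j)) -[(- W) _]/(- W (T (e j))) bopN.
Qed.

Lemma tr_le_weaken T c d : c <= d -> tr_le e T c -> tr_le e T d.
Proof. by move=> cd Tc W WC n; apply: le_trans (Tc W WC n) cd. Qed.

(** The rank one contraction x -> <v, x> e_i, with v the normalised T e_i, isolates the i-th term of
    the trace. Through this bound trace norm limits are determined on the basis. *)
Lemma tr_le_pointwise T c i : orthonormal e -> tr_le e T c ->
  nrm (T (e i)) <= c.
Proof.
move=> eON Tc; have [T0|T0] := eqVneq (nrm (T (e i))) 0.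
  (* The empty sum already forces 0 <= c. *)
  have C0 : contraction_op (0 : 'B(V, U)) by move=> x; rewrite bop0E nrm0.
  by rewrite T0; have := Tc _ C0 0; rewrite big_geq.
have Tp : 0 < nrm (T (e i)) by rewrite lt0r T0/=.
pose v := ((nrm (T (e i)))^-1)%:C *: T (e i).
have v1 : nrm v = 1.
  by rewrite nrmZ nrm_real ger0_norm ?invr_ge0// mulVf.
have Wlin : linear (fun x => ip v x *: e i).
  by move=> a x y; rewrite ipDr ipZr scalerDl scalerA.
have WC x : nrm (ip v x *: e i) <= 1 * nrm x.
  rewrite nrmZ nrm_orthonormal// mulr1; apply: le_trans (Cauchy_Schwarz _ _) _.
  by rewrite v1.
have [W WE] := mkbop_bound Wlin WC.
have {}WC : contraction_op W by move=> x; rewrite WE; have := WC x; rewrite mul1r.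
apply: le_trans (Tc W WC i.+1); rewrite big_nat_recr//= big_nat big1 ?add0r.
  rewrite WE ipZr eON eqxx mulr1 /v ipZl ip_self conjCR -rmorphM/=.
  by rewrite expr2 mulKf.
move=> j /andP[_ ji]; rewrite WE ipZr eON ltn_eqF// mulr0//.
Qed.

End TraceNorm.

(** A test contraction composed with S and divided by d is again a contraction, hence a test for
    T. *)
Lemma tr_le_comp (R : realType) (U V W : hilbertType R) (e : nat -> U)
    (S : 'B(V, W)) (T : 'B(U, V)) (c d : R) : 0 < d ->
  (forall x, nrm (S x) <= d * nrm x) -> tr_le e T c -> tr_le e (S \ob T) (d * c).
Proof.
move=> d0 Sd Tc Y YC n.
pose Z : 'B(V, U) := (d^-1)%:C *: (Y \ob S).
have ZE x : Z x = (d^-1)%:C *: Y (S x) by [].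
have ZC : contraction_op Z.
  move=> x; rewrite ZE nrmZ nrm_real ger0_norm ?invr_ge0 ?(ltW d0)//.
  by rewrite ler_pdivrMl//; apply: le_trans (YC _) (Sd _).
rewrite -ler_pdivrMl// mulr_sumr; apply: le_trans (Tc Z ZC n).
apply: ler_sum => j _; rewrite ZE ipZr bcompE.
by case: (ip _ _) => a b /=; rewrite mul0r subr0.
Qed.

Section AbsoluteValue.
Variables (R : realType) (U V : hilbertType R) (T : 'B(U, V)).
Let P := abs_op T.

Lemma abs_opP : nonneg_op (abs_op T) /\ abs_op T \ob abs_op T = adj T \ob T.
Proof.
apply: sqrt_opP => x; rewrite bcompE adjP' ip_self ler0c sqr_ge0//.
Qed.

Let P0 : nonneg_op P. Proof. by case: abs_opP. Qed.

Lemma nrm_abs_op x : nrm (abs_op T x) = nrm (T x).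
Proof.
apply/eqP; rewrite -(@eqrXn2 _ 2)// -!Re_ip_self nonneg_sym//.
rewrite -[abs_op T (abs_op T x)]/((abs_op T \ob abs_op T) x).
by case: abs_opP => _ ->; rewrite bcompE adjP'.
Qed.

(* T G is the partial isometry of the polar decomposition of T, up to an error
   of order e. *)
Lemma abs_op_regularized (e : R) : 0 < e -> exists G : 'B(U, U),
  [/\ contraction_op (T \ob G), contraction_op (P \ob G),
      (forall x, P (G x) = x - e%:C *: G x) &
      (forall x, G (P x) = x - e%:C *: G x)].
Proof.
move=> e0; have [G [PG GP]] := nonneg_op_shift_inverse P0 e0.
have PGE x : P (G x) = x - e%:C *: G x by rewrite -{2}(PG x) addrK.
(* In x = P G x + e G x the cross term e <P G x, G x> is non-negative, so |P G x| <= |x|. *)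
have PGC : contraction_op (P \ob G).
  move=> x; rewrite bcompE -(@ler_pXn2r _ 2) ?nnegrE// -{2}(PG x) nrm_sqrD.
  rewrite -addrA lerDl addr_ge0 ?sqr_ge0// mulr_ge0// ipZr nonneg_sym//.
  rewrite -nonneg_sym// ip_conj.
  have := nonneg_ReE (G x) P0; have := nonneg_Re (G x) P0.
  case: (ip (G x) (P (G x))) => a b /= a0 [->].
  by rewrite oppr0 mulr0 subr0 mulr_ge0// ltW.
exists G; split => //.
  by move=> x; rewrite bcompE -nrm_abs_op; exact: PGC.
by move=> x; rewrite -{2}(GP x) bopD bopZ addrK.
Qed.

End AbsoluteValue.

Section TraceNormDuality.
Variables (R : realType) (U V : hilbertType R) (e : nat -> U) (T : 'B(U, V)).
Hypothesis eB : orthonormal_basis e.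
Let eON : orthonormal e. Proof. by case: eB. Qed.
Let P := abs_op T.
Let P0 : nonneg_op P. Proof. by case: (abs_opP T). Qed.

Let trnorm_leP c : (trnorm e T <= c%:E)%E <->
  forall n, \sum_(0 <= j < n) complex.Re (ip (e j) (P (e j))) <= c.
Proof.
split=> [Tc n|Pc].
  rewrite -lee_fin -sumEFin; apply: le_trans Tc; apply: nneseries_lim_ge => j _ _.
  by rewrite lee_fin nonneg_Re.
apply: lime_le.
  by apply: is_cvg_nneseries => j _ _; rewrite lee_fin nonneg_Re.
by apply: nearW => n; rewrite sumEFin lee_fin.
Qed.

(** The test contraction is the adjoint of T G: <T G e_j, T e_j> = <P G e_j, P e_j>, and P G = 1 - e
    G returns <e_j, P e_j> up to a small error. *)
Lemma tr_le_trnorm c : tr_le e T c -> (trnorm e T <= c%:E)%E.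
Proof.
move=> Tc; apply/trnorm_leP => n; apply/ler_addgt0Pr => d d0.
(* Each of the n terms may err by d / (n + 1); the successor keeps the divisor positive when n =
   0. *)
have dn : 0 < d / n.+1%:R by rewrite divr_gt0.
have [G [TG PG PGE GPE]] := abs_op_regularized T dn.
have WC : contraction_op (adj (T \ob G)) by exact: contraction_adj.
apply: le_trans (_ : \sum_(0 <= j < n) (complex.Re (ip (e j)
    (adj (T \ob G) (T (e j)))) + d / n.+1%:R) <= _).
  apply: ler_sum => j _; rewrite adjP' bcompE -adjP'.
  have -> : adj T (T (e j)) = P (P (e j)).
    by have [_ /(congr1 (fun S : 'B(U, U) => S (e j)))] := abs_opP T; rewrite !bcompE.
  rewrite -(nonneg_sym (G (e j)) (P (e j)) P0) PGE ipBl raddfB/= -addrA lerDl.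
  rewrite addrC subr_ge0 ipZl conjCR -(nonneg_sym (G (e j)) (e j) P0).
  apply: le_trans (ler_Re_nrm _) _; rewrite nrmM nrm_real ger0_norm ?(ltW dn)//.
  rewrite ler_piMr ?(ltW dn)//; apply: le_trans (Cauchy_Schwarz _ _) _.
  by rewrite nrm_orthonormal// mulr1; apply: le_trans (PG _) _; rewrite nrm_orthonormal.
rewrite big_split/= lerD ?Tc// big_const_nat subn0 iter_addr_0.
rewrite -[_ *+ n]mulr_natr -mulrA ger_pMr// mulrC ler_pdivrMr// mul1r ler_nat//.
Qed.

(** Up to a small error W T e_j is B P e_j with B = W T G a contraction. With Q the root of P and Y
    the adjoint of B, <e_j, B P e_j> = <Q Y e_j, Q e_j> is at most the mean of |Q Y e_j|^2 and |Q
    e_j|^2, and both sums are bounded by the squared Hilbert-Schmidt norm of Q, the trace of P. *)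
Lemma trnorm_tr_le c : (trnorm e T <= c%:E)%E -> tr_le e T c.
Proof.
move=> /trnorm_leP Pc W WC n; apply/ler_addgt0Pr => d d0.
have dn : 0 < d / n.+1%:R by rewrite divr_gt0.
have [G [TG PG PGE GPE]] := abs_op_regularized T dn.
have [Q0 QQ] := sqrt_opP P0; set Q := sqrt_op P in Q0 QQ.
have QE x : Q (Q x) = P x by rewrite -[LHS]/((Q \ob Q) x) QQ.
have adjQ : adj Q = Q by apply: adj_unique => x y; exact: nonneg_sym.
have nQ x : nrm (Q x) ^+ 2 = complex.Re (ip x (P x)).
  by rewrite -Re_ip_self nonneg_sym// QE.
pose B := W \ob T \ob G.
have BC : contraction_op B by move=> x; apply: le_trans (WC _) (TG _).
pose Y := adj B; have YC : contraction_op Y by exact: contraction_adj.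
have Qc m : \sum_(0 <= k < m) nrm (Q (e k)) ^+ 2 <= c.
  by under eq_bigr do rewrite nQ; exact: Pc.
have QYc : \sum_(0 <= k < n) nrm (Q (Y (e k))) ^+ 2 <= c.
  by apply: hilbert_schmidt_contraction eON eB _ YC => m; rewrite adjQ.
apply: le_trans (_ : \sum_(0 <= j < n) (2^-1 * nrm (Q (Y (e j))) ^+ 2 +
    2^-1 * nrm (Q (e j)) ^+ 2 + d / n.+1%:R) <= _).
  apply: ler_sum => j _.
  have -> : T (e j) = T (G (P (e j))) + (d / n.+1%:R)%:C *: T (G (e j)).
    by rewrite GPE bopB bopZ subrK.
  rewrite bopD bopZ ipDr ipZr raddfD/= lerD//.
    rewrite -[W _]/(B (P (e j))) -adjP -/Y -QE -nonneg_sym//.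
    have := sqr_ge0 (nrm (Q (Y (e j))- Q (e j))); rewrite nrm_sqrB; lra.
  have := ler_Re_nrm (ip (e j) (W (T (G (e j))))).
  have : nrm (ip (e j) (W (T (G (e j))))) <= 1.
    apply: le_trans (Cauchy_Schwarz _ _) _; rewrite nrm_orthonormal// mul1r.
    by apply: le_trans (BC _) _; rewrite nrm_orthonormal.
  case: (ip (e j) _) => a b /= h1 h2; rewrite mul0r subr0 ler_piMr ?(ltW dn)//.
  exact: le_trans h2 h1.
rewrite !big_split/= -!mulr_sumr big_const_nat subn0 iter_addr_0 lerD//.
  by have := Qc n; lra.
by rewrite -[_ *+ n]mulr_natr ger_pMr// mulrC ler_pdivrMr// mul1r ler_nat.
Qed.

End TraceNormDuality.

(** * Convergence in operator norm and in trace norm *)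

Section NormConvergence.
Variable R : realType.

Lemma ecvg0P (T : Type) (G : set_system T) {FG : Filter G} (f : T -> \bar R) :
  (forall t, 0 <= f t)%E ->
  f @ G --> 0%E <-> forall e : R, 0 < e -> \forall t \near G, (f t <= e%:E)%E.
Proof.
move=> f0; split=> [fG e e0|fe].
  have : nbhs (0%E : \bar R) [set x | (x < e%:E)%E].
    by apply: open_nbhs_nbhs; split; [exact: open_ereal_lt_ereal|rewrite /= lte_fin].
  by move=> h; apply: (@filterS _ G FG _ _ _ (fG _ h)) => t /= /ltW.
apply/fine_cvgP; split.
  by apply: filterS (fe _ ltr01) => t ft; rewrite ge0_fin_numE// (le_lt_trans ft)// ltry.
apply/cvgrPdist_le => e /fe; apply: filterS => t ft.
rewrite sub0r normrN ger0_norm ?fine_ge0//= -lee_fin fineK//.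
by rewrite ge0_fin_numE// (le_lt_trans ft)// ltry.
Qed.

Lemma opnorm_ge0 (U V : hilbertType R) (T : 'B(U, V)) : (0 <= opnorm T)%E.
Proof.
apply: ereal_sup_ubound; exists 0; rewrite /= ?nrm0 ?ler01// bop0 nrm0//.
Qed.

Lemma opnorm_leP (U V : hilbertType R) (T : 'B(U, V)) (c : R) : 0 <= c ->
  (opnorm T <= c%:E)%E <-> forall x, nrm (T x) <= c * nrm x.
Proof.
move=> c0; split=> [Tc x|Tc].
  have [x0|x0] := eqVneq (nrm x) 0.
    by rewrite (nrm_eq0 x0) bop0 !nrm0 mulr0.
  have xp : 0 < nrm x by rewrite lt0r x0/=.
  pose y := ((nrm x)^-1)%:C *: x.
  have y1 : nrm y = 1 by rewrite nrmZ nrm_real ger0_norm ?invr_ge0// mulVf.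
  have : ((nrm (T y))%:E <= c%:E)%E.
    by apply: le_trans Tc; apply: ereal_sup_ubound; exists y => //=; rewrite y1.
  rewrite lee_fin bopZ nrmZ nrm_real ger0_norm ?invr_ge0//.
  by rewrite ler_pdivrMl// mulrC.
apply: ge_ereal_sup => _ [x /= x1 <-]; rewrite lee_fin.
by apply: le_trans (Tc x) _; rewrite ler_piMr.
Qed.

Lemma opnorm_cvgP (U V : hilbertType R) (I : Type) (G : set_system I)
    {FG : Filter G} (T : I -> 'B(U, V)) :
  opnorm (T t) @[t --> G] --> 0%E <->
  forall e : R, 0 < e -> \forall t \near G, forall x, nrm (T t x) <= e * nrm x.
Proof.
split=> [/(ecvg0P (fun t => opnorm_ge0 (T t))) h e e0|h].
  by apply: filterS (h _ e0) => t /(opnorm_leP _ (ltW e0)).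
apply/(ecvg0P (fun t => opnorm_ge0 (T t))) => e e0.
by apply: filterS (h _ e0) => t /(opnorm_leP _ (ltW e0)).
Qed.

Lemma trnorm_cvgP (U V : hilbertType R) (b : nat -> U) (I : Type)
    (G : set_system I) {FG : Filter G} (T : I -> 'B(U, V)) :
  orthonormal_basis b ->
  trnorm b (T t) @[t --> G] --> 0%E <->
  forall e : R, 0 < e -> \forall t \near G, tr_le b (T t) e.
Proof.
move=> bB.
have tr0 t : (0 <= trnorm b (T t))%E.
  apply: nneseries_ge0 => j _ _; rewrite lee_fin nonneg_Re//.
  by case: (abs_opP (T t)).
split=> [/(ecvg0P tr0) h e e0|h].
  by apply: filterS (h _ e0) => t; exact: trnorm_tr_le.
by apply/(ecvg0P tr0) => e e0; apply: filterS (h _ e0) => t; exact: tr_le_trnorm.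
Qed.

Lemma opnorm_cvg_app (U V : hilbertType R) (I : Type) (G : set_system I)
    {FG : Filter G} (T : I -> 'B(U, V)) (S : 'B(U, V)) (u : I -> U) (v : U) :
  opnorm (T t - S) @[t --> G] --> 0%E -> u t @[t --> G] --> v ->
  T t (u t) @[t --> G] --> S v.
Proof.
move=> /opnorm_cvgP TS uv.
have -> : (fun t => T t (u t)) = (fun t => (T t - S) (u t) + S (u t)).
  by apply/funext => t; rewrite bopBE subrK.
rewrite -[X in _ --> X]add0r; apply: cvgD; last first.
  exact: continuous_cvg _ (@bop_continuous _ _ _ S v) uv.
have [M M0 uM] : exists2 M : R, 0 < M & \forall t \near G, nrm (u t) <= M.
  exists (nrm v + 1); first by rewrite ltr_wpDl.
  move/cvg_nrmP : uv => /(_ _ ltr01); apply: filterS => t ut.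
  have := ler_nrmD (u t - v) v; rewrite subrK; lra.
apply/cvg_nrmP => e e0; have eM : 0 < e / M by rewrite divr_gt0.
apply: filterS2 uM (TS _ eM) => t utM /(_ (u t)) h; rewrite subr0.
apply: le_trans h _; apply: (@le_trans _ _ (e / M * M)).
  by rewrite ler_wpM2l// ltW.
by rewrite divfK ?gt_eqF.
Qed.

Lemma trnorm_cvg_app (U V : hilbertType R) (b : nat -> U) (I : Type)
    (G : set_system I) {FG : Filter G} (T : I -> 'B(U, V)) (S : 'B(U, V)) i :
  orthonormal_basis b ->
  trnorm b (T t - S) @[t --> G] --> 0%E -> T t (b i) @[t --> G] --> S (b i).
Proof.
move=> bB /(trnorm_cvgP _ bB) TS; apply/cvg_nrmP => e /TS; apply: filterS => t.
by rewrite -bopBE; apply: tr_le_pointwise; case: bB.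
Qed.

(** In C D - C0 D0 = C (D - D0) + (C - C0) D0 the trace norm is supplied first by D - D0 and then by
    D0, hence the bound c required of D0. *)
Lemma trnorm_cvg_comp (U V W : hilbertType R) (b : nat -> U) (I : Type)
    (G : set_system I) {FG : Filter G} (C : I -> 'B(V, W)) (C0 : 'B(V, W))
    (D : I -> 'B(U, V)) (D0 : 'B(U, V)) (c : R) :
  orthonormal_basis b -> tr_le b D0 c ->
  opnorm (C t - C0) @[t --> G] --> 0%E ->
  trnorm b (D t - D0) @[t --> G] --> 0%E ->
  trnorm b (C t \ob D t - C0 \ob D0) @[t --> G] --> 0%E.
Proof.
move=> bB D0c /opnorm_cvgP CC /(trnorm_cvgP _ bB) DD; apply/(trnorm_cvgP _ bB) => e e0.
have [k k0 C0k] := bop_bound C0.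
have c1 : 0 < `|c| + 1 by rewrite ltr_wpDl.
have e1 : 0 < e / 2 / (`|c| + 1) by rewrite !divr_gt0.
have e2 : 0 < e / 2 / (k + 1) by rewrite !divr_gt0// addr_gt0.
(* Tolerance 1 bounds C t by k + 1; the other two tolerances make each summand at most e / 2. *)
apply: filterS3 (CC _ e1) (CC _ ltr01) (DD _ e2) => t h1 h2 h3.
have -> : C t \ob D t - C0 \ob D0 = C t \ob (D t - D0) + (C t - C0) \ob D0.
  by apply: bop_ext => x; rewrite !(bopBE, bopDE, bcompE) bopB addrA subrK.
rewrite (splitr e); apply: tr_leD.
  rewrite -(@divfK _ (k + 1) _ (e / 2)) ?gt_eqF ?addr_gt0// mulrC.
  apply: tr_le_comp h3; first by rewrite addr_gt0.
  move=> x; rewrite -(subrK (C0 x) (C t x)) -bopBE.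
  apply: le_trans (ler_nrmD _ _) _; rewrite mulrDl addrC lerD//.
rewrite -(@divfK _ (`|c| + 1) _ (e / 2)) ?gt_eqF//.
apply: tr_le_comp h1 _ => //; apply: tr_le_weaken D0c.
by apply: le_trans (ler_norm _) _; rewrite lerDl.
Qed.

End NormConvergence.

(** * Rigged spaces *)

Section WeightedSequences.
Variable R : realType.
Implicit Types w : nat -> {posnum R}.

Lemma wl2_series_le w (c : wl2 w) n :
  series (fun j => ((w j)%:num * nrm (c j)) ^+ 2) n <= nrm c ^+ 2.
Proof.
rewrite wl2_normE; apply: nondecreasing_cvgn_le.
  by apply: nondecreasing_series => j _ _; exact: sqr_ge0.
by apply/asboolP; case: c.
Qed.

Lemma wl2_nrm_le w (c : wl2 w) (x : R) : 0 <= x ->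
  (forall n, series (fun j => ((w j)%:num * nrm (c j)) ^+ 2) n <= x ^+ 2) ->
  nrm c <= x.
Proof.
move=> x0 cx; rewrite -(@ler_pXn2r _ 2) ?nnegrE// wl2_normE.
by apply: limr_le; [apply/asboolP; case: (c)|exact: nearW].
Qed.

Lemma l2_summable_bounded w (c : nat -> R[i]) (x : R) :
  (forall n, series (fun j => ((w j)%:num * nrm (c j)) ^+ 2) n <= x) ->
  c \in l2_summable w.
Proof.
move=> cx; apply/asboolP; apply: nondecreasing_is_cvgn.
  by apply: nondecreasing_series => j _ _; exact: sqr_ge0.
by exists x => _ [n _ <-].
Qed.

Lemma wl2_ext w (c d : wl2 w) : (forall j, c j = d j) -> c = d.
Proof. by move=> cd; apply: val_inj; apply/funext. Qed.

Lemma bop_delta_ext (V : normedModType R[i]) w (S T : 'B(wl2 w, V)) :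
  (forall j, S (wl2_delta w j) = T (wl2_delta w j)) -> S = T.
Proof.
move=> ST; apply: bop_ext => c.
have h (Q : 'B(wl2 w, V)) : series (fun j => c j *: Q (wl2_delta w j)) @ \oo --> Q c.
  rewrite (_ : series _ = Q \o series (fun j => c j *: wl2_delta w j)).
    by apply: continuous_cvg; [exact: bop_continuous|exact: wl2_expansion].
  by apply/funext => n; rewrite /series/= bop_sum;
    apply: eq_bigr => j _; rewrite bopZ.
have := h S; rewrite (_ : (fun j => _) = fun j => c j *: T (wl2_delta w j)).
  by move=> hS; apply: (cvg_unique _ hS) => //; exact: h.
by apply/funext => j; rewrite ST.
Qed.

Definition diag_op w w' (m : nat -> R) : 'B(wl2 w, wl2 w') :=
  xget 0 [set T : 'B(wl2 w, wl2 w') | forall c j, T c j = (m j)%:C * c j].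

Lemma diag_op_ex w w' (m : nat -> R) (C : R) : 0 <= C ->
  (forall j, (w' j)%:num * `|m j| <= C * (w j)%:num) ->
  (forall c j, diag_op w w' m c j = (m j)%:C * c j) /\
  (forall c, nrm (diag_op w w' m c) <= C * nrm c).
Proof.
move=> C0 mC.
have le (c : wl2 w) n : series (fun j => ((w' j)%:num * nrm ((m j)%:C * c j)) ^+ 2) n
    <= (C * nrm c) ^+ 2.
  rewrite exprMn; apply: (@le_trans _ _ (C ^+ 2 *
    series (fun j => ((w j)%:num * nrm (c j)) ^+ 2) n)).
    rewrite /series/= mulr_sumr; apply: ler_sum => j _.
    rewrite -exprMn ler_pXn2r ?nnegrE ?mulr_ge0// nrmM nrm_real !mulrA.
    by rewrite ler_wpM2r.
  by rewrite ler_wpM2l ?sqr_ge0// wl2_series_le.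
pose f (c : wl2 w) : wl2 w' := WL2 (l2_summable_bounded (le c)).
have fE c j : f c j = (m j)%:C * c j by [].
have flin : linear f.
  move=> a x y; apply: wl2_ext => j.
  rewrite -[RHS]/(a * f x j + f y j) !fE -[(a *: x + y) j]/(a * x j + y j).
  by rewrite mulrDr mulrCA.
have fC c : nrm (f c) <= C * nrm c.
  by apply: (@wl2_nrm_le w' (f c)) (le c); rewrite mulr_ge0.
have [T TE] := mkbop_bound flin fC.
have TP : [set T : 'B(wl2 w, wl2 w') | forall c j, T c j = (m j)%:C * c j] T.
  by move=> c j; rewrite TE fE.
have dE : forall c j, diag_op w w' m c j = (m j)%:C * c j.
  by have := @xgetPex _ 0 _ (ex_intro _ _ TP); apply.
split=> // c; suff -> : diag_op w w' m c = f c by [].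
by apply: wl2_ext => j; rewrite dE.
Qed.

(* The unitary operator between two weighted spaces given by multiplication by
   the quotient of the weights. *)
Definition reweight w w' : 'B(wl2 w, wl2 w') :=
  diag_op w w' (fun j => (w j)%:num / (w' j)%:num).

Lemma reweightE w w' c j :
  reweight w w' c j = ((w j)%:num / (w' j)%:num)%:C * c j.
Proof.
have [||+ _] := @diag_op_ex w w' (fun j => (w j)%:num / (w' j)%:num) 1; last exact.
  exact: ler01.
by move=> i; rewrite mul1r ger0_norm ?divr_ge0// mulrCA mulfV ?mulr1.
Qed.

Lemma reweightK w w' c : reweight w' w (reweight w w' c) = c.
Proof.
apply: wl2_ext => j; rewrite !reweightE mulrA -rmorphM/= mulrA divfK//.
by rewrite mulfV// mul1r.
Qed.

Lemma ip_reweight w w' c d : ip (reweight w w' c) (reweight w w' d) = ip c d.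
Proof.
rewrite -[LHS]/(wl2_form _ _) -[RHS]/(wl2_form _ _) /wl2_form.
congr csum; apply/funext => j; rewrite !reweightE rmorphM/=.
move: (c j) (d j) => [a b] [a' b'] /=; simpc; congr (_ +i* _); field;
  by rewrite gt_eqF.
Qed.

Lemma nrm_reweight w w' c : nrm (reweight w w' c) = nrm c.
Proof. by apply/eqP; rewrite -(@eqrXn2 _ 2)// -!Re_ip_self ip_reweight. Qed.

Lemma pairing_delta w w' j (d : wl2 w) : pairing (wl2_delta w' j) d = d j.
Proof.
rewrite /pairing (_ : (fun i => _) = fun i => ((i == j)%:R * d j)); last first.
  apply/funext => i; rewrite -[wl2_val _ i]/((i == j)%:R).
  by have [->|_] := eqVneq i j; rewrite ?mul1r ?rmorph1 ?mul1r// rmorph0 !mul0r.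
have L (x : R) : limn (series (fun i => (i == j)%:R * x)) = x.
  apply/cvg_lim => //; apply: cvg_near_cst; exists j.+1 => // n /= jn.
  rewrite /series/= (bigD1_seq j) ?mem_index_iota ?iota_uniq//= big1; last first.
    by move=> i ij; rewrite (negbTE ij) mul0r.
  by rewrite eqxx mul1r addr0.
rewrite /csum; case: (d j) => a b; congr (_ +i* _).
  rewrite -[RHS]L; congr (limn (series _)); apply/funext => i.
  by case: (i == j); rewrite ?mul1r ?mul0r.
rewrite -[RHS]L; congr (limn (series _)); apply/funext => i.
by case: (i == j); rewrite ?mul1r ?mul0r.
Qed.

End WeightedSequences.

(** * Coefficients in an orthonormal system *)

Section Coefficients.
Variables (R : realType) (U : hilbertType R) (e : nat -> U).

Definition coef_op : 'B(U, l2 R) :=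
  xget 0 [set T : 'B(U, l2 R) | forall x j, T x j = ip (e j) x].

(** The sum of the series with coefficients c in the system e; as an adjoint it is bounded from the
    start, and convergence of the series follows by continuity. *)
Definition synth_op : 'B(l2 R, U) := adj coef_op.

Hypothesis eON : orthonormal e.

Lemma coef_op_ex : (forall x j, coef_op x j = ip (e j) x) /\ contraction_op coef_op.
Proof.
have le x n : series (fun j => ((unit_weight R j)%:num * nrm (ip (e j) x)) ^+ 2) n
    <= nrm x ^+ 2.
  by apply: le_trans (bessel eON x n); rewrite /series/=; under eq_bigr do rewrite mul1r.
pose f x : l2 R := WL2 (l2_summable_bounded (le x)).
have flin : linear f.
  by move=> a x y; apply: wl2_ext => j; exact: ip_linear.
have fC x : nrm (f x) <= 1 * nrm x.
  by rewrite mul1r; apply: (@wl2_nrm_le _ _ (f x)) (le x).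
have [T TE] := mkbop_bound flin fC.
have TP : [set T : 'B(U, l2 R) | forall x j, T x j = ip (e j) x] T.
  by move=> c j; rewrite TE.
have dE : forall x j, coef_op x j = ip (e j) x.
  by have := @xgetPex _ 0 _ (ex_intro _ _ TP); apply.
split=> // x; have := fC x; rewrite mul1r; suff -> : coef_op x = f x by [].
by apply: wl2_ext => j; rewrite dE.
Qed.

Lemma coef_opE x j : coef_op x j = ip (e j) x.
Proof. by case: coef_op_ex. Qed.

Lemma l2_ip (c d : l2 R) : ip c d = pairing c d.
Proof.
rewrite -[LHS]/(wl2_form _ _) /wl2_form /pairing; congr csum.
by apply/funext => j; rewrite expr1n mul1r.
Qed.

Lemma synth_op_delta j : synth_op (wl2_delta _ j) = e j.
Proof.
by apply: ip_ext => x; rewrite ip_conj adjP l2_ip pairing_delta coef_opE -ip_conj.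
Qed.

Lemma synth_op_cvg (c : l2 R) : series (fun j => c j *: e j) @ \oo --> synth_op c.
Proof.
rewrite (_ : series _ =
    synth_op \o series (fun j => c j *: wl2_delta (unit_weight R) j)).
  by apply: continuous_cvg; [exact: bop_continuous|exact: wl2_expansion].
apply/funext => n; rewrite /series/= bop_sum.
by apply: eq_bigr => j _; rewrite bopZ synth_op_delta.
Qed.

Lemma synth_opK c : coef_op (synth_op c) = c.
Proof.
suff E : coef_op \ob synth_op = bid (l2 R).
  by rewrite -[LHS]/((coef_op \ob synth_op) c) E.
apply: bop_delta_ext => j; rewrite bcompE synth_op_delta; apply: wl2_ext => i.
by rewrite coef_opE eON.
Qed.

End Coefficients.

Lemma coef_opK (R : realType) (U : hilbertType R) (e : nat -> U) x :
  orthonormal_basis e -> synth_op e (coef_op e x) = x.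
Proof.
move=> [eON eB]; apply: (cvg_unique _ _ (eB x)) => //.
have := @synth_op_cvg _ _ _ eON (coef_op e x).
rewrite (_ : (fun j => _) = (fun j => ip (e j) x *: e j))//.
by apply/funext => j; rewrite coef_opE.
Qed.

(** * The rigging of a frame *)

Section Rigging.
Variables (R : realType) (H K : hilbertType R) (F : frame H K).
Implicit Types (c : Hplus F) (d u v : Hminus F) (k : K) (f : H).

Let phiB : orthonormal_basis (phi F) := phi_basis F.
Let psiB : orthonormal_basis (psi F) := psi_basis F.
Let phiON : orthonormal (phi F). Proof. by case: phiB. Qed.
Let psiON : orthonormal (psi F). Proof. by case: psiB. Qed.

(* The Riesz isomorphism for the pairing of H_1 and H_{-1}. *)
Definition sharp : 'B(Hminus F, Hplus F) := reweight (kappa F) (kappaV F).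
Definition flat : 'B(Hplus F, Hminus F) := reweight (kappaV F) (kappa F).

Lemma flatK c : sharp (flat c) = c. Proof. exact: reweightK. Qed.

Lemma pairing_sharp c d : pairing c d = ip c (sharp d).
Proof.
rewrite -[RHS]/(wl2_form _ _) /wl2_form /pairing; congr csum; apply/funext => j.
rewrite reweightE; move: (c j) (d j) => [a b] [a' b'] /=; simpc.
by congr (_ +i* _); field; rewrite gt_eqF.
Qed.

Lemma pairing_sharpl d c : pairing d c = ip (sharp d) c.
Proof.
rewrite -[RHS]/(wl2_form _ _) /wl2_form /pairing; congr csum; apply/funext => j.
rewrite reweightE; move: (c j) (d j) => [a b] [a' b'] /=; simpc.
by congr (_ +i* _); field; rewrite gt_eqF.
Qed.

Lemma pairing_conj c d : pairing d c = (pairing c d)^*.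
Proof. by rewrite pairing_sharp pairing_sharpl -ip_conj. Qed.

Lemma pairing_inj d d' : (forall c, pairing c d = pairing c d') -> d = d'.
Proof.
move=> dd; apply: (can_inj (@reweightK _ _ (kappaV F))).
by apply: ip_ext => c; rewrite -!pairing_sharp.
Qed.

(** These four maps identify H_{-1} and H_1 unitarily with K. The frame operator is [Hminus_to_K]
    after [emb], and its adjoint is [incl] after [K_to_Hplus]. The hypotheses on the sandwiched
    resolvent in K thereby become statements about the rigged resolvent, with the same operator and
    trace norms. *)
Definition Hminus_to_K : 'B(Hminus F, K) :=
  synth_op (psi F) \ob reweight (kappa F) (unit_weight R).
Definition K_to_Hminus : 'B(K, Hminus F) :=
  reweight (unit_weight R) (kappa F) \ob coef_op (psi F).
Definition K_to_Hplus : 'B(K, Hplus F) :=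
  reweight (unit_weight R) (kappaV F) \ob coef_op (psi F).
Definition Hplus_to_K : 'B(Hplus F, K) :=
  synth_op (psi F) \ob reweight (kappaV F) (unit_weight R).

Lemma Hminus_to_KK d : K_to_Hminus (Hminus_to_K d) = d.
Proof. by rewrite !bcompE synth_opK// reweightK. Qed.

Lemma K_to_HminusK k : Hminus_to_K (K_to_Hminus k) = k.
Proof. by rewrite !bcompE reweightK coef_opK. Qed.

Lemma K_to_HplusK k : Hplus_to_K (K_to_Hplus k) = k.
Proof. by rewrite !bcompE reweightK coef_opK. Qed.

Lemma Hplus_to_KK c : K_to_Hplus (Hplus_to_K c) = c.
Proof. by rewrite !bcompE synth_opK// reweightK. Qed.

Lemma ip_coef_op (x y : K) : ip (coef_op (psi F) x) (coef_op (psi F) y) = ip x y.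
Proof. by rewrite -adjP coef_opK. Qed.

Lemma ip_K_to_Hplus k k' : ip (K_to_Hplus k) (K_to_Hplus k') = ip k k'.
Proof. by rewrite !bcompE ip_reweight ip_coef_op. Qed.

Lemma ip_K_to_Hminus k k' : ip (K_to_Hminus k) (K_to_Hminus k') = ip k k'.
Proof. by rewrite !bcompE ip_reweight ip_coef_op. Qed.

Lemma nrm_K_to_Hplus k : nrm (K_to_Hplus k) = nrm k.
Proof. by apply/eqP; rewrite -(@eqrXn2 _ 2)// -!Re_ip_self ip_K_to_Hplus. Qed.

Lemma nrm_K_to_Hminus k : nrm (K_to_Hminus k) = nrm k.
Proof. by apply/eqP; rewrite -(@eqrXn2 _ 2)// -!Re_ip_self ip_K_to_Hminus. Qed.

Lemma nrm_Hplus_to_K c : nrm (Hplus_to_K c) = nrm c.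
Proof. by rewrite -{2}(Hplus_to_KK c) nrm_K_to_Hplus. Qed.

Lemma nrm_Hminus_to_K d : nrm (Hminus_to_K d) = nrm d.
Proof. by rewrite -{2}(Hminus_to_KK d) nrm_K_to_Hminus. Qed.

Lemma sharp_K_to_Hminus k : sharp (K_to_Hminus k) = K_to_Hplus k.
Proof.
apply: wl2_ext => j; rewrite !bcompE !reweightE mulrA -rmorphM/=; congr (_%:C * _).
by field; rewrite gt_eqF.
Qed.

Lemma pairing_K_to_Hplus k d : pairing (K_to_Hplus k) d = ip k (Hminus_to_K d).
Proof.
by rewrite -{1}(Hminus_to_KK d) pairing_sharp sharp_K_to_Hminus ip_K_to_Hplus.
Qed.

Lemma pairing_K_to_Hplusr d k : pairing d (K_to_Hplus k) = ip (Hminus_to_K d) k.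
Proof. by rewrite pairing_conj pairing_K_to_Hplus -ip_conj. Qed.

Lemma embE f j : emb F f j = ip (phi F j) f.
Proof.
(* The weights decrease, so the first one bounds the embedding. *)
have bd : forall j, (kappa F j)%:num * `|1| <=
    (kappa F 0)%:num * (unit_weight R j)%:num.
  by move=> i; rewrite normr1 !mulr1; exact: kappa_decr.
have [dE _] := diag_op_ex (ge0 (kappa F 0)) bd.
have TP : [set T : 'B(H, Hminus F) | forall f j, T f j = ip (phi F j) f]
    (diag_op (unit_weight R) (kappa F) (fun=> 1) \ob coef_op (phi F)).
  by move=> g i /=; rewrite dE mul1r coef_opE.
by have := @xgetPex _ 0 _ (ex_intro _ _ TP); apply.
Qed.

Lemma incl_emb c f : ip (Defs.incl F c) f = pairing c (emb F f).
Proof.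
have bd : forall j, (unit_weight R j)%:num * `|1| <=
    (kappa F 0)%:num * (kappaV F j)%:num.
  move=> i; rewrite normr1 !mulr1 /= ler_pdivlMr// mul1r; exact: kappa_decr.
have [dE _] := diag_op_ex (ge0 (kappa F 0)) bd.
pose T : 'B(Hplus F, H) :=
  synth_op (phi F) \ob diag_op (kappaV F) (unit_weight R) (fun=> 1).
have TP : [set T : 'B(Hplus F, H) |
    forall c : Hplus F, series (fun j => c j *: phi F j) @ \oo --> T c] T.
  move=> a /=; have := @synth_op_cvg _ _ _ phiON
    (diag_op (kappaV F) (unit_weight R) (fun=> 1) a).
  by rewrite (_ : (fun j => _) = (fun j => a j *: phi F j))//;
    apply/funext => j; rewrite dE mul1r.
have iP : forall a : Hplus F, series (fun j => a j *: phi F j) @ \oo --> Defs.incl F a.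
  by have := @xgetPex _ 0 _ (ex_intro _ _ TP); apply.
have -> : Defs.incl F c = T c by apply: (cvg_unique _ (iP c)) => //; exact: TP.
rewrite adjP l2_ip /pairing; congr csum; apply/funext => j.
by rewrite dE mul1r coef_opE// embE.
Qed.

Lemma emb_incl f c : ip f (Defs.incl F c) = pairing (emb F f) c.
Proof. by rewrite pairing_conj -incl_emb -ip_conj. Qed.

Lemma frame_op_emb f : F f = Hminus_to_K (emb F f).
Proof.
apply: (cvg_unique _ (@frame_opE _ _ _ F f)) => //.
have := @synth_op_cvg _ _ _ psiON (reweight (kappa F) (unit_weight R) (emb F f)).
by rewrite (_ : (fun j => _) = (fun j => ((kappa F j)%:num%:C * ip (phi F j) f)
  *: psi F j))//; apply/funext => j; rewrite reweightE embE divr1.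
Qed.

Lemma adj_frame_op k : adj F k = Defs.incl F (K_to_Hplus k).
Proof.
suff -> : adj F = Defs.incl F \ob K_to_Hplus by [].
apply: adj_unique => f {}k.
by rewrite bcompE incl_emb pairing_K_to_Hplus frame_op_emb.
Qed.

Lemma frame_sandwich (T : 'B(H, H)) :
  F \ob T \ob adj F = Hminus_to_K \ob rig F T \ob K_to_Hplus.
Proof.
by apply: bop_ext => k; rewrite 2!bcompE frame_op_emb adj_frame_op.
Qed.

Lemma emb_phi j : emb F (phi F j) = wl2_delta (kappa F) j.
Proof. by apply: wl2_ext => i; rewrite embE phiON. Qed.

Lemma incl_inj c c' : Defs.incl F c = Defs.incl F c' -> c = c'.
Proof.
move=> cc; apply: wl2_ext => j.
by rewrite -!(pairing_delta (kappa F)) -emb_phi -!emb_incl cc.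
Qed.

(** The defining property of the left side determines it: the image of [emb] contains every delta
    sequence, and [incl] is injective. *)
Lemma rig_perturbE (J : 'B(K, K)) :
  rig_perturb F (frame_perturbation F J) = K_to_Hplus \ob J \ob Hminus_to_K.
Proof.
have E f : Defs.incl F ((K_to_Hplus \ob J \ob Hminus_to_K) (emb F f)) =
    frame_perturbation F J f.
  by rewrite 2!bcompE -frame_op_emb -adj_frame_op.
apply: bop_delta_ext => j; rewrite -emb_phi; apply: incl_inj; rewrite E.
have TP : [set T : 'B(Hminus F, Hplus F) | forall f, Defs.incl F (T (emb F f)) =
    frame_perturbation F J f] (K_to_Hplus \ob J \ob Hminus_to_K) by exact: E.
by have := @xgetPex _ 0 _ (ex_intro _ _ TP); apply.
Qed.

Lemma frame_perturbation_rig (J : 'B(K, K)) f :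
  frame_perturbation F J f =
  Defs.incl F (rig_perturb F (frame_perturbation F J) (emb F f)).
Proof.
rewrite rig_perturbE.
rewrite -[RHS]/(Defs.incl F (K_to_Hplus (J (Hminus_to_K (emb F f))))).
by rewrite -frame_op_emb -adj_frame_op.
Qed.

Lemma rig_perturb_sym (J : 'B(K, K)) u v : self_adjoint_bop J ->
  pairing u (rig_perturb F (frame_perturbation F J) v) =
  pairing (rig_perturb F (frame_perturbation F J) u) v.
Proof.
move=> Jsa; rewrite rig_perturbE -[LHS]/(pairing u (K_to_Hplus (J (Hminus_to_K v)))).
rewrite -[RHS]/(pairing (K_to_Hplus (J (Hminus_to_K u))) v).
by rewrite pairing_K_to_Hplusr pairing_K_to_Hplus Jsa.
Qed.

Lemma rig_adjP (T : 'B(Hplus F, Hminus F)) (f' g : Hplus F) :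
  pairing (rig_adj T f') g = pairing f' (T g).
Proof.
have TP : [set S : 'B(Hplus F, Hminus F) |
    forall f g : Hplus F, pairing (S f) g = pairing f (T g)] (flat \ob adj (sharp \ob T)).
  by move=> a b /=; rewrite pairing_sharpl flatK adjP bcompE pairing_sharp.
by have := @xgetPex _ 0 _ (ex_intro _ _ TP); apply.
Qed.

Lemma rig_adjP' (T : 'B(Hplus F, Hminus F)) (f' g : Hplus F) :
  pairing g (rig_adj T f') = pairing (T g) f'.
Proof.
have := rig_adjP T f' g; rewrite pairing_conj => /(congr1 (@conjc R)).
by rewrite conjcK -pairing_conj.
Qed.

Lemma rig_adj_unique (S T : 'B(Hplus F, Hminus F)) :
  (forall f g : Hplus F, pairing f (S g) = pairing (T f) g) -> rig_adj T = S.
Proof.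
by move=> ST; apply: bop_ext => f; apply: pairing_inj => g; rewrite rig_adjP' ST.
Qed.

Lemma rig_adj_bound (T : 'B(Hplus F, Hminus F)) (a : R) :
  (forall f : Hplus F, nrm (T f) <= a * nrm f) ->
  forall f : Hplus F, nrm (rig_adj T f) <= a * nrm f.
Proof.
move=> Ta f; have [S0|S0] := eqVneq (nrm (rig_adj T f)) 0.
  by rewrite S0; exact: le_trans (nrm_ge0 _) (Ta f).
have Sp : 0 < nrm (rig_adj T f) by rewrite lt0r S0/=.
rewrite -(ler_pM2l Sp) -expr2 -(nrm_reweight (kappaV F)) -Re_ip_self.
rewrite -pairing_sharpl rig_adjP pairing_sharp.
apply: le_trans (ler_Re_nrm _) _; apply: le_trans (Cauchy_Schwarz _ _) _.
rewrite !nrm_reweight [leRHS](_ : _ = nrm f * (a * nrm (rig_adj T f))); last by ring.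
by rewrite ler_wpM2l//; have := Ta (sharp (rig_adj T f)); rewrite nrm_reweight.
Qed.

Lemma Hplus_basisE j : Hplus_basis F j = K_to_Hplus (psi F j).
Proof.
apply: wl2_ext => i; rewrite bcompE reweightE coef_opE// psiON /=.
rewrite -[LHS]/((kappa F j)%:num%:C * (i == j)%:R) div1r invrK.
by have [->|] := eqVneq i j; rewrite ?mulr0.
Qed.

Lemma Hplus_basis_ext (V : normedModType R[i]) (S T : 'B(Hplus F, V)) :
  (forall j, S (Hplus_basis F j) = T (Hplus_basis F j)) -> S = T.
Proof.
move=> ST; apply: bop_delta_ext => j.
have -> : wl2_delta (kappaV F) j = ((kappa F j)%:num^-1)%:C *: Hplus_basis F j.
  by rewrite scalerA -rmorphM/= mulVf// scale1r.
by rewrite (bopZ S) (bopZ T) ST.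
Qed.

Lemma pairingDr c d d' : pairing c (d + d') = pairing c d + pairing c d'.
Proof. by rewrite !pairing_sharp bopD ipDr. Qed.

Lemma pairingBr c d d' : pairing c (d - d') = pairing c d - pairing c d'.
Proof. by rewrite !pairing_sharp bopB ipBr. Qed.

Lemma pairingZr a c d : pairing c (a *: d) = a * pairing c d.
Proof. by rewrite !pairing_sharp bopZ ipZr. Qed.

Lemma pairingDl c c' d : pairing (c + c') d = pairing c d + pairing c' d.
Proof. by rewrite !pairing_sharp ipDl. Qed.

Lemma pairingDl' d d' c : pairing (d + d') c = pairing d c + pairing d' c.
Proof. by rewrite !pairing_sharpl bopD ipDl. Qed.

Lemma Hplus_basis_basis : orthonormal_basis (Hplus_basis F).
Proof.
split=> [i j|c]; first by rewrite !Hplus_basisE ip_K_to_Hplus.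
rewrite (_ : series _ = K_to_Hplus \o
    series (fun j => ip (psi F j) (Hplus_to_K c) *: psi F j)).
  rewrite -[X in _ --> X](Hplus_to_KK c).
  apply: continuous_cvg; first exact: bop_continuous.
  by case: psiB => _; apply.
apply/funext => n; rewrite [RHS]/comp /series bop_sum; apply: eq_bigr => j _.
by rewrite bopZ Hplus_basisE -[in LHS](Hplus_to_KK c) ip_K_to_Hplus.
Qed.

(** Conjugation by the unitaries turns a test contraction from H_{-1} to H_1 into one on K. *)
Lemma tr_le_rig (T : 'B(Hplus F, Hminus F)) (a : R) :
  tr_le (psi F) (Hminus_to_K \ob T \ob K_to_Hplus) a -> tr_le (Hplus_basis F) T a.
Proof.
move=> Ta W WC n; pose Y := Hplus_to_K \ob W \ob K_to_Hminus.
have YC : contraction_op Y.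
  move=> k; rewrite 2!bcompE nrm_Hplus_to_K; apply: le_trans (WC _) _.
  by rewrite nrm_K_to_Hminus.
apply: le_trans (Ta Y YC n); apply: ler_sum => j _.
rewrite -[Y _]/(Hplus_to_K (W (K_to_Hminus (Hminus_to_K (T (K_to_Hplus _)))))).
by rewrite Hminus_to_KK -ip_K_to_Hplus Hplus_to_KK -Hplus_basisE.
Qed.

(** Here |F phi_j| = kappa_j, so the square summability of kappa is the Hilbert-Schmidt property of
    the frame operator. *)
Lemma hilbert_schmidt_frame (Y : 'B(K, K)) n (C : R) :
  (forall m, \sum_(0 <= k < m) (kappa F k)%:num ^+ 2 <= C) -> contraction_op Y ->
  \sum_(0 <= j < n) nrm (adj F (Y (psi F j))) ^+ 2 <= C.
Proof.
move=> kC; apply: (hilbert_schmidt_contraction _ psiON phiB) => m.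
rewrite (_ : \sum_(0 <= k < m) _ = \sum_(0 <= k < m) (kappa F k)%:num ^+ 2)//.
apply: eq_bigr => j _; rewrite (_ : adj (adj F) = F); last first.
  by apply: adj_unique => k f; rewrite adjP'.
rewrite frame_op_emb nrm_Hminus_to_K emb_phi.
rewrite (_ : wl2_delta _ j = (kappa F j)%:num%:C *: K_to_Hminus (psi F j)).
  by rewrite nrmZ nrm_real ger0_norm// nrm_K_to_Hminus nrm_orthonormal// mulr1.
apply: wl2_ext => i; rewrite -[RHS]/((kappa F j)%:num%:C * K_to_Hminus _ i).
rewrite bcompE reweightE coef_opE// psiON -[LHS]/((i == j)%:R).
by have [->|] := eqVneq i j; rewrite ?mulr0// mulr1 -rmorphM/= mul1r mulfV.
Qed.

End Rigging.

(** * Density of the range in the fibre *)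

Section ClosedRangeDensity.
Variables (R : realType) (U V W : hilbertType R) (T : 'B(U, V)).

Lemma crange_ip_ext (u v : crange T) :
  (forall f, ip (to_crange T f) u = ip (to_crange T f) v) -> u = v.
Proof.
move=> uv; apply/eqP; rewrite -subr_eq0; apply/eqP; set w := u - v.
have Tw f : ip (T f) (crange_val w) = 0.
  rewrite -[LHS]/(ip (to_crange T f) w) ipBr uv subrr//.
have wcl : closure (range T) (crange_val w) by case: (w) => x /= /asboolP.
apply: nrm_eq0; rewrite /nrm crange_norm -/(nrm (crange_val w)).
have [//|w0] := eqVneq (nrm (crange_val w)) 0.
have wp : 0 < nrm (crange_val w) by rewrite lt0r w0/=.
have wpC : 0 < (nrm (crange_val w))%:C :> R[i] by rewrite ltcR.
(* Some T f lies at distance less than |w| from w, which is impossible since T f is orthogonal to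
   w. *)
have [_ [[f _ <-]]] := wcl _ (nbhsx_ballx (crange_val w) _ wpC).
rewrite -ball_normE /= nrmE ltcR => h; exfalso; move: h; apply/negP; rewrite -leNgt.
rewrite -(ler_pM2l wp) -expr2 -Re_ip_self.
apply: le_trans (Cauchy_Schwarz _ _); apply: le_trans (ler_Re_nrm _).
have wT : ip (crange_val w) (T f) = 0 by rewrite ip_conj Tw conjc0.
by rewrite (ipBr _ _ (T f)) wT subr0.
Qed.

(** Taking adjoints moves the comparison to vectors of the fibre, which are determined by their
    inner products with the range. *)
Lemma bop_crange_ext (S S' : 'B(crange T, W)) :
  (forall f, S (to_crange T f) = S' (to_crange T f)) -> S = S'.
Proof.
move=> SS; apply: bop_ext => u; apply: ip_ext => x.
rewrite -!adjP; congr (ip _ _); apply: crange_ip_ext => f.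
by rewrite !adjP' SS.
Qed.

End ClosedRangeDensity.

(** * Boundary values and the evaluation operator *)

Section BoundaryValues.
Variables (R : realType) (H K : hilbertType R) (F : frame H K).

Lemma rigE (T : 'B(H, H)) (f g : Hplus F) :
  pairing f (rig F T g) = ip (Defs.incl F f) (T (Defs.incl F g)).
Proof. by rewrite incl_emb. Qed.

Lemma rig_adj_rig (T : 'B(H, H)) : rig_adj (rig F T) = rig F (adj T).
Proof.
apply: rig_adj_unique => f g.
by rewrite rigE adjP' emb_incl.
Qed.

Lemma rig_adjB (S T : 'B(Hplus F, Hminus F)) :
  rig_adj (S - T) = rig_adj S - rig_adj T.
Proof.
apply: rig_adj_unique => f g; rewrite pairing_sharp bopBE bopB ipBr.
by rewrite -!pairing_sharp !rig_adjP' !pairing_sharpl bopBE bopB ipBl.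
Qed.

Lemma rig_imE (T : 'B(Hplus F, Hminus F)) f :
  rig_im T f = (2 * 'i)^-1 *: (T f - rig_adj T f).
Proof. by []. Qed.

Lemma rig_im_sym (T : 'B(Hplus F, Hminus F)) f g :
  pairing (rig_im T f) g = pairing f (rig_im T g).
Proof.
rewrite !rig_imE pairing_sharp pairing_sharpl !bopZ ipZl ipZr !bopB ipBl ipBr.
rewrite -!pairing_sharp -!pairing_sharpl rig_adjP rig_adjP'.
rewrite (_ : ((2 * 'i)^-1)^*%R = - (2 * 'i)^-1); first by rewrite mulNr -mulrN opprB.
rewrite fmorphV rmorphM/= -invrN -mulrN; congr (_ * _)^-1.
  by rewrite rmorph_nat.
by apply/eqP; rewrite eq_complex /= ?oppr0 !eqxx.
Qed.

Lemma opnorm_cvg_rig (T : R -> 'B(H, H)) (S : 'B(K, K)) :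
  opnorm (F \ob T y \ob adj F - S) @[y --> 0^'+] --> 0%E ->
  opnorm (rig F (T y) - K_to_Hminus F \ob S \ob Hplus_to_K F) @[y --> 0^'+] --> 0%E.
Proof.
move=> /opnorm_cvgP TS; apply/opnorm_cvgP => e /TS.
apply: filterS => y h c; have := h (Hplus_to_K F c).
rewrite nrm_Hplus_to_K frame_sandwich -(nrm_Hminus_to_K (_ c)).
rewrite (_ : (_ - S) _ = Hminus_to_K F ((rig F (T y) -
  K_to_Hminus F \ob S \ob Hplus_to_K F) c))//.
rewrite bopBE [X in _ = Hminus_to_K F X]bopBE bopB; congr (_ - _).
  rewrite -[LHS]/(Hminus_to_K F (rig F (T y) (K_to_Hplus F (Hplus_to_K F c)))).
  by rewrite Hplus_to_KK.
rewrite -[RHS]/(Hminus_to_K F (K_to_Hminus F (S (Hplus_to_K F c)))).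
by rewrite K_to_HminusK.
Qed.

(** Each term of the trace is <F^* W^* e_j, T F^* e_j>, at most a times the mean of |F^* W^* e_j|^2
    and |F^* e_j|^2; both sums are bounded by C because F is Hilbert-Schmidt. *)
Lemma tr_le_frame (T : 'B(H, H)) (a C : R) : 0 <= a ->
  (forall m, \sum_(0 <= k < m) (kappa F k)%:num ^+ 2 <= C) ->
  (forall x, nrm (T x) <= a * nrm x) ->
  tr_le (psi F) (F \ob T \ob adj F) (a * C).
Proof.
move=> a0 kC Ta W WC n.
have h1 := hilbert_schmidt_frame n kC (contraction_adj WC).
have bC : contraction_op (bid K) by move=> x; exact: lexx.
have h2 := hilbert_schmidt_frame n kC bC.
apply: le_trans (_ : \sum_(0 <= j < n) a * (2^-1 *
    nrm (adj F (adj W (psi F j))) ^+ 2 + 2^-1 * nrm (adj F (psi F j)) ^+ 2) <= _).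
  apply: ler_sum => j _; rewrite !bcompE -adjP -adjP.
  apply: le_trans (ler_Re_nrm _) _; apply: le_trans (Cauchy_Schwarz _ _) _.
  set p := adj F (adj W _); set q := adj F _.
  apply: le_trans (_ : nrm p * (a * nrm q) <= _); first by rewrite ler_wpM2l.
  rewrite mulrCA ler_wpM2l//; have := sqr_ge0 (nrm p - nrm q); lra.
rewrite -mulr_sumr ler_wpM2l// big_split/= -!mulr_sumr.
by move: h1 h2; rewrite /=; lra.
Qed.

Variables (A : linop H) (lam : R).
Hypotheses (Asa : self_adjoint A) (lamA : Lambda F A lam).

Local Notation Rz y := (resolvent A (lam +i* y)).
Local Notation bd := (resolvent_bd F A lam).

Lemma resolvent_bd_cvg : opnorm (rig F (Rz y) - bd) @[y --> 0^'+] --> 0%E.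
Proof.
have [[S /opnorm_cvg_rig SP] _] := lamA.
have TP : [set T : 'B(Hplus F, Hminus F) |
    opnorm (rig F (Rz y) - T) @[y --> 0^'+] --> 0%E]
    (K_to_Hminus F \ob S \ob Hplus_to_K F) by exact: SP.
by have := @xgetPex _ 0 _ (ex_intro _ _ TP); apply.
Qed.

Lemma resolvent_bd_adj_cvg :
  opnorm (rig F (resolvent A (lam -i* y)) - rig_adj bd) @[y --> 0^'+] --> 0%E.
Proof.
apply/opnorm_cvgP => e e0; have /opnorm_cvgP/(_ _ e0) := resolvent_bd_cvg.
have : \forall y \near (0 : R)^'+, 0 < y by exact: near_at_right0.
apply: filterS2 => y y0 h.
have -> : rig F (resolvent A (lam -i* y)) = rig_adj (rig F (Rz y)).
  by rewrite rig_adj_rig resolvent_conj//= gt_eqF.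
by rewrite -rig_adjB; exact: rig_adj_bound.
Qed.

Lemma rig_im_cvg f : rig F (im_op (Rz y)) f @[y --> 0^'+] --> rig_im bd f.
Proof.
rewrite rig_imE.
have : (2 * 'i)^-1 *: (rig F (Rz y) f - rig F (resolvent A (lam -i* y)) f)
    @[y --> 0^'+] --> (2 * 'i)^-1 *: (bd f - rig_adj bd f).
  apply: cvgZr; apply: cvgB.
    by apply: opnorm_cvg_app resolvent_bd_cvg _; exact: cvg_cst.
  by apply: opnorm_cvg_app resolvent_bd_adj_cvg _; exact: cvg_cst.
apply: cvg_trans; apply: near_eq_cvg; apply: near_at_right0 => y y0.
rewrite /rig !bcompE /im_op bopZE bopBE resolvent_conj ?gt_eqF//=.
by rewrite bopZ bopB.
Qed.

(** The pairing is the limit of y |R_{lam + iy} f|^2. *)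
Lemma rig_im_nonneg f : 0 <= pairing f (rig_im bd f).
Proof.
have Im0 : complex.Im (pairing f (rig_im bd f)) = 0.
  have := rig_im_sym bd f f; rewrite pairing_conj.
  by case: (pairing f _) => a b [] /= ?; lra.
suff : 0 <= complex.Re (pairing f (rig_im bd f)).
  move: Im0; rewrite lecE; case: (pairing f _) => a b /= -> ->.
  by rewrite eqxx.
have h : complex.Re (ip f (sharp F (rig F (im_op (Rz y)) f))) @[y --> 0^'+] -->
    complex.Re (ip f (sharp F (rig_im bd f))).
  apply: cvg_ip; apply: continuous_cvg; first exact: bop_continuous.
  exact: rig_im_cvg.
rewrite pairing_sharp -(cvg_lim _ h)//; apply: limr_ge.
  by apply/cvg_ex; eexists; exact: h.
apply: near_at_right0 => y y0; rewrite -pairing_sharp rigE im_op_resolvent ?gt_eqF//.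
have -> : resolvent A (lam -i* y) = adj (Rz y).
  by rewrite resolvent_conj//= gt_eqF.
by rewrite ipZr adjP' ip_self/= mul0r subr0 mulr_ge0 ?sqr_ge0// ltW.
Qed.

Lemma rig_im_trace : 
  trnorm (Hplus_basis F) (rig F (im_op (Rz y)) - rig_im bd) @[y --> 0^'+] --> 0%E
  /\ exists c, tr_le (Hplus_basis F) (rig_im bd) c.
Proof.
have [_ [T TP]] := lamA; have psiB := psi_basis F.
pose D := K_to_Hminus F \ob T \ob Hplus_to_K F.
have DE : Hminus_to_K F \ob D \ob K_to_Hplus F = T.
  apply: bop_ext => k; rewrite /D.
  rewrite -[LHS]/(Hminus_to_K F (K_to_Hminus F (T (Hplus_to_K F (K_to_Hplus F k))))).
  by rewrite K_to_HminusK K_to_HplusK.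
have Dcvg : trnorm (Hplus_basis F) (rig F (im_op (Rz y)) - D) @[y --> 0^'+] --> 0%E.
  apply/(trnorm_cvgP _ (Hplus_basis_basis F)) => e e0.
  have /(trnorm_cvgP _ psiB)/(_ _ e0) := TP; apply: filterS => y h.
  apply: tr_le_rig; rewrite (_ : _ \ob _ = F \ob im_op (Rz y) \ob adj F - T)//.
  by rewrite frame_sandwich -DE; exact: bcomp_sandwichB.
(* The trace norm limit and the imaginary part of the norm limit agree on the basis, where both are
   limits of the same vectors. *)
have Dim : D = rig_im bd.
  apply: Hplus_basis_ext => j.
  have h : rig F (im_op (Rz y)) (Hplus_basis F j) @[y --> 0^'+] -->
      D (Hplus_basis F j).
    by apply: trnorm_cvg_app Dcvg; exact: Hplus_basis_basis.
  have h' : rig F (im_op (Rz y)) (Hplus_basis F j) @[y --> 0^'+] -->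
      rig_im bd (Hplus_basis F j) by exact: rig_im_cvg.
  exact: cvg_nrm_unique h h'.
rewrite -Dim; split=> //.
have kC m : \sum_(0 <= k < m) (kappa F k)%:num ^+ 2 <=
    limn (series (fun j => (kappa F j)%:num ^+ 2)).
  apply: nondecreasing_cvgn_le; last exact: kappa_l2.
  by apply: nondecreasing_series => j _ _; exact: sqr_ge0.
(* One y at which the trace norm distance to the limit T is at most 1 suffices: at that y the
   sandwiched Im R is a bounded operator between two Hilbert-Schmidt factors, hence trace class, and
   T differs from it by at most 1. *)
have [y hy] : exists y,
    tr_le (psi F) (F \ob im_op (Rz y) \ob adj F - T) 1.
  apply: (@filter_ex _ (0 : R)^'+).
  by have /(trnorm_cvgP _ psiB) := TP; apply; exact: ltr01.
have [a a0 Ta] := bop_bound (im_op (Rz y)).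
have hT := tr_leD (tr_le_frame (ltW a0) kC Ta) (tr_leN hy).
exists (a * limn (series (fun j => (kappa F j)%:num ^+ 2)) + 1).
by apply: tr_le_rig; rewrite DE; move: hT; rewrite opprB addrC subrK.
Qed.

End BoundaryValues.

(** * The evaluation operator *)

Section EvaluationOperator.
Variables (R : realType) (H K : hilbertType R) (F : frame H K).
Variables (A : linop H) (lam : R).
Hypotheses (Asa : self_adjoint A) (lamA : Lambda F A lam).

Local Notation im := (rig_im (resolvent_bd F A lam)).
Local Notation from_l2 := (reweight (unit_weight R) (kappaV F)).
Local Notation to_l2 := (reweight (kappaV F) (unit_weight R)).

(** The matrix phi is that of Im R / pi carried to l2 by the reweighting unitaries. This bounded
    operator is the witness that [phi_op] needs. *)
Lemma ip_phi_op (b b' : l2 R) :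
  ip b (phi_op F A lam b') = (pi^-1)%:C * pairing (from_l2 b) (im (from_l2 b')).
Proof.
have [T TE] : exists T : 'B(l2 R, l2 R), forall c, T c =
    (pi^-1)%:C *: reweight (kappa F) (unit_weight R) (im (from_l2 c)).
  exists ((pi^-1)%:C *: (reweight (kappa F) (unit_weight R) \ob im \ob from_l2)).
  by move=> c; rewrite bopZE 2!bcompE.
have TP : [set T : 'B(l2 R, l2 R) | forall i j, T (wl2_delta _ j) i =
    phi_mx F A lam i j] T.
  move=> i j; rewrite TE.
  have -> : from_l2 (wl2_delta _ j) = (kappa F j)%:num%:C *: wl2_delta (kappaV F) j.
    apply: wl2_ext => k; rewrite reweightE div1r invrK.
    rewrite -[RHS]/((kappa F j)%:num%:C * (k == j)%:R).
    rewrite -[wl2_delta _ j k]/((k == j)%:R).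
    by have [->|] := eqVneq k j; rewrite ?mulr0.
  rewrite (bopZ im) (bopZ (reweight (kappa F) (unit_weight R))).
  rewrite -[LHS]/((pi^-1)%:C * ((kappa F j)%:num%:C *
    reweight (kappa F) (unit_weight R) (im (wl2_delta (kappaV F) j)) i)).
  rewrite reweightE /phi_mx pairing_delta divr1 !rmorphM/=; ring.
have -> : phi_op F A lam = T.
  have h : forall i j, phi_op F A lam (wl2_delta _ j) i = phi_mx F A lam i j.
    by have := @xgetPex _ 0 _ (ex_intro _ _ TP); apply.
  by apply: bop_delta_ext => j; apply: wl2_ext => i; rewrite h TP.
rewrite TE ipZr pairing_sharp; congr (_ * _).
rewrite -(@ip_reweight _ _ (kappaV F)); congr (ip _ _).
apply: wl2_ext => j; rewrite !reweightE mulrA -rmorphM/=; congr (_%:C * _).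
by field; rewrite gt_eqF.
Qed.

Lemma phi_op_nonneg : nonneg_op (phi_op F A lam).
Proof.
move=> b; rewrite ip_phi_op mulr_ge0//; first by rewrite ler0c invr_ge0 pi_ge0.
exact: rig_im_nonneg.
Qed.

Lemma eval_opE f : eval_op F A lam f = sqrt_op (phi_op F A lam) (to_l2 f).
Proof.
pose E : 'B(Hplus F, l2 R) := sqrt_op (phi_op F A lam) \ob to_l2.
have cv (b : l2 R) : series (fun j => b j *: Defs.eta F A lam j) @ \oo -->
    sqrt_op (phi_op F A lam) b.
  rewrite (_ : series _ = sqrt_op (phi_op F A lam) \o
      series (fun j => b j *: wl2_delta (unit_weight R) j)).
    by apply: continuous_cvg; [exact: bop_continuous|exact: wl2_expansion].
  apply/funext => n; rewrite [RHS]/comp /series bop_sum.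
  by apply: eq_bigr => j _; rewrite bopZ.
have bE (b : l2 R) (g : Hplus F) :
    (forall j, g j = (kappa F j)%:num%:C * b j) -> b = to_l2 g.
  move=> gb; apply: wl2_ext => j; rewrite reweightE gb mulrA -rmorphM/=.
  by rewrite divr1 mulVf// mul1r.
have EP : [set E : 'B(Hplus F, l2 R) | forall (b : l2 R) (f : Hplus F),
    (forall j, f j = (kappa F j)%:num%:C * b j) ->
      series (fun j => b j *: Defs.eta F A lam j) @ \oo --> E f] E.
  by move=> b g /bE bg; rewrite /E bcompE -bg; exact: cv.
have eP : forall (b : l2 R) (f : Hplus F),
    (forall j, f j = (kappa F j)%:num%:C * b j) ->
      series (fun j => b j *: Defs.eta F A lam j) @ \oo --> eval_op F A lam f.
  by have := @xgetPex _ 0 _ (ex_intro _ _ EP); apply.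
have h : series (fun j => to_l2 f j *: Defs.eta F A lam j) @ \oo --> eval_op F A lam f.
  apply: eP => j; rewrite reweightE mulrA -rmorphM/= divr1 mulfV ?mul1r//.
by rewrite -(cvg_lim _ h)//; apply/cvg_lim => //; exact: cv.
Qed.

Lemma ip_eval_op f g :
  ip (eval_op F A lam f) (eval_op F A lam g) = (pi^-1)%:C * pairing f (im g).
Proof.
have [S0 SS] := sqrt_opP phi_op_nonneg.
rewrite !eval_opE nonneg_sym// -[sqrt_op _ (sqrt_op _ _)]/((_ \ob _) _) SS.
by rewrite ip_phi_op !reweightK.
Qed.

Lemma ip_eval_fiber f g :
  ip (eval_fiber F A lam f) (eval_fiber F A lam g) =
  (pi^-1)%:C * pairing f (im g).
Proof. exact: ip_eval_op. Qed.

(** Up to the Riesz isomorphism [flat], the operator E^diamond is the adjoint of E into the fibre,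
    so the left side is E^* E f. *)
Lemma eval_diamond_fiber f :
  eval_diamond F A lam (eval_fiber F A lam f) = (pi^-1)%:C *: im f.
Proof.
have DP : [set D : 'B(crange (eval_op F A lam), Hminus F) |
    forall u g, pairing (D u) g = ip (crange_val u) (eval_op F A lam g)]
    (flat F \ob adj (eval_fiber F A lam)).
  by move=> u g /=; rewrite pairing_sharpl flatK adjP.
have dP : forall u g, pairing (eval_diamond F A lam u) g =
    ip (crange_val u) (eval_op F A lam g).
  by have := @xgetPex _ 0 _ (ex_intro _ _ DP); apply.
apply: pairing_inj => c; rewrite -[LHS]conjcK -[RHS]conjcK; congr (_^*).
rewrite -!pairing_conj dP -[LHS]/(ip (eval_op F A lam f) _) ip_eval_op.
by rewrite -rig_im_sym [RHS]pairing_sharpl (bopZ (sharp F)) ipZl conjCR -pairing_sharpl.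
Qed.

End EvaluationOperator.

Lemma resolvent_comm (R : realType) (H : hilbertType R) (A : linop H)
    (z w : R[i]) f : self_adjoint A -> complex.Im z != 0 -> complex.Im w != 0 ->
  resolvent A w (resolvent A z f) = resolvent A z (resolvent A w f).
Proof.
move=> Asa z0 w0; have [->//|zw] := eqVneq z w.
have zw0 : z - w != 0 by rewrite subr_eq0.
apply: (scalerI zw0); rewrite -resolvent_first//.
by rewrite -[z - w]opprB scaleNr -resolvent_first// opprB.
Qed.

(** W is obtained through its adjoint: for each v the functional f -> <v, L f> is dominated by |v|
    |T f|, so the Riesz lemma represents it by a vector of the closed range, of norm at most |v|.
    This replaces extension by continuity from the range of T. *)
Lemma isometry_factor (R : realType) (U V M : hilbertType R) (T : 'B(U, V))
    (L : U -> M) : linear L -> (forall f, nrm (L f) <= nrm (to_crange T f)) ->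
  exists W : 'B(crange T, M), forall f, W (to_crange T f) = L f.
Proof.
move=> Llin LT.
have /choice[S SP] : forall v, exists w : crange T,
    (forall f, ip v (L f) = ip w (to_crange T f)) /\ nrm w <= nrm v.
  move=> v; have [] := @riesz_rep _ U (crange T) setT (to_crange T)
     (fun f => ip v (L f)) (nrm v).
  - by [].
  - by [].
  - by move=> a f g _ _; exact: bop_linear.
  - by move=> a f g _ _; rewrite Llin ipDr ipZr.
  - move=> f _; apply: le_trans (Cauchy_Schwarz _ _) _.
    by rewrite ler_wpM2l.
  move=> w [wP wv]; exists w; split=> [f|]; first exact: wP.
  have [->|w0] := eqVneq (nrm w) 0; first by [].
  have wp : 0 < nrm w by rewrite lt0r w0/=.
  by rewrite -(ler_pM2r wp) -expr2.
have Slin : linear S.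
  move=> a u v; apply: crange_ip_ext => f; rewrite ip_conj [RHS]ip_conj; congr (_^*).
  by have [<- _] := SP (a *: u + v); rewrite !ipDl !ipZl; have [-> _] := SP u;
    have [-> _] := SP v.
have SC u : nrm (S u) <= 1 * nrm u by rewrite mul1r; have [_] := SP u.
have [B BE] := mkbop_bound Slin SC.
exists (adj B) => f; apply: ip_ext => v; rewrite adjP' BE.
by have [-> _] := SP v.
Qed.

(** * The scattering matrix *)

(* Here s and r stand for R_{lam + i0}(H_0) and R_{lam + i0}(H_r), and v for V_r. *)
Section ResolventAlgebra.
Variables (R : realType) (H K : hilbertType R) (F : frame H K).
Variables (r s : 'B(Hplus F, Hminus F)) (v : 'B(Hminus F, Hplus F)).
Hypothesis srvs : forall g, s g = r g + r (v (s g)).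
Hypothesis srsv : forall g, s g = r g + s (v (r g)).
Hypothesis vsym : forall u w, pairing u (v w) = pairing (v u) w.
Local Notation s' := (rig_adj s).
Local Notation r' := (rig_adj r).

(** Since v is symmetric, the adjoint turns r v s into s' v r'; each form of the resolvent identity
    thus yields the other one for the adjoints. *)
Lemma rig_adj_second_resolvent g : s' g = r' g + s' (v (r' g)).
Proof.
apply: pairing_inj => f; rewrite pairingDr.
rewrite (rig_adjP' s g f) (rig_adjP' r g f) (rig_adjP' s (v (r' g)) f).
rewrite (vsym (s f) (r' g)) (rig_adjP' r g (v (s f))).
by rewrite -pairingDl' -srvs.
Qed.

Lemma rig_adj_second_resolvent' g : s' g = r' g + r' (v (s' g)).
Proof.
apply: pairing_inj => f; rewrite pairingDr.
rewrite (rig_adjP' s g f) (rig_adjP' r g f) (rig_adjP' r (v (s' g)) f).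
rewrite (vsym (r f) (s' g)) (rig_adjP' s g (v (r f))).
by rewrite -pairingDl' -srsv.
Qed.

Let rvs g : r (v (s g)) = s g - r g.
Proof. by rewrite [in RHS]srvs addrC addKr. Qed.

Let svr g : s (v (r g)) = s g - r g.
Proof. by rewrite [in RHS]srsv addrC addKr. Qed.

Let s'vr' g : s' (v (r' g)) = s' g - r' g.
Proof. by rewrite [in RHS]rig_adj_second_resolvent addrC addKr. Qed.

Let r'vs' g : r' (v (s' g)) = s' g - r' g.
Proof. by rewrite [in RHS]rig_adj_second_resolvent' addrC addKr. Qed.

(* Boundary form, from the two sides of the real axis, of the fact that
   y R_{conj z}(H_r) R_z(H_0) is both (1 - R_{conj z}(H_r) V_r) Im R_z(H_0) and
   Im R_z(H_r) (1 + V_r R_z(H_0)). *)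
Lemma wave_identity_plus g :
  rig_im s g - r' (v (rig_im s g)) = rig_im r (g + v (s g)).
Proof.
rewrite (rig_imE s) (rig_imE r) (bopZ v) (bopZ r') -scalerBr; congr (_ *: _).
rewrite (bopB v) (bopB r') r'vs' (bopD r) (bopD r') rvs.
rewrite [r g + _]addrC subrK opprB -addrA; congr (_ + _).
by rewrite !addrA addNr sub0r opprD.
Qed.

Lemma wave_identity_minus g :
  rig_im s g - r (v (rig_im s g)) = rig_im r (g + v (s' g)).
Proof.
rewrite (rig_imE s) (rig_imE r) (bopZ v) (bopZ r) -scalerBr; congr (_ *: _).
rewrite (bopB v) (bopB r) rvs (bopD r) (bopD r') r'vs'.
rewrite [r' g + _]addrC subrK addrAC; congr (_ - _).
by rewrite !opprB addrC -addrA subrK addrC.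
Qed.

(** Moving 1 + v s to the other side gives 1 + s' v, which is inverse to the factor 1 - r' v of the
    wave identity. For f = g this is the norm equality that lets w_+ pass from the range of E(H_0)
    to its closure. *)
Lemma wave_isometry_plus f g :
  pairing (f + v (s f)) (rig_im r (g + v (s g))) = pairing f (rig_im s g).
Proof.
rewrite -wave_identity_plus; set x := rig_im s g.
rewrite pairingDl -vsym -rig_adjP' -pairingDr; congr pairing.
by rewrite (bopB v) (bopB s') s'vr' subKr subrK.
Qed.

Lemma wave_isometry_minus f g :
  pairing (f + v (s' f)) (rig_im r (g + v (s' g))) = pairing f (rig_im s g).
Proof.
rewrite -wave_identity_minus; set x := rig_im s g.
rewrite pairingDl -vsym rig_adjP -pairingDr; congr pairing.
by rewrite (bopB v) (bopB s) svr subKr subrK.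
Qed.

Lemma scattering_identity f g (x := rig_im s g) (y := x - r (v x)) :
  pairing (f + v (s f)) (rig_im r (g + v (s' g))) =
  pairing f (x - (2 * 'i) *: rig_im s (v y)).
Proof.
rewrite -wave_identity_minus -/x -/y pairingDl -vsym -rig_adjP' -pairingDr.
congr pairing; rewrite rig_imE scalerA mulfV ?scale1r; last first.
  by rewrite mulf_neq0 ?pnatr_eq0// neq0Ci.
have yx : y + s (v y) = x.
  by rewrite /y (bopB v) (bopB s) svr subKr subrK.
by rewrite -yx opprB addrA addrAC addrK.
Qed.

Lemma resolvent_inverse_left u : u + s (v u) - r (v (u + s (v u))) = u.
Proof.
by rewrite (bopD v) (bopD r) rvs [r _ + _]addrC subrK addrK.
Qed.

Lemma resolvent_inverse_right u : u - r (v u) + s (v (u - r (v u))) = u.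
Proof.
by rewrite (bopB v) (bopB s) svr subKr subrK.
Qed.

End ResolventAlgebra.

(** * The second resolvent identity and its boundary values *)

Section TwoOperators.
Variables (R : realType) (H K : hilbertType R) (F : frame H K).
Variables (H0 : linop H) (J : 'B(K, K)) (lam : R).
Local Notation V := (frame_perturbation F J).
Local Notation H1 := (perturb H0 V).
Hypotheses (H0sa : self_adjoint H0) (H1sa : self_adjoint H1).
Hypothesis Jsa : self_adjoint_bop J.
Hypotheses (lam1 : Lambda F H1 lam) (lam0 : Lambda F H0 lam).
Local Notation v := (rig_perturb F V).
Local Notation s := (resolvent_bd F H0 lam).
Local Notation r := (resolvent_bd F H1 lam).

(** The perturbed operator keeps the domain, and x = R_z(H_0) f solves (H_0 + V - z) x = f + V x. *)
Lemma second_resolvent (z : R[i]) f : complex.Im z != 0 ->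
  resolvent H0 z f = resolvent H1 z f + resolvent H1 z (V (resolvent H0 z f)).
Proof.
move=> z0; rewrite -bopD; apply: resolvent_eq => //.
  exact: (resolvent_dom H0sa z0).
by rewrite /= resolventE// addrAC.
Qed.

Lemma second_resolvent' (z : R[i]) f : complex.Im z != 0 ->
  resolvent H0 z f = resolvent H1 z f + resolvent H0 z (V (resolvent H1 z f)).
Proof.
move=> z0; apply/eqP; rewrite -subr_eq; apply/eqP; rewrite -bopB.
apply/esym/resolvent_eq => //; first exact: (resolvent_dom H1sa z0).
have E : H0 (resolvent H1 z f) + V (resolvent H1 z f) = f + z *: resolvent H1 z f.
  exact: (resolventE H1sa z0 f).
by rewrite -[LHS](addrK (V (resolvent H1 z f))) E addrAC.
Qed.

Lemma rig_second_resolvent (z : R[i]) g : complex.Im z != 0 ->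
  rig F (resolvent H0 z) g =
  rig F (resolvent H1 z) g + rig F (resolvent H1 z) (v (rig F (resolvent H0 z) g)).
Proof.
move=> z0; rewrite /rig !bcompE [in LHS]second_resolvent// bopD; congr (_ + _).
by rewrite frame_perturbation_rig.
Qed.

Lemma rig_second_resolvent' (z : R[i]) g : complex.Im z != 0 ->
  rig F (resolvent H0 z) g =
  rig F (resolvent H1 z) g + rig F (resolvent H0 z) (v (rig F (resolvent H1 z) g)).
Proof.
move=> z0; rewrite /rig !bcompE [in LHS]second_resolvent'// bopD; congr (_ + _).
by rewrite frame_perturbation_rig.
Qed.

Lemma bd_second_resolvent g : s g = r g + r (v (s g)).
Proof.
have cs : rig F (resolvent H0 (lam +i* y)) g @[y --> 0^'+] --> s g.
  by apply: opnorm_cvg_app (resolvent_bd_cvg lam0) _; exact: cvg_cst.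
have cr : rig F (resolvent H1 (lam +i* y)) g +
    rig F (resolvent H1 (lam +i* y)) (v (rig F (resolvent H0 (lam +i* y)) g))
    @[y --> 0^'+] --> r g + r (v (s g)).
  apply: cvgD.
    by apply: opnorm_cvg_app (resolvent_bd_cvg lam1) _; exact: cvg_cst.
  apply: opnorm_cvg_app (resolvent_bd_cvg lam1) _.
  by apply: continuous_cvg; [exact: bop_continuous|exact: cs].
have cs' : rig F (resolvent H0 (lam +i* y)) g @[y --> 0^'+] --> r g + r (v (s g)).
  apply: cvg_trans cr; apply: near_eq_cvg; apply: near_at_right0 => y y0.
  have z0 : complex.Im (lam +i* y) != 0 by rewrite /= gt_eqF.
  by rewrite -rig_second_resolvent.
exact: cvg_nrm_unique cs cs'.
Qed.

Lemma bd_second_resolvent' g : s g = r g + s (v (r g)).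
Proof.
have cs : rig F (resolvent H0 (lam +i* y)) g @[y --> 0^'+] --> s g.
  by apply: opnorm_cvg_app (resolvent_bd_cvg lam0) _; exact: cvg_cst.
have cr1 : rig F (resolvent H1 (lam +i* y)) g @[y --> 0^'+] --> r g.
  by apply: opnorm_cvg_app (resolvent_bd_cvg lam1) _; exact: cvg_cst.
have cr : rig F (resolvent H1 (lam +i* y)) g +
    rig F (resolvent H0 (lam +i* y)) (v (rig F (resolvent H1 (lam +i* y)) g))
    @[y --> 0^'+] --> r g + s (v (r g)).
  apply: cvgD; first exact: cr1.
  apply: opnorm_cvg_app (resolvent_bd_cvg lam0) _.
  by apply: continuous_cvg; [exact: bop_continuous|exact: cr1].
have cs' : rig F (resolvent H0 (lam +i* y)) g @[y --> 0^'+] --> r g + s (v (r g)).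
  apply: cvg_trans cr; apply: near_eq_cvg; apply: near_at_right0 => y y0.
  have z0 : complex.Im (lam +i* y) != 0 by rewrite /= gt_eqF.
  by rewrite -rig_second_resolvent'.
exact: cvg_nrm_unique cs cs'.
Qed.

Lemma pairing_v_sym u w : pairing u (v w) = pairing (v u) w.
Proof. exact: rig_perturb_sym. Qed.

End TwoOperators.

Lemma scaler_subBl (R : pzRingType) (V : lmodType R) (a : R) (x y z : V) :
  a *: (x - y) - a *: (x - z) = - a *: (y - z).
Proof. by rewrite -scalerBr scaleNr -scalerN !opprB addrC addrA subrK. Qed.

(** * Wave forms and wave matrices *)

Section WaveMatrix.
Variables (R : realType) (H K : hilbertType R) (F : frame H K).
Variables (H0 : linop H) (J : 'B(K, K)) (lam : R).
Local Notation V := (frame_perturbation F J).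
Local Notation H1 := (perturb H0 V).
Hypotheses (H0sa : self_adjoint H0) (H1sa : self_adjoint H1).
Hypotheses (lam0 : Lambda F H0 lam).
Local Notation v := (rig_perturb F V).
Local Notation s := (resolvent_bd F H0 lam).

(** For both signs the right factor is the same Im R_{lam + iy}(H_0), since the two resolvents of
    H_0 in it commute; only the resolvent of the perturbed operator feels the sign. *)
Lemma wave_form_factor (t y : R) : t = 1 \/ t = -1 -> 0 < y ->
  (y / pi)%:C *: rig F (resolvent H1 (lam -i* (t * y)) \ob
                        resolvent H0 (lam +i* (t * y))) =
  ((pi^-1)%:C *: (bid _ - rig F (resolvent H1 (lam -i* (t * y))) \ob v)) \ob
    rig F (im_op (resolvent H0 (lam +i* y))).
Proof.
move=> t1 y0; have ty0 : t * y != 0.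
  by case: t1 => ->; rewrite ?mul1r ?mulN1r ?oppr_eq0 gt_eqF.
set z := lam -i* (t * y); set w := lam +i* (t * y).
have z0 : complex.Im z != 0 by rewrite /= oppr_eq0.
have w0 : complex.Im w != 0 by [].
have imE x : im_op (resolvent H0 (lam +i* y)) x =
    y%:C *: resolvent H0 z (resolvent H0 w x).
  rewrite im_op_resolvent ?gt_eqF//; congr (_ *: _); rewrite /z /w.
  case: t1 => ->; rewrite ?mul1r// mulN1r opprK.
  by rewrite resolvent_comm//= ?oppr_eq0 gt_eqF.
apply: bop_ext => g; rewrite bopZE bcompE bopZE bopBE bidE bcompE.
rewrite (_ : rig F (im_op _) g = y%:C *: emb F (resolvent H0 z (resolvent H0 w
   (Defs.incl F g)))); last by rewrite /rig 2!bcompE imE bopZ.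
rewrite (bopZ v) (bopZ (rig F _)) -scalerBr scalerA mulrC -rmorphM/=.
congr (_ *: _).
transitivity (emb F (resolvent H1 z (resolvent H0 w (Defs.incl F g)))); first by [].
move: (resolvent H0 w (Defs.incl F g)) => x.
rewrite -(frame_perturbation_rig F J (resolvent H0 z x)).
rewrite -(bopB (emb F)); congr (emb F _).
by apply/esym/eqP; rewrite subr_eq; exact/eqP/second_resolvent.
Qed.

(** [rt] is the boundary value on the side chosen by t, which is r' for t = 1 and r for t = -1, so
    one argument covers both wave forms. *)
Lemma wave_formE (t : R) (rt : 'B(Hplus F, Hminus F)) g : t = 1 \/ t = -1 ->
  opnorm (rig F (resolvent H1 (lam -i* (t * y))) - rt) @[y --> 0^'+] --> 0%E ->
  wave_form F H1 H0 lam t g =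
  (pi^-1)%:C *: (rig_im s g - rt (v (rig_im s g))).
Proof.
move=> t1 rtP; have bB := Hplus_basis_basis F.
pose C0 := (pi^-1)%:C *: (bid (Hminus F) - rt \ob v).
have [Dcvg [c Dc]] := rig_im_trace H0sa lam0.
have aP : trnorm (Hplus_basis F) ((y / pi)%:C *:
    rig F (resolvent H1 (lam -i* (t * y)) \ob resolvent H0 (lam +i* (t * y)))
    - C0 \ob rig_im s) @[y --> 0^'+] --> 0%E.
  have : trnorm (Hplus_basis F) (((pi^-1)%:C *: (bid _ -
      rig F (resolvent H1 (lam -i* (t * y))) \ob v)) \ob
      rig F (im_op (resolvent H0 (lam +i* y))) - C0 \ob rig_im s)
      @[y --> 0^'+] --> 0%E.
    apply: trnorm_cvg_comp bB Dc _ Dcvg; apply/opnorm_cvgP => e e0.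
    have [M M0 vM] := bop_bound v.
    (* The tolerance compensates the bound M of v and the prefactor 1 / pi. *)
    have e1 : 0 < e * pi / M by rewrite divr_gt0// mulr_gt0// pi_gt0.
    have /opnorm_cvgP/(_ _ e1) := rtP; apply: filterS => y h x.
    rewrite /C0 scaler_subBl bopZE bopBE (bcompE (rig F _) v)
      (bcompE rt v) -bopBE.
    rewrite nrmZ nrmN nrm_real ger0_norm ?invr_ge0 ?pi_ge0//.
    rewrite ler_pdivrMl ?pi_gt0//; apply: le_trans (h (v x)) _.
    apply: (@le_trans _ _ (e * pi / M * (M * nrm x))).
      by rewrite ler_wpM2l// ltW.
    by rewrite mulrA divfK ?gt_eqF// mulrAC mulrC mulrA.
  apply: cvg_trans; apply: near_eq_cvg; apply: near_at_right0 => y y0.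
  by rewrite wave_form_factor.
have wP : trnorm (Hplus_basis F) ((y / pi)%:C *:
    rig F (resolvent H1 (lam -i* (t * y)) \ob resolvent H0 (lam +i* (t * y)))
    - wave_form F H1 H0 lam t) @[y --> 0^'+] --> 0%E.
  have TP : [set a : 'B(Hplus F, Hminus F) | trnorm (Hplus_basis F) ((y / pi)%:C *:
    rig F (resolvent H1 (lam -i* (t * y)) \ob resolvent H0 (lam +i* (t * y)))
    - a) @[y --> 0^'+] --> 0%E] (C0 \ob rig_im s) by exact: aP.
  by have := @xgetPex _ 0 _ (ex_intro _ _ TP); apply.
have -> : wave_form F H1 H0 lam t = C0 \ob rig_im s.
  apply: Hplus_basis_ext => j.
  apply: cvg_nrm_unique (trnorm_cvg_app bB wP) (trnorm_cvg_app bB aP).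
by rewrite bcompE bopZE bopBE bidE bcompE.
Qed.

Hypothesis lam1 : Lambda F H1 lam.
Local Notation r := (resolvent_bd F H1 lam).

Lemma wave_form_plus g : wave_form F H1 H0 lam 1 g =
  (pi^-1)%:C *: (rig_im s g - rig_adj r (v (rig_im s g))).
Proof.
apply: wave_formE; first by left.
have E y : lam -i* (1 * y) = lam -i* y by rewrite mul1r.
by under eq_fun do rewrite E; exact: resolvent_bd_adj_cvg H1sa lam1.
Qed.

Lemma wave_form_minus g : wave_form F H1 H0 lam (-1) g =
  (pi^-1)%:C *: (rig_im s g - r (v (rig_im s g))).
Proof.
apply: wave_formE; first by right.
have E y : lam -i* (-1 * y) = lam +i* y by rewrite mulN1r opprK.
by under eq_fun do rewrite E; exact: resolvent_bd_cvg lam1.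
Qed.

(** L is a lift of the wave matrix to H_1. The first hypothesis says that it realises the wave form,
    the second that it descends to the fibres; together they provide the operator that [wave_mx]
    selects. *)
Lemma wave_mx_eval (t : R) (L : 'B(Hplus F, Hplus F)) :
  (forall f g, pairing f (wave_form F H1 H0 lam t g) =
     ip (eval_fiber F H1 lam f) (eval_fiber F H1 lam (L g))) ->
  (forall f, nrm (eval_fiber F H1 lam (L f)) <= nrm (eval_fiber F H0 lam f)) ->
  forall g, wave_mx F H1 H0 lam t (eval_fiber F H0 lam g) =
    eval_fiber F H1 lam (L g).
Proof.
move=> wL Lle g.
have Llin : linear (eval_fiber F H1 lam \o L).
  by move=> a x y; rewrite [LHS]/comp (bop_linear L) (bop_linear (eval_fiber _ _ _)).
have [W WE] := isometry_factor Llin Lle.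
have WP : [set W : 'B(crange (eval_op F H0 lam), crange (eval_op F H1 lam)) |
    forall f g, ip (eval_fiber F H1 lam f) (W (eval_fiber F H0 lam g)) =
                pairing f (wave_form F H1 H0 lam t g)] W.
  by move=> f h; rewrite wL WE.
have wP : forall f g, ip (eval_fiber F H1 lam f)
    (wave_mx F H1 H0 lam t (eval_fiber F H0 lam g)) =
    pairing f (wave_form F H1 H0 lam t g).
  by have := @xgetPex _ 0 _ (ex_intro _ _ WP); apply.
by apply: crange_ip_ext => f; rewrite wP wL.
Qed.

End WaveMatrix.

(** * The stationary formula *)

Section StationaryFormula.
Variables (R : realType) (H K : hilbertType R) (F : frame H K).
Variables (r s : 'B(Hplus F, Hminus F)) (v : 'B(Hminus F, Hplus F)).
Hypothesis srvs : forall g, s g = r g + r (v (s g)).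
Hypothesis srsv : forall g, s g = r g + s (v (r g)).
Hypothesis vsym : forall u w, pairing u (v w) = pairing (v u) w.
Variables (E0 E1 : 'B(Hplus F, l2 R)).
Hypothesis ipE0 : forall f g,
  ip (to_crange E0 f) (to_crange E0 g) = (pi^-1)%:C * pairing f (rig_im s g).
Hypothesis ipE1 : forall f g,
  ip (to_crange E1 f) (to_crange E1 g) = (pi^-1)%:C * pairing f (rig_im r g).

(* For t = R_{lam +- i0}(H_0) this lifts w_+- to H_1: one has
   w_+- E(H_0) f = E(H_r) (1 + V_r t) f. *)
Definition wave_lift (t : 'B(Hplus F, Hminus F)) : 'B(Hplus F, Hplus F) :=
  bid _ + v \ob t.

Lemma wave_liftE t f : wave_lift t f = f + v (t f).
Proof. by []. Qed.

Lemma nrm_wave_lift_plus f :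
  nrm (to_crange E1 (wave_lift s f)) <= nrm (to_crange E0 f).
Proof.
rewrite -(@ler_pXn2r _ 2) ?nnegrE// -!Re_ip_self ipE0 ipE1 wave_liftE.
by rewrite (wave_isometry_plus srvs srsv vsym).
Qed.

Lemma nrm_wave_lift_minus f :
  nrm (to_crange E1 (wave_lift (rig_adj s) f)) <= nrm (to_crange E0 f).
Proof.
rewrite -(@ler_pXn2r _ 2) ?nnegrE// -!Re_ip_self ipE0 ipE1 wave_liftE.
by rewrite (wave_isometry_minus srvs srsv vsym).
Qed.

Lemma wave_lift_plusP (a : Hplus F -> Hminus F) :
  (forall g, a g = (pi^-1)%:C *: (rig_im s g - rig_adj r (v (rig_im s g)))) ->
  forall f g, pairing f (a g) =
    ip (to_crange E1 f) (to_crange E1 (wave_lift s g)).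
Proof.
move=> aE f g; rewrite aE pairingZr (wave_identity_plus srvs srsv vsym).
by rewrite ipE1 wave_liftE.
Qed.

Lemma wave_lift_minusP (a : Hplus F -> Hminus F) :
  (forall g, a g = (pi^-1)%:C *: (rig_im s g - r (v (rig_im s g)))) ->
  forall f g, pairing f (a g) =
    ip (to_crange E1 f) (to_crange E1 (wave_lift (rig_adj s) g)).
Proof.
move=> aE f g; rewrite aE pairingZr (wave_identity_minus srvs srsv vsym).
by rewrite ipE1 wave_liftE.
Qed.

Lemma resolvent_factor_left :
  (bid _ - r \ob v) \ob (bid _ + s \ob v) = bid (Hminus F).
Proof. by apply: bop_ext => u; exact: resolvent_inverse_left srvs u. Qed.

Lemma resolvent_factor_right :
  (bid _ + s \ob v) \ob (bid _ - r \ob v) = bid (Hminus F).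
Proof. by apply: bop_ext => u; exact: resolvent_inverse_right srsv u. Qed.

Lemma stationary_formula (W1 W2 : 'B(crange E0, crange E1))
    (D : 'B(crange E0, Hminus F)) :
  (forall f, W1 (to_crange E0 f) = to_crange E1 (wave_lift s f)) ->
  (forall f, W2 (to_crange E0 f) = to_crange E1 (wave_lift (rig_adj s) f)) ->
  (forall f, D (to_crange E0 f) = (pi^-1)%:C *: rig_im s f) ->
  adj W1 \ob W2 = bid _ - (2 * pi%:C * 'i) *:
    (to_crange E0 \ob v \ob (bid _ - r \ob v) \ob D).
Proof.
move=> W1E W2E DE; set B := bid _ - r \ob v.
have BE u : B u = u - r (v u) by [].
move: B BE => B BE; apply: bop_crange_ext => g; apply: crange_ip_ext => f.
rewrite bcompE adjP' W1E W2E ipE1 !wave_liftE.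
rewrite (scattering_identity srvs srsv vsym).
have -> : (bid _ - (2 * pi%:C * 'i) *: (to_crange E0 \ob v \ob B \ob D))
    (to_crange E0 g) = to_crange E0 g - (2 * pi%:C * 'i) *:
    to_crange E0 (v (B (D (to_crange E0 g)))) by [].
(* The correction term acquires 1 / pi twice, from [D] and from the inner product of the fibre,
   against once on the left; this is how 2 i becomes 2 pi i. *)
rewrite ipBr ipZr ipE0 DE (bopZ B) (bopZ v) (bopZ (to_crange E0)) ipZr ipE0 BE.
rewrite pairingBr [pairing f (_ *: rig_im s _)]pairingZr mulrBr; congr (_ - _).
set P := pairing f (rig_im s (v _)).
have pi0 : (pi : R)%:C != 0 :> R[i] by rewrite (inj_eq (@complexI R)) gt_eqF ?pi_gt0.
have piV : ((pi : R)^-1)%:C = (pi%:C)^-1 :> R[i] by rewrite fmorphV.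
by rewrite piV; move: (pi%:C) pi0 (P) => q q0 p; field.
Qed.

End StationaryFormula.

Theorem theorem8p5 (R : realType) (H K : hilbertType R) (F : frame H K)
    (H0 : linop H) (J : R -> 'B(K, K)) (r lam : R) :
  separable_space H -> separable_space K ->
  self_adjoint H0 ->
  (forall s, self_adjoint (perturb H0 (frame_perturbation F (J s)))) ->
  (forall s, self_adjoint_bop (J s)) ->
  J 0 = 0 -> opnorm_continuous J -> piecewise_analytic J ->
  Lambda F (perturb H0 (frame_perturbation F (J r))) lam ->
  Lambda F H0 lam ->
  let Vr : 'B(Hminus F, Hplus F) :=
    rig_perturb F (frame_perturbation F (J r)) in
  let A : 'B(Hminus F, Hminus F) :=
    bid (Hminus F) + resolvent_bd F H0 lam \ob Vr in
  exists Ainv : 'B(Hminus F, Hminus F),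
    [/\ Ainv \ob A = bid (Hminus F), A \ob Ainv = bid (Hminus F) &
     scattering_mx F (perturb H0 (frame_perturbation F (J r))) H0 lam =
       bid _ - (2 * pi%:C * 'i) *:
         (eval_fiber F H0 lam \ob Vr \ob Ainv \ob eval_diamond F H0 lam)].
Proof.
move=> _ _ H0sa Hsa Jsa _ _ _ lam1 lam0 Vr A.
have H1sa := Hsa r.
have srvs := bd_second_resolvent H0sa H1sa lam1 lam0.
have srsv := bd_second_resolvent' H0sa H1sa lam1 lam0.
have vsym := @pairing_v_sym _ _ _ F _ (Jsa r).
have ip0 := ip_eval_fiber H0sa lam0.
have ip1 := ip_eval_fiber H1sa lam1.
have dia := eval_diamond_fiber H0sa lam0.
have wf1 := wave_form_plus H0sa H1sa lam0 lam1.
have wf2 := wave_form_minus H0sa H1sa lam0 lam1.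
have n1 := nrm_wave_lift_plus srvs srsv vsym ip0 ip1.
have n2 := nrm_wave_lift_minus srvs srsv vsym ip0 ip1.
have W1E := wave_mx_eval (wave_lift_plusP srvs srsv vsym ip1 wf1) n1.
have W2E := wave_mx_eval (wave_lift_minusP srvs srsv vsym ip1 wf2) n2.
exists (bid _ - resolvent_bd F (perturb H0 (frame_perturbation F (J r))) lam \ob Vr).
split; first exact: resolvent_factor_left srvs.
  exact: resolvent_factor_right srsv.
exact: (stationary_formula srvs srsv vsym ip0 ip1 W1E W2E dia).
Qed.
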